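(* Let $X$ be a diffusion on $[0,\infty)$ on natural scale with speed measure $m$, absorbed at $0$, which comes down from infinity, and assume $$\int_0^1\frac1x\,\sup_{y\le x}\Big(\frac1y\int_{(0,y)}z^2\,m(dz)\Big)\,dx<\infty.$$ Then for every $t>0$ there exists $A_t<\infty$ such that $\mathbb{P}_x(t<\tau_\partial)\le A_t\,x$ for all $x>0$.
   Context: A diffusion on $[0,\infty)$ on natural scale with speed measure $m$ (locally finite positive measure on $(0,\infty)$ charging every nonempty open subset), absorbed at $0$: $X_t=B_{\sigma_t}$ for $t<\tau_\partial$, $X_t=0$ after, with $B$ standard Brownian motion, $A_s=\int L^y_s m(dy)$ ($L^y$ local times), $\sigma_t=\inf\{s:A_s>t\}$, $\tau_\partial$ the first hitting time of $0$. $X$ comes down from infinity iff $\int_1^\infty y\,m(dy)<\infty$. *)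

(* Defs.v *)
From HB Require Import structures.
From mathcomp Require Import all_boot all_order all_algebra.
From mathcomp Require Import all_classical all_reals all_analysis.
Set Implicit Arguments. Unset Strict Implicit. Unset Printing Implicit Defensive.
Import Order.TTheory GRing.Theory Num.Theory.
Import numFieldNormedType.Exports.
Local Open Scope classical_set_scope.
Local Open Scope ring_scope.

Section Defs.
Variable R : realType.
Notation leb := (@lebesgue_measure R).

Definition speed_measure (m : {measure set R -> \bar R}) : Prop :=
  [/\ m `]-oo, 0%R]%classic = 0%E,
      (forall a b : R, 0 < a -> a < b -> (m `[a, b]%classic < +oo)%E) &
      (forall a b : R, 0 <= a -> a < b -> (0 < m `]a, b[%classic)%E)].

Definition comes_down_from_infinity (m : {measure set R -> \bar R}) : Prop :=
  (\int[m]_(y in `[1%R, +oo[%classic) (y%:E) < +oo)%E.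

Definition Gm (m : {measure set R -> \bar R}) (y : R) : \bar R :=
  ((y^-1)%:E * \int[m]_(z in `]0%R, y[%classic) ((z ^+ 2)%:E))%E.

Definition Sm (m : {measure set R -> \bar R}) (x : R) : \bar R :=
  ereal_sup [set Gm m y | y in `]0%R, x]%classic].

Definition integral_condition (m : {measure set R -> \bar R}) : Prop :=
  (\int[leb]_(x in `]0%R, 1%R[%classic) ((x^-1)%:E * Sm m x) < +oo)%E.

Definition gauss_density (v u : R) : R :=
  expR (- (u ^+ 2) / (2 * v)) / Num.sqrt (2 * pi * v).

Definition is_BM_from {d} {T : measurableType d} (P : probability T R)
    (x : R) (B : R -> T -> R) : Prop :=
  [/\ (forall s, measurable_fun setT (B s)),
      (forall w, B 0 w = x),
      (forall w, {within `[0%R, +oo[%classic, continuous (fun s => B s w)}) &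
      (forall (n : nat) (t : nat -> R) (A : nat -> set R),
         0 <= t 0%N ->
         (forall i, (i < n)%N -> t i < t i.+1) ->
         (forall i, measurable (A i)) ->
         P (\bigcap_(i in [set i | (i < n)%N])
               [set w | A i (B (t i.+1) w - B (t i) w)])
         = (\prod_(i < n)
               \int[leb]_(u in A i) (gauss_density (t i.+1 - t i) u)%:E)%E)].

Definition is_local_time {d} {T : measurableType d} (P : probability T R)
    (B : R -> T -> R) (L : R -> R -> T -> R) : Prop :=
  {ae P, forall w,
     (forall y s, 0 <= L y s w) /\
     (forall p : R * R, {for p, continuous (fun q : R * R => L q.1 q.2 w)}) /\
     (forall s A, 0 <= s -> measurable A ->
        (leb (`[0%R, s]%classic `&` ((fun r => B r w) @^-1` A))
        = \int[leb]_(y in A) (L y s w)%:E)%E)}.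

Definition additive_functional (m : {measure set R -> \bar R})
    {T : Type} (L : R -> R -> T -> R) (s : R) (w : T) : \bar R :=
  (\int[m]_y (L y s w)%:E)%E.

(* sigma_t = inf {s >= 0 : A_s > t} (in \bar R, inf of empty set = +oo) *)
Definition time_change (m : {measure set R -> \bar R})
    {T : Type} (L : R -> R -> T -> R) (t : R) (w : T) : \bar R :=
  ereal_inf [set s%:E | s in [set s : R | 0 <= s /\ (t%:E < additive_functional m L s w)%E]].

Definition absorption_time (m : {measure set R -> \bar R})
    {T : Type} (B : R -> T -> R) (L : R -> R -> T -> R) (w : T) : \bar R :=
  ereal_inf [set u%:E | u in [set u : R | 0 <= u /\
     exists s : R, time_change m L u w = s%:E /\ B s w = 0]].

End Defs.

(* Main.v *)
(**
Starting from x, Brownian motion reaches 4^-k before 0 with probability of order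
4^k x.  Given that its running maximum is of this order, the clock A should exceed t
before absorption with probability at most e^(-lam_k t), where lam_k is of order 1/s_k
and s_k bounds 16 Sm(2 4^-k).  The integral condition says that the nonincreasing
sequence s_k is summable, so k s_k tends to 0, e^(-lam_k t) is eventually below 16^-k,
and the sum over k of 4^k x e^(-lam_k t) is O(x).

The bound on reaching the level and accumulating more than t on the clock comes from a pair of
positive functions f0 (of order x) and f1 (bounded) with f'' + 2 lam rho f <= 0, glued
at the level.  They are exponentials of sums over the scales 4^-j of fixed profiles
weighted by s_j, corrected by the potential of rho; summability of s_j keeps the
exponent bounded.  No stochastic calculus is needed: the estimate holds for the Gaussian random
walk obtained by sampling the path at mesh h, as a supermartingale inequality up to an error
o(h) per step, and passes to the path by continuity.  For a general m, one takes for
rho the smoothing by tent kernels of m restricted to a compact interval of positive numbers;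
the occupation formula and the continuity of L show that the corresponding
clocks are eventually at least A/2.
*)
Require Import Defs.
From HB Require Import structures.
From mathcomp Require Import all_boot all_order all_algebra.
From mathcomp Require Import all_classical all_reals all_analysis.
From mathcomp Require Import measurable_realfun.
From mathcomp Require Import zify ring lra.
Import Order.TTheory GRing.Theory Num.Theory.
Import numFieldNormedType.Exports.
Local Open Scope classical_set_scope.
Local Open Scope ring_scope.
Set Implicit Arguments. Unset Strict Implicit. Unset Printing Implicit Defensive.

(** * Outer probability and Markov chains *)

(** The hypotheses give the law of finitely many increments, continuity, and the occupation formula,
    so probabilities are bounded through measurable covers, and optional stopping is replaced by a
    walk that stores its clock and maximum. The analytic obstacle is that the integral condition
    controls the moments W(x), the integral of z^2 rho over [0, x], but not rho itself. For f = exp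
    Phi one has f''/f = Phi'' + Phi'^2. Subtracting 2 lam Q from Phi, with Q' = W / x^2, puts
    exactly - 2 lam rho into Phi'' and leaves the cost 4 lam W / x^3, which involves moments only. A
    small positive function b pays that cost. If x Phi' is b or 1 - b, then x^2 (Phi'' + Phi'^2) is
    - b + b^2 plus or minus x b', so the same b serves the bounded function and the one comparable
    to x, provided that it varies slowly in ln x. At scale 4^-j it has to be of order lam s_j, and
    being at most 1/8 forces lam to be of order 1/s_k. *)

Section outer_bounds.
Context d (T : measurableType d) (R : realType).
Variable P : {measure set T -> \bar R}.
Local Open Scope ereal_scope.

(** Bound on an outer measure, witnessed by a measurable cover: the events below involve infima and
    uncountably many times, and their measurability never has to be settled. *)
Definition outer_le (X : set T) (c : \bar R) :=
  exists E : set T, [/\ measurable E, X `<=` E & P E <= c].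

Lemma outer_le_sub X Y a b : Y `<=` X -> a <= b -> outer_le X a -> outer_le Y b.
Proof.
move=> YX ab [E [mE XE PE]]; exists E; split => //.
  exact: subset_trans XE.
exact: le_trans ab.
Qed.

(** Fatou's inequality for covers: the intersections of the covers from rank n on increase with n.
    It serves every passage to the limit: mesh, smoothing and cutoff near 0. *)
Lemma outer_le_liminf (X : set T) (Xn : (set T)^nat) (c : \bar R) :
  (forall w, X w -> exists n, forall k, (n <= k)%N -> Xn k w) ->
  (exists n, forall k, (n <= k)%N -> outer_le (Xn k) c) -> outer_le X c.
Proof.
move=> Xlim [n0 hn].
have /choice[E hE] : forall k, exists E, [/\ measurable E, Xn (n0 + k)%N `<=` E & P E <= c].
  by move=> k; apply: hn; rewrite leq_addr.
have mE k : measurable (E k) by have [] := hE k.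
pose F n := \bigcap_(k in [set k | (n <= k)%N]) E k.
have mF n : measurable (F n) by apply: bigcap_measurable => //; exists n => /=.
have ndF : nondecreasing_seq F.
  move=> n m nm; apply/subsetPset => w Fn k /= mk; apply: Fn => /=.
  exact: leq_trans mk.
exists (\bigcup_n F n); split.
- exact: bigcup_measurable.
- move=> w /Xlim[n hw]; exists n => // k /= nk; have [_ + _] := hE k; apply.
  by apply: hw; rewrite (leq_trans nk)// leq_addl.
- have cvgF : (P \o F) x @[x --> \oo] --> P (\bigcup_n F n).
    by apply: nondecreasing_cvg_mu => //; exact: bigcup_measurable.
  rewrite -(cvg_lim _ cvgF)//; apply: lime_le; first by apply/cvg_ex; eexists; exact: cvgF.
  apply: nearW => n /=; have [_ _] := hE n; apply: le_trans.
  apply: le_measure; rewrite ?inE; [exact: mF|exact: mE|].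
  by move=> w; apply => /=.
Qed.

Lemma outer_le_bigcup (Xn : (set T)^nat) (c : (\bar R)^nat) :
  (forall k, outer_le (Xn k) (c k)) ->
  outer_le (\bigcup_k Xn k) (\sum_(k <oo) c k).
Proof.
move=> /choice[E hE].
have mE k : measurable (E k) by have [] := hE k.
exists (\bigcup_k E k); split.
- exact: bigcup_measurable.
- by move=> w [k _ Xk]; exists k => //; have [_ + _] := hE k; apply.
- have mU : measurable (\bigcup_k E k) by exact: bigcup_measurable.
  have /le_trans := @measure_sigma_subadditive _ _ _ P _ _ mE mU (@subset_refl _ _); apply.
  by apply: lee_nneseries => // k _; have [] := hE k.
Qed.

Lemma outer_leU X Y a b : outer_le X a -> outer_le Y b -> outer_le (X `|` Y) (a + b).
Proof.
move=> [E [mE XE PE]] [F [mF YF PF]]; exists (E `|` F); split.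
- exact: measurableU.
- exact: setUSS.
- by apply: (le_trans (measureU2 _ _ _)) => //; exact: leeD.
Qed.

End outer_bounds.

Lemma measure_rect_unique d1 d2 (S1 : measurableType d1) (S2 : measurableType d2)
  (R : realType) (m1 m2 : {measure set (S1 * S2)%type -> \bar R}) :
  (m1 setT < +oo)%E ->
  (forall A B, measurable A -> measurable B -> m1 (A `*` B) = m2 (A `*` B)) ->
  forall D, measurable D -> m1 D = m2 D.
Proof.
move=> m1oo m12; pose G : set (set (S1 * S2)) :=
  [set C | exists A, measurable A /\ exists B, measurable B /\ C = A `*` B].
apply: (measure_unique G (fun=> setT)).
- rewrite measurable_prod_measurableType //; congr (<<s _ >>).
  rewrite predeqE; split => [[A mA [B mB <-]]|[A [mA [B [mB ->]]]]].
    by exists A; split => //; exists B.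
  by exists A => //; exists B.
- move=> /= _ _ [X1 [mX1 [X2 [mX2 ->]]]] [Y1 [mY1 [Y2 [mY2 ->]]]].
  rewrite -setXI; exists (X1 `&` Y1); split; first exact: measurableI.
  by exists (X2 `&` Y2); split => //; exact: measurableI.
- by move=> _; exists setT; split => //; exists setT; split => //; rewrite setXTT.
- by rewrite bigcup_const.
- by move=> _ [A [mA [B [mB ->]]]]; exact: m12.
- by [].
Qed.

(** * Markov chains driven by independent increments *)

Section chain.
Context d dS (T : measurableType d) (S : measurableType dS) (R : realType).
Variables (P : probability T R) (g : probability (measurableTypeR R) R).
Variables (xi : nat -> T -> R) (s0 : S) (step : S * measurableTypeR R -> S).
Hypothesis mxi : forall i, measurable_fun setT (xi i).
Hypothesis mstep : measurable_fun setT step.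
Local Open Scope ereal_scope.

Hypothesis ind : forall (n : nat) (A : nat -> set R), (forall i, measurable (A i)) ->
  P (\bigcap_(i in [set i | (i < n)%N]) [set w | A i (xi i w)])
  = \prod_(i < n) g (A i).

Fixpoint chain k (w : T) : S :=
  if k is k'.+1 then step (chain k' w, xi k' w) else s0.

Lemma measurable_chain k : measurable_fun setT (chain k).
Proof.
elim: k => [|k IH]; first exact: measurable_cst.
by apply: measurableT_comp => //; exact: measurable_fun_pair.
Qed.

Let tail (A : nat -> set R) k n :=
  \bigcap_(i in [set i | (i < n)%N]) [set w | A i (xi (k + i)%N w)].

Let mpre (X : T -> S) C : measurable_fun setT X -> measurable C -> measurable (X @^-1` C).
Proof. by move=> mX mC; rewrite -[X in measurable X]setTI; exact: mX. Qed.

Let mtail A k n : (forall i, measurable (A i)) -> measurable (tail A k n).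
Proof.
move=> mA; apply: bigcap_measurableType => i _.
by have := mxi (k + i)%N measurableT (mA i); rewrite setTI.
Qed.

Let tailS A k n : tail A k n.+1 =
  [set w | A 0%N (xi k w)] `&` tail (fun i => A i.+1) k.+1 n.
Proof.
apply/seteqP; split => w.
  move=> h; split; first by have := h 0%N; rewrite addn0; apply.
  by move=> i /= in_; have := h i.+1; rewrite addnS; apply.
move=> [h0 h] [|i] /=; first by rewrite addn0.
by move=> ?; have := h i; rewrite /= addnS; apply.
Qed.

(** Induction on [k] with [n] and [A] free. An event on [chain k.+1] is an event D on the pair of
    [chain k] and [xi k]. For a rectangle D, the condition on [xi k] joins the future and the
    induction hypothesis applies with n + 1 sets; both sides are finite measures in D, so rectangles
    suffice. *)
Lemma chain_indep k C n A : measurable C -> (forall i, measurable (A i)) ->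
  P (chain k @^-1` C `&` tail A k n) = P (chain k @^-1` C) * \prod_(i < n) g (A i).
Proof.
elim: k C n A => [|k IH] C n A mC mA.
  have -> : chain 0 @^-1` C = if s0 \in C then setT else set0.
    by case: ifPn => [/set_mem|/negP] h; apply/seteqP; split => // w //= hC; apply: h; rewrite inE.
  case: ifP => _; last by rewrite set0I measure0 mul0e.
  by rewrite setTI probability_setT mul1e -ind//.
have mZ : measurable_fun setT (fun w => (chain k w, xi k w) : S * measurableTypeR R).
  exact: (measurable_fun_pair (measurable_chain k) (mxi k)).
have c01 : 0 <= \prod_(i < n) g (A i) /\ \prod_(i < n) g (A i) \is a fin_num.
  split; first by apply: prode_ge0 => i _; exact: measure_ge0.
  apply: prode_fin_num => i _; apply: fin_num_measure; exact: mA.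
set c := \prod_(i < n) g (A i) in c01 *.
have mT' := @mtail A k.+1 n mA.
pose c' : {nonneg R} := NngNum (fine_ge0 c01.1).
have c'E : (c'%:num)%:E = c by rewrite /= fineK //; exact: c01.2.
have mDZ D : measurable D -> measurable ((fun w => (chain k w, xi k w) : S * measurableTypeR R) @^-1` D).
  by move=> mD; rewrite -[X in measurable X]setTI; exact: mZ.
pose Pt : {measure set T -> \bar R} := mrestr P mT'.
pose m1 : {measure set (S * measurableTypeR R) -> \bar R} := measure_function_pushforward__canonical__measure_function_Measure Pt mZ.
pose m2 : {measure set (S * measurableTypeR R) -> \bar R} := mscale c' (measure_function_pushforward__canonical__measure_function_Measure P mZ).
have E12 D : measurable D -> m1 D = m2 D.
  apply: measure_rect_unique.
    rewrite /m1/= /pushforward /Pt/= /mrestr preimage_setT setTI.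
    by rewrite (le_lt_trans (probability_le1 _ _))// ltry.
  move=> C' B mC' mB; rewrite /m1 /m2/= /pushforward /Pt/= /mrestr /mscale /= c'E.
  rewrite -[X in X `&` _](_ : (chain k @^-1` C') `&` [set w | B (xi k w)] = _) //.
  pose A' i := if i is i'.+1 then A i' else B.
  have mA' i : measurable (A' i) by case: i => [|i] //=; exact: mA.
  rewrite -setIA; have -> : [set w | B (xi k w)] `&` tail A k.+1 n = tail A' k n.+1.
    by rewrite tailS.
  transitivity (c * P (chain k @^-1` C' `&` tail A' k 1)); last first.
    congr (_ * _); congr (P _); apply/seteqP; split => w [h1 h2]; split => //.
      by have := h2 0%N; rewrite addn0; apply.
    by move=> [|i]//= _; rewrite addn0.
  by rewrite !IH // big_ord_recl /= big_ord_recl big_ord0 mule1 muleA muleC.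
have mC2 : measurable (step @^-1` C) by rewrite -[X in measurable X]setTI; exact: mstep.
by have := E12 _ mC2; rewrite /m1 /m2/= /pushforward /Pt/= /mrestr /mscale/= c'E muleC.
Qed.

(** By independence the law of the pair of [chain k] and [xi k] is a product, so Tonelli integrates
    the increment first, at a fixed state. *)
Lemma chain_supermartingale (V : S -> \bar R) : measurable_fun setT V ->
  (forall s, 0 <= V s) ->
  (forall s, \int[g]_u V (step (s, u)) <= V s) ->
  forall k, \int[P]_w V (chain k w) <= V s0.
Proof.
move=> mV V0 hV; elim=> [|k IH] /=.
  by rewrite integral_cst// [X in _ * X](@probability_setT _ _ _ P) mule1.
apply: le_trans IH.
set X : {mfun T >-> S} := HB.pack (chain k) (isMeasurableFun.Build _ _ _ _ _ (measurable_chain k)).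
have mZ : measurable_fun setT (fun w => (chain k w, xi k w) : S * measurableTypeR R).
  exact: (measurable_fun_pair (measurable_chain k) (mxi k)).
set Z : {mfun T >-> (S * measurableTypeR R)%type} :=
  HB.pack (fun w => (chain k w, xi k w)) (isMeasurableFun.Build _ _ _ _ _ mZ).
have mVs : measurable_fun setT (V \o step) by exact: measurableT_comp.
have E : forall D, measurable D -> (distribution P X \x g) D = distribution P Z D.
  apply: product_measure_unique => A B mA mB.
  rewrite /distribution /pushforward /=.
  pose A' (i : nat) := B.
  transitivity (P (chain k @^-1` A `&` tail A' k 1)).
    congr (P _); apply/seteqP; split => w [h1 h2]; split => //.
      by move=> [|i]//= _; rewrite addn0.
    by have := h2 0%N; rewrite addn0; apply.
  by rewrite chain_indep// big_ord_recl big_ord0 mule1.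
have -> : \int[P]_w V (step (chain k w, xi k w)) = \int[P]_w ((V \o step) \o Z) w by [].
rewrite -(ge0_integral_distribution Z)//; last by move=> y; exact: V0.
rewrite -(eq_measure_integral _ (fun D mD _ => E D mD)).
rewrite fubini_tonelli1//; last by move=> x; exact: V0.
have -> : \int[P]_w V (chain k w) = \int[P]_w (V \o X) w by [].
rewrite -(ge0_integral_distribution X)//.
apply: ge0_le_integral => //.
- by move=> s _; apply: integral_ge0 => u _; exact: V0.
- by apply: measurable_fun_fubini_tonelli_F => // x; exact: V0.
- by move=> s _; exact: hV.
Qed.

End chain.

(** * Gaussian increments and the sampled walk *)

Section gaussian.
Variable R : realType.
Local Notation leb := (@lebesgue_measure R).
Implicit Types (v u delta : R).

Lemma gauss_densityE v : 0 < v -> normal_pdf 0 (Num.sqrt v) = gauss_density v.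
Proof.
move=> v0; have s0 : Num.sqrt v != 0 by rewrite gt_eqF// sqrtr_gt0.
apply/funext => u; rewrite normal_pdfE// /normal_peak /normal_fun /gauss_density.
rewrite subr0 sqr_sqrtr ?ltW// -mulrnAr -[v *+ 2]mulr_natl mulrC.
by congr (_ / Num.sqrt _); rewrite -mulr_natl; ring.
Qed.

Definition gauss v : probability (measurableTypeR R) R := normal_prob 0 (Num.sqrt v).

Lemma gaussE v A : 0 < v -> gauss v A = (\int[leb]_(u in A) (gauss_density v u)%:E)%E.
Proof. by move=> v0; rewrite /gauss/= /normal_prob gauss_densityE. Qed.

Lemma gauss_density_ge0 v u : 0 <= gauss_density v u.
Proof. by rewrite /gauss_density divr_ge0 ?expR_ge0 ?sqrtr_ge0. Qed.

Lemma measurable_gauss_density v : 0 < v -> measurable_fun setT (gauss_density v).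
Proof. by move=> v0; rewrite -gauss_densityE//; exact: measurable_normal_pdf. Qed.

Lemma gaussN v (A : set R) : 0 < v -> measurable A -> gauss v (-%R @^-1` A) = gauss v A.
Proof.
move=> v0 mA; rewrite !gaussE//.
have mN : measurable_fun setT (-%R : measurableTypeR R -> measurableTypeR R) by exact: oppr_measurable.
have mg D : measurable D -> measurable_fun D (fun u => (gauss_density v u)%:E).
  by move=> mD; apply/measurable_funTS/measurable_EFinP; exact: measurable_gauss_density.
have := @ge0_integral_pushforward _ _ _ _ _ _ mN leb A (fun u => (gauss_density v u)%:E) mA (mg _ mA).
move=> /(_ _)/=; rewrite (eq_measure_integral leb); last first.
  by move=> B mB _; exact: lebesgue_measureN.
move=> ->; last by move=> u _; rewrite lee_fin gauss_density_ge0.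
by apply: eq_integral => u _ /=; rewrite /gauss_density sqrrN.
Qed.

Lemma ge0_integral_gaussN v (f : R -> \bar R) : 0 < v -> measurable_fun setT f ->
  (forall u, (0 <= f u)%E) ->
  (\int[gauss v]_u f (- u)%R = \int[gauss v]_u f u)%E.
Proof.
move=> v0 mf f0.
have mN : measurable_fun setT (-%R : measurableTypeR R -> measurableTypeR R) by exact: oppr_measurable.
have := @ge0_integral_pushforward _ _ _ _ _ _ mN (gauss v) setT f measurableT mf (fun x _ => f0 x).
rewrite preimage_setT (eq_measure_integral (gauss v)) //.
by move=> B mB _; exact: gaussN.
Qed.

(** Beyond delta, the density of variance v is at most the stated constant times the density of
    variance 2v, whose total mass is 1. *)
Lemma gauss_tail v delta : 0 < v -> 0 <= delta ->
  (gauss v [set u | (delta < `|u|)%R] <= (Num.sqrt 2 * expR (- (delta ^+ 2) / (4 * v)))%:E)%E.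
Proof.
move=> v0 d0; have v20 : 0 < 2 * v by rewrite mulr_gt0.
set A := [set u | _]; have mA : measurable A.
  rewrite (_ : A = `]-oo, - delta[%classic `|` `]delta, +oo[%classic); last first.
    apply/seteqP; split => u; rewrite /A/= !in_itv/= andbT.
      by rewrite ltr_normr ltrNr => /orP[]; [right|left].
    by rewrite ltr_normr ltrNr => -[->|->]//; rewrite orbT.
  by apply: measurableU; exact: measurable_itv.
rewrite gaussE//; set K := _ * expR _.
have K0 : 0 <= K by rewrite mulr_ge0 ?sqrtr_ge0 ?expR_ge0.
have mg w : 0 < w -> measurable_fun A (fun u => (gauss_density w u)%:E).
  by move=> w0; apply/measurable_funTS/measurable_EFinP; exact: measurable_gauss_density.
apply: (@le_trans _ _ (\int[leb]_(u in A) (K%:E * (gauss_density (2 * v) u)%:E))%E).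
  apply: ge0_le_integral => //.
  - by move=> u _; rewrite lee_fin gauss_density_ge0.
  - exact: mg.
  - by apply: measurable_funeM; exact: mg.
  - move=> u uA; rewrite -EFinM lee_fin /K /gauss_density.
    have -> : Num.sqrt (2 * pi * (2 * v)) = Num.sqrt 2 * Num.sqrt (2 * pi * v).
      by rewrite -sqrtrM//; congr Num.sqrt; ring.
    have s1 : 0 < Num.sqrt (2 * pi * v) by rewrite sqrtr_gt0 !mulr_gt0// pi_gt0.
    have s2 : 0 < Num.sqrt 2 :> R by rewrite sqrtr_gt0.
    have -> : forall a b : R, Num.sqrt 2 * a * (b / (Num.sqrt 2 * Num.sqrt (2 * pi * v))) =
        a * b / Num.sqrt (2 * pi * v).
      by move=> a b; field; rewrite !gt_eqF.
    rewrite ler_pM2r ?invr_gt0// -expRD ler_expR.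
    have u2 : delta ^+ 2 <= u ^+ 2.
      by rewrite -[leRHS]real_normK ?num_real// ler_pXn2r ?nnegrE// ltW.
    rewrite (_ : - u ^+ 2 / (2 * v) = - (u ^+ 2 / (4 * v)) - u ^+ 2 / (4 * v)); last by field; rewrite gt_eqF.
    rewrite (_ : - u ^+ 2 / (2 * (2 * v)) = - (u ^+ 2 / (4 * v))); last by field; rewrite gt_eqF.
    by rewrite lerD2r mulNr lerN2 ler_pM2r// invr_gt0 mulr_gt0.
rewrite ge0_integralZl//; first last.
- by move=> u _; rewrite lee_fin gauss_density_ge0.
- exact: mg.
rewrite -gaussE// -[leRHS]mule1 lee_wpmul2l ?lee_fin//.
exact: probability_le1.
Qed.

(** The standard normal density at 2, hence a lower bound for the mass between one and two standard
    deviations. It replaces the exact second moment in the drift estimates, at the cost of a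
    constant factor in the rates. *)
Definition gauss_mass : R := expR (- 2) / Num.sqrt (2 * pi).

Lemma gauss_mass_gt0 : 0 < gauss_mass.
Proof. by rewrite divr_gt0 ?expR_gt0// sqrtr_gt0 mulr_gt0// pi_gt0. Qed.

Lemma gauss_bulk v : 0 < v ->
  (gauss_mass%:E <= gauss v `[Num.sqrt v, (2 * Num.sqrt v)%R]%classic)%E.
Proof.
move=> v0; rewrite gaussE//.
have s0 : 0 < Num.sqrt v by rewrite sqrtr_gt0.
set A := `[_, _]%classic; have mA : measurable A by exact: measurable_itv.
have -> : gauss_mass%:E = (\int[leb]_(u in A) (gauss_mass / Num.sqrt v)%:E)%E.
  rewrite integral_cst//= lebesgue_measure_itv/= lte_fin ltr_pMl// ltr1n.
  by rewrite -EFinD -EFinM; congr EFin; field; rewrite gt_eqF.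
apply: ge0_le_integral => //.
- by move=> u _; rewrite lee_fin divr_ge0 ?sqrtr_ge0// ltW// gauss_mass_gt0.
- by apply/measurable_funTS/measurable_EFinP; exact: measurable_gauss_density.
- move=> u; rewrite /A/= in_itv/= => /andP[u1 u2]; rewrite lee_fin /gauss_mass /gauss_density.
  have -> : Num.sqrt (2 * pi * v) = Num.sqrt (2 * pi) * Num.sqrt v.
    by rewrite sqrtrM// mulr_ge0// pi_ge0.
  set e := expR (_ / (2 * v)).
  rewrite (invfM (Num.sqrt (2 * pi))) mulrA ler_pM2r ?invr_gt0// ler_pM2r; last first.
    by rewrite invr_gt0 sqrtr_gt0 mulr_gt0// pi_gt0.
  rewrite /e ler_expR mulNr lerN2 ler_pdivrMr ?mulr_gt0//.
  have : u ^+ 2 <= (2 * Num.sqrt v) ^+ 2 by rewrite ler_pXn2r ?nnegrE ?mulr_ge0//; lra.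
  by rewrite exprMn sqr_sqrtr ?(ltW v0)//; lra.
Qed.

End gaussian.

(** * One Gaussian step *)

Section one_step.
Variable R : realType.
Local Open Scope ereal_scope.

(** By symmetry, twice the integral is that of f(x + u) + f(x - u). The gain u^2 q is kept only for
    u between sqrt v and 2 sqrt v, where it is at least q v, and the bound C is used beyond
    delta. *)
Lemma gauss_step_le (f : R -> R) (C x q delta v : R) :
  measurable_fun setT f -> (forall y, 0 <= f y <= C)%R -> (0 <= q)%R -> (0 < v)%R ->
  (2 * Num.sqrt v <= delta)%R ->
  (forall u, `|u| <= delta -> f (x + u) + f (x - u) <= 2 * f x - u ^+ 2 * q)%R ->
  \int[gauss v]_u (f (x + u)%R)%:E <=
  (f x - q * v / 2 * gauss_mass R + C * (Num.sqrt 2 * expR (- delta ^+ 2 / (4 * v))))%:E.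
Proof.
move=> mf f0 q0 v0 vd hf.
have s0 : (0 < Num.sqrt v)%R by rewrite sqrtr_gt0.
have d0 : (0 <= delta)%R by lra.
have C0 : (0 <= C)%R by have /andP[] := f0 x; exact: le_trans.
pose J : set R := `[Num.sqrt v, (2 * Num.sqrt v)%R]%classic.
pose K : set R := [set u | (delta < `|u|)%R].
have mJ : measurable J by exact: measurable_itv.
have mK : measurable K.
  rewrite (_ : K = `]-oo, (- delta)%R[%classic `|` `]delta, +oo[%classic); last first.
    apply/seteqP; split => u; rewrite /K/= !in_itv/= andbT.
      by rewrite ltr_normr ltrNr => /orP[]; [right|left].
    by rewrite ltr_normr ltrNr => -[->|->]//; rewrite orbT.
  by apply: measurableU; exact: measurable_itv.
have mfx (e : R) : measurable_fun setT (fun u : R => (f (x + e * u)%R)%:E : \bar R).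
  apply/measurable_EFinP; apply: measurableT_comp => //.
  by apply: measurable_funD => //; exact: measurable_funM.
have mf1 : measurable_fun setT (fun u : R => (f (x + u)%R)%:E).
  by have := mfx 1%R; under eq_fun do rewrite mul1r.
have mf2 : measurable_fun setT (fun u : R => (f (x - u)%R)%:E).
  by have := mfx (-1)%R; under eq_fun do rewrite mulN1r.
have fge0 y : 0 <= (f y)%:E by rewrite lee_fin; have /andP[] := f0 y.
have mind D r : measurable D -> measurable_fun setT (fun u : R => (r * \1_D u)%:E).
  by move=> mD; apply/measurable_EFinP; exact: measurable_funM.
have intI D r : (0 <= r)%R -> measurable D ->
    \int[gauss v]_u (r * \1_D u)%:E = r%:E * gauss v D.
  move=> r0 mD; under eq_integral do rewrite EFinM.
  rewrite ge0_integralZl//; last exact/measurable_EFinP.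
  by rewrite integral_indic// setIT.
set I := \int[gauss v]_u (f (x + u)%R)%:E.
have I0 : 0 <= I by apply: integral_ge0.
have I2 : \int[gauss v]_u (f (x - u)%R)%:E = I.
  exact: (@ge0_integral_gaussN _ _ (fun u => (f (x + u)%R)%:E)).
have main : I + I + (q * v)%:E * gauss v J <= (2 * f x)%:E + (2 * C)%:E * gauss v K.
  rewrite -{2}I2 -(intI J)//; last by rewrite mulr_ge0// ltW.
  rewrite -(intI K)//; last by rewrite mulr_ge0.
  rewrite -ge0_integralD//.
  rewrite -ge0_integralD//; last 4 first.
  - by move=> u _; exact: adde_ge0.
  - exact: emeasurable_funD.
  - by move=> u _; rewrite lee_fin mulr_ge0// mulr_ge0// ltW.
  - exact: mind.
  have -> : (2 * f x)%:E = \int[gauss v]_u (2 * f x)%:E.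
    by rewrite integral_cst// [X in _ * X](@probability_setT _ _ _ (gauss v)) mule1.
  have fx0 : (0 <= 2 * f x)%R by rewrite mulr_ge0//; have /andP[] := f0 x.
  rewrite -ge0_integralD//; last 2 first.
  - by move=> u _; rewrite lee_fin mulr_ge0// mulr_ge0.
  - exact: mind.
  apply: ge0_le_integral => //.
  - by move=> u _; apply: adde_ge0; [exact: adde_ge0|rewrite lee_fin mulr_ge0// mulr_ge0// ltW].
  - by apply: emeasurable_funD; [exact: emeasurable_funD|exact: mind].
  - by apply: emeasurable_funD => //; exact: mind.
  - move=> u _; rewrite -!EFinD lee_fin !indicE.
    have [uK|uK] := pselect (K u).
      rewrite (mem_set uK) memNset.
        have /andP[_ h1] := f0 (x + u)%R; have /andP[_ h2] := f0 (x - u)%R.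
        by rewrite mulr0 mulr1; lra.
      rewrite /J/= in_itv/= => /andP[u1 u2]; have u0 : (0 <= u)%R by lra.
        move: uK; rewrite /K/= ger0_norm// => uK.
        have : (u < u)%R by lra.
        by rewrite ltxx.
    rewrite (memNset uK); have /hf h : (`|u| <= delta)%R by rewrite leNgt; exact/negP.
    have [uJ|uJ] := pselect (J u); last first.
      rewrite (memNset uJ) mulr0 addr0 mulr0 addr0; apply: (le_trans h).
      by rewrite gerBl mulr_ge0// sqr_ge0.
    rewrite (mem_set uJ) mulr1 mulr0 addr0.
    suff : (q * v <= u ^+ 2 * q)%R by lra.
    rewrite mulrC ler_wpM2r//.
    move: uJ; rewrite /J/= in_itv/= => /andP[u1 _].
    by rewrite -[leLHS](sqr_sqrtr (ltW v0)) ler_pXn2r ?nnegrE// ltW//; lra.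
have Ifin : I \is a fin_num.
  rewrite ge0_fin_numE//; apply: (@le_lt_trans _ _ (\int[gauss v]_u C%:E)).
    apply: ge0_le_integral => //.
    by move=> u _; rewrite lee_fin; have /andP[] := f0 (x + u)%R.
  by rewrite integral_cst// [X in _ * X](@probability_setT _ _ _ (gauss v)) mule1 ltry.
have gJ := gauss_bulk v0; rewrite -/J in gJ.
have gK := gauss_tail v0 d0; rewrite -/K in gK.
have fJ : gauss v J \is a fin_num by exact: fin_num_measure.
have fK : gauss v K \is a fin_num by exact: fin_num_measure.
move: main gJ gK; rewrite -(fineK Ifin) -(fineK fJ) -(fineK fK) -!EFinM -!EFinD !lee_fin.
move: (fine I) (fine (gauss v J)) (fine (gauss v K)) => i j k main gJ gK.
have : (q * v * gauss_mass R <= q * v * j)%R by rewrite ler_wpM2l// mulr_ge0// ltW.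
have : (C * k <= C * (Num.sqrt 2 * expR (- delta ^+ 2 / (4 * v))))%R by rewrite ler_wpM2l.
by lra.
Qed.

End one_step.

Lemma BM_increments (R : realType) d (T : measurableType d) (P : probability T R)
    (x : R) (B : R -> T -> R) (h : R) : is_BM_from P x B -> 0 < h ->
  forall (n : nat) (A : nat -> set R), (forall i, measurable (A i)) ->
  P (\bigcap_(i in [set i | (i < n)%N])
      [set w | A i (B (i.+1%:R * h) w - B (i%:R * h) w)])
  = (\prod_(i < n) gauss h (A i))%E.
Proof.
move=> [_ _ _ hB] h0 n A mA.
rewrite (hB n (fun i => i%:R * h) A)//.
- by apply: eq_bigr => i _; rewrite gaussE// -mulrBl -natrB// subSnn mul1r.
- by rewrite mul0r.
- by move=> i _; rewrite ltr_pM2r// ltr_nat.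
Qed.

(** * The walk with clock and running maximum *)

Section walk.
Variables (R : realType) (eps a a' h lam : R) (rho f0 f1 : R -> R).
Implicit Types s : (R * R * R)%type.

(* State of the walk: position, accumulated clock, running maximum. The walk is
   frozen once its position has left [eps, a]. *)
Definition walk_step (z : (R * R * R) * measurableTypeR R) : R * R * R :=
  let: (y, c, M) := z.1 in
  if eps <= y <= a then (y + z.2, c + h * rho y, Num.max M (y + z.2)) else z.1.

(** The running maximum selects the function: [f0] until it reaches [a'], [f1] from then on. The
    switch happens at a position beyond [a'], where [f1 <= f0], so it can only lower the weight. *)
Definition walk_weight s : R :=
  expR (lam * s.1.2) * (if s.2 < a' then f0 s.1.1 else f1 s.1.1).

Hypothesis mrho : measurable_fun setT rho.
Hypothesis mf0 : measurable_fun setT f0.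
Hypothesis mf1 : measurable_fun setT f1.
Hypothesis f0_ge0 : forall y, 0 <= f0 y.
Hypothesis f1_ge1 : forall y, 1 <= f1 y.
Hypothesis f1_le_f0 : forall y, a' <= y -> f1 y <= f0 y.
Hypothesis rho_ge0 : forall y, 0 <= rho y.
Hypothesis h0 : 0 < h.
Hypothesis lam0 : 0 <= lam.
Hypothesis hf0 : forall y, eps <= y <= a ->
  (\int[gauss h]_u (f0 (y + u)%R)%:E <= (f0 y * expR (- (lam * h * rho y)))%:E)%E.
Hypothesis hf1 : forall y, eps <= y <= a ->
  (\int[gauss h]_u (f1 (y + u)%R)%:E <= (f1 y * expR (- (lam * h * rho y)))%:E)%E.

Lemma measurable_walk_step : measurable_fun setT walk_step.
Proof.
have m1 : measurable_fun setT (fun z : (R * R * R) * measurableTypeR R => z.1.1.1).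
  do 2 (apply: measurableT_comp => //).
have m2 : measurable_fun setT (fun z : (R * R * R) * measurableTypeR R => z.1.1.2).
  do 2 (apply: measurableT_comp => //).
have m3 : measurable_fun setT (fun z : (R * R * R) * measurableTypeR R => z.1.2).
  by apply: measurableT_comp.
have m4 : measurable_fun setT (fun z : (R * R * R) * measurableTypeR R => (z.2 : R)).
  exact: measurable_snd.
rewrite (_ : walk_step = fun z => if (eps <= z.1.1.1) && (z.1.1.1 <= a) then
   (z.1.1.1 + z.2, z.1.1.2 + h * rho z.1.1.1, Num.max z.1.2 (z.1.1.1 + z.2)) else z.1).
  apply: measurable_fun_ifT => //=.
  - exact: (measurable_and (measurable_fun_ler (measurable_cst eps) m1)
      (measurable_fun_ler m1 (measurable_cst a))).
  - have m5 := measurable_funD m1 m4.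
    have m6 := measurableT_comp mrho m1.
    have m7 := measurable_funD m2 (measurable_funM (measurable_cst h) m6).
    exact: (measurable_fun_pair (measurable_fun_pair m5 m7) (measurable_maxr m3 m5)).
by apply/funext => -[[[y c] M] u].
Qed.

Lemma measurable_walk_weight : measurable_fun setT walk_weight.
Proof.
have m1 : measurable_fun setT (fun z : (R * R * R) => z.1.1) by apply: measurableT_comp.
have m2 : measurable_fun setT (fun z : (R * R * R) => z.1.2) by apply: measurableT_comp.
apply: measurable_funM.
  by apply: measurableT_comp => //; exact: measurable_funM.
apply: measurable_fun_ifT; first exact: measurable_fun_ltr.
- exact: measurableT_comp.
- exact: measurableT_comp.
Qed.

Lemma walk_weight_ge0 s : 0 <= walk_weight s.
Proof.
rewrite mulr_ge0 ?expR_ge0//; case: ifP => // _; exact: le_trans (f1_ge1 _).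
Qed.

Lemma walk_weight_step s :
  (\int[gauss h]_u (walk_weight (walk_step (s, u)))%:E <= (walk_weight s)%:E)%E.
Proof.
case: s => [[y c] M]; have [hy|hy] := boolP (eps <= y <= a); last first.
  under eq_integral do rewrite /walk_step /= (negbTE hy).
  by rewrite integral_cst// [X in (_ * X)%E](@probability_setT _ _ _ (gauss h)) mule1.
pose f := if M < a' then f0 else f1.
have mf : measurable_fun setT f by rewrite /f; case: ifP.
have f_ge0 z : 0 <= f z.
  by rewrite /f; case: ifP => // _; exact: le_trans (f1_ge1 _).
have hf : (\int[gauss h]_u (f (y + u)%R)%:E <= (f y * expR (- (lam * h * rho y)))%:E)%E.
  by rewrite /f; case: ifP => _; [exact: hf0|exact: hf1].
have mfy : measurable_fun setT (fun u => (f (y + u)%R)%:E).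
  by apply/measurable_EFinP; apply: measurableT_comp => //; exact: measurable_funD.
apply: (@le_trans _ _ (\int[gauss h]_u ((expR (lam * (c + h * rho y)))%:E * (f (y + u)%R)%:E))%E).
  apply: ge0_le_integral => //.
  - by move=> u _; rewrite lee_fin walk_weight_ge0.
  - apply/measurable_EFinP; apply: (measurableT_comp measurable_walk_weight).
    apply: (measurableT_comp measurable_walk_step).
    exact: measurable_fun_pair.
  - exact: measurable_funeM.
  - move=> u _; rewrite -EFinM lee_fin /walk_weight /walk_step/= hy /=.
    rewrite ler_wpM2l ?expR_ge0// /f; have [Ma|Ma] := ltP M a'; last first.
      by rewrite ltNge le_max Ma.
    case: ltP => //; rewrite le_max leNgt Ma/=; exact: f1_le_f0.
rewrite ge0_integralZl//; last by move=> u _; rewrite lee_fin.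
apply: (@le_trans _ _ ((expR (lam * (c + h * rho y)))%:E * (f y * expR (- (lam * h * rho y)))%:E)%E).
  by rewrite lee_wpmul2l// lee_fin expR_ge0.
rewrite -EFinM lee_fin /walk_weight/= mulrCA -expRD mulrC /f.
rewrite (_ : lam * (c + h * rho y) - lam * h * rho y = lam * c); last by ring.
by case: ifP.
Qed.

Variables (d : measure_display) (T : measurableType d) (P : probability T R).
Variables (x : R) (B : R -> T -> R).
Hypothesis hB : is_BM_from P x B.

Let xi (i : nat) w : R := B (i.+1%:R * h) w - B (i%:R * h) w.

Let mxi i : measurable_fun setT (xi i).
Proof. by case: hB => mB _ _ _; exact: measurable_funB. Qed.

Let S : measurableType _ := (R * R * R)%type.

Let walk := @chain _ _ T S R xi (x, 0, x) walk_step.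

Let mwalk k : measurable_fun setT (walk k).
Proof. exact: (measurable_chain _ mxi measurable_walk_step). Qed.

Lemma walk_nondecreasing k n w : (k <= n)%N ->
  (walk k w).1.2 <= (walk n w).1.2 /\ (walk k w).2 <= (walk n w).2.
Proof.
elim: n => [|n IH]; first by rewrite leqn0 => /eqP ->.
rewrite leq_eqVlt => /predU1P[->//|/IH[h1 h2]].
rewrite /walk/= -/walk /walk_step/=; case: (walk n w) h1 h2 => [[y c] M]/= h1 h2.
case: ifP => _ //=; split.
  by rewrite (le_trans h1)// lerDl mulr_ge0// ltW.
by rewrite le_max h2.
Qed.

Lemma walkE k w : (forall i, (i < k)%N -> eps <= B (i%:R * h) w <= a) ->
  (walk k w).1 = (B (k%:R * h) w, \sum_(i < k) h * rho (B (i%:R * h) w)).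
Proof.
have B0 : B 0 w = x by case: hB.
elim: k => [|k IH] hk; first by rewrite /= mul0r B0 big_ord0.
have {}IH : (walk k w).1 = (B (k%:R * h) w, \sum_(i < k) h * rho (B (i%:R * h) w)).
  by apply: IH => i ik; apply: hk; exact: ltnW.
rewrite /walk/= -/walk /walk_step/=; case: (walk k w) IH => [[y c] M]/= [-> ->].
by rewrite hk//= big_ord_recr/=; congr pair; rewrite /xi addrC subrK.
Qed.

Lemma walk_max k i w : (forall i, (i < k)%N -> eps <= B (i%:R * h) w <= a) -> (i <= k)%N ->
  B (i%:R * h) w <= (walk k w).2.
Proof.
have B0 : B 0 w = x by case: hB.
move=> + ik; move=> hk; suff : B (i%:R * h) w <= (walk i w).2.
  by move=> /le_trans; apply; have [] := walk_nondecreasing w ik.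
case: i ik => [|i] ik; first by rewrite mul0r B0.
have hi : (walk i w).1 = (B (i%:R * h) w, \sum_(j < i) h * rho (B (j%:R * h) w)).
  by apply: walkE => j ji; apply: hk; rewrite (ltn_trans ji).
rewrite /walk/= -/walk /walk_step/=; case: (walk i w) hi => [[y c] M]/= [-> ->].
by rewrite hk//= le_max; apply/orP; right; rewrite /xi addrC subrK.
Qed.

(** Markov's inequality at the single time N. Clock and maximum never decrease, so what happened at
    some k <= N is still recorded at time N, where the weight is then at least [expR (lam * t)]
    because [f1] is at least 1. This takes the place of optional stopping. *)
Lemma walk_estimate (N : nat) (t : R) :
  outer_le P [set w | exists k, [/\ (k <= N)%N,
      forall i, (i < k)%N -> eps <= B (i%:R * h) w <= a,
      exists2 i, (i <= k)%N & a' <= B (i%:R * h) w &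
      t < \sum_(i < k) h * rho (B (i%:R * h) w)]]
    (expR (- (lam * t)) * f0 x)%:E.
Proof.
pose V (s : S) := (walk_weight s)%:E.
have mV : measurable_fun setT V by apply/measurable_EFinP; exact: measurable_walk_weight.
have V0 s : (0 <= V s)%E by rewrite lee_fin walk_weight_ge0.
have hV := @chain_supermartingale _ _ T S R P (gauss h) xi (x, 0, x) walk_step mxi
  measurable_walk_step (BM_increments hB h0) V mV V0 walk_weight_step N.
have mVw : measurable_fun setT (V \o walk N) by exact: measurableT_comp.
pose E := [set w | ((expR (lam * t))%:E <= V (walk N w))%E].
have mE : measurable E.
  have -> : E = (V \o walk N) @^-1` `[(expR (lam * t))%:E, +oo[%classic.
    by apply/seteqP; split => w; rewrite /E/= in_itv/= andbT.
  by rewrite -[X in measurable X]setTI; apply: mVw => //; exact: emeasurable_itv.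
exists E; split => //.
- move=> w [k [kN hk [i ik ai] tk]]; rewrite /E/= /V lee_fin /walk_weight.
  have [h1 h2] := walk_nondecreasing w kN.
  have := walk_max hk ik; have := walkE hk.
  case: (walk k w) h1 h2 => [[y c] M]/= h1 h2 [_ cE] yM.
  rewrite ltNge (le_trans ai)/=; last exact: le_trans h2.
  rewrite -[leLHS]mulr1 ler_pM ?expR_ge0// ler_expR ler_wpM2l//.
  by rewrite (le_trans _ h1)// cE ltW.
- have e0 : 0 < expR (lam * t) by exact: expR_gt0.
  have V_x : V (x, 0, x) = (if x < a' then f0 x else f1 x)%:E.
    by rewrite /V /walk_weight/= mulr0 expR0 mul1r.
  have PE : ((expR (lam * t))%:E * P E <= (f0 x)%:E)%E.
    apply: (@le_trans _ _ (V (x, 0, x))); last first.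
      by rewrite V_x; case: ltP => // ?; rewrite lee_fin; exact: f1_le_f0.
    apply: le_trans hV; rewrite -integral_cst//.
    apply: (@le_trans _ _ (\int[P]_(w in E) V (walk N w))%E).
      apply: ge0_le_integral => //.
      - by move=> w _; rewrite lee_fin ltW.
      - exact: measurable_funTS.
    exact: ge0_subset_integral.
  have fPE : P E \is a fin_num by exact: fin_num_measure.
  rewrite -(fineK fPE) -EFinM lee_fin in PE.
  rewrite -[X in (X <= _)%E](fineK fPE) lee_fin.
  by rewrite expRN -(ler_pM2l e0) mulrA mulfV ?gt_eqF// mul1r.
Qed.

End walk.

(** * Continuous paths *)

Section real_topology.
Variable R : realType.
Implicit Types (f : R -> R).

Lemma continuousP_dist f x : {for x, continuous f} ->
  forall e, 0 < e -> exists2 r, 0 < r & forall y, `|x - y| < r -> `|f x - f y| < e.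
Proof.
move=> cf e e0.
have /(_ (ball (f x) e)) : f @ x --> f x by exact: cf.
move=> /(_ (nbhsx_ballx _ _ e0))/nbhs_ballP[r /= r0 hr].
by exists r => // y xy; exact: (hr y).
Qed.

Lemma unif_continuous_segment f (a b : R) : continuous f ->
  forall e, 0 < e -> exists2 r, 0 < r &
    forall x y, a <= x <= b -> `|x - y| < r -> `|f x - f y| < e.
Proof.
move=> cf e e0.
have /compact_near_coveringP cpt := @segment_compact R a b.
have := cpt _ (0^'+) (fun r x => forall y, `|x - y| < r -> `|f x - f y| < e).
move=> /(_ _ _) [].
  move=> x xab; have e20 : 0 < e / 2 by rewrite divr_gt0.
  have [r r0 hr] := continuousP_dist (cf x) e20.
  exists (ball x (r / 2), [set z | z < r / 2]).
    split => /=; first by apply: nbhsx_ballx; rewrite divr_gt0.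
    by apply: nbhs_right_lt; rewrite divr_gt0.
  move=> [x' z]/= [xx' zr] y x'y.
  have h1 : `|f x - f x'| < e / 2 by apply: hr; rewrite (lt_trans xx')//; lra.
  have h2 : `|f x - f y| < e / 2.
    apply: hr; rewrite -(subrKA x') (le_lt_trans (ler_normD _ _))//.
    by move: xx'; rewrite /ball/= => xx'; lra.
  rewrite -(subrKA (f x)) (le_lt_trans (ler_normD _ _))//.
  by rewrite distrC; lra.
move=> r /= r0 hr; exists (r / 2); first by rewrite divr_gt0.
move=> x y xab xy; apply: (hr (r / 2)) => //=.
- by rewrite /ball/= sub0r normrN gtr0_norm ?divr_gt0//; lra.
- by rewrite divr_gt0.
Qed.

(** Retraction onto a segment: it extends functions that are known only there to continuous
    functions on the line. *)
Definition clamp (a b x : R) := Num.max a (Num.min b x).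

Lemma clamp_itv a b x : a <= b -> a <= clamp a b x <= b.
Proof. by move=> ab; rewrite /clamp le_max lexx/= ge_max ab ge_min lexx. Qed.

Lemma clamp_id a b x : a <= x <= b -> clamp a b x = x.
Proof. by move=> /andP[ax xb]; rewrite /clamp (min_idPr xb) (max_idPr ax). Qed.

Lemma continuous_clamp a b : continuous (clamp a b).
Proof.
move=> x; apply: continuous_max; first exact: cvg_cst.
by apply: continuous_min; [exact: cvg_cst|exact: cvg_id].
Qed.

Lemma continuous_clamp_within (a b : R) f (A : set R) : a <= b ->
  (forall x, a <= x <= b -> A x) ->
  {within A, continuous f} -> continuous (f \o clamp a b).
Proof.
move=> ab hA /subspace_continuousP cf x.
have Ac y : A (clamp a b y) by apply: hA; exact: clamp_itv.
apply: (@cvg_comp _ _ _ (clamp a b) f _ (within A (nbhs (clamp a b x)))); last exact: cf.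
move=> V /= hV.
have H : nbhs x [set y | A (clamp a b y) -> V (clamp a b y)] := @continuous_clamp a b x _ hV.
rewrite /= nbhs_simpl /=.
by apply: (filterS _ H) => y /= hy; exact: (hy (Ac y)).
Qed.

Lemma riemann_le (g : R -> R) (h e : R) (k : nat) : continuous g -> 0 <= h -> 0 <= e ->
  (forall y, 0 <= g y) ->
  (forall i r, (i < k)%N -> i%:R * h <= r <= i.+1%:R * h -> g r <= g (i%:R * h) + e) ->
  (\int[lebesgue_measure]_(r in `[0%R, (k%:R * h)%R]) (g r)%:E <=
    (\sum_(i < k) h * g (i%:R * h) + k%:R * h * e)%:E)%E.
Proof.
move=> cg h0 e0 g0; elim: k => [|k IH] hk.
  rewrite !mul0r addr0 big_ord0 set_itv1 integral_set1//.
have mg D : measurable_fun D (fun r => (g r)%:E).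
  by apply/measurable_funTS/measurable_EFinP; exact: continuous_measurable_fun.
have kh0 : 0 <= k%:R * h by rewrite mulr_ge0.
have khk : k%:R * h <= k.+1%:R * h by rewrite ler_wpM2r// ler_nat.
rewrite (@itv_bndbnd_setU _ _ _ (BRight (k%:R * h))) ?bnd_simp//.
rewrite ge0_integral_setU//=; first last.
- apply/disj_setPS => r [] /=; rewrite !in_itv/= => /andP[_ rk] /andP[kr _].
  by move: (lt_le_trans kr rk); rewrite ltxx.
- by move=> r _; rewrite lee_fin.
- exact: mg.
apply: (@le_trans _ _ ((\sum_(i < k) h * g (i%:R * h) + k%:R * h * e)%:E +
    (h * (g (k%:R * h) + e))%:E)%E).
  apply: leeD; first by apply: IH => i r ik; apply: hk; rewrite (ltn_trans ik).
  apply: (@le_trans _ _ (\int[lebesgue_measure]_(r in `](k%:R * h)%R, (k.+1%:R * h)%R]) (g (k%:R * h) + e)%:E)%E).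
    apply: ge0_le_integral => //.
    - by move=> r _; rewrite lee_fin.
    - exact: mg.
    - move=> r /=; rewrite in_itv/= => /andP[r1 r2]; rewrite lee_fin.
      by apply: hk => //; rewrite (ltW r1) r2.
  rewrite integral_cst//= lebesgue_measure_itv/=; case: ifPn => _.
    by rewrite -EFinD -EFinM lee_fin -mulrBl -natrB// subSnn mul1r mulrC.
  by rewrite mule0 lee_fin mulr_ge0// addr_ge0.
rewrite -EFinD lee_fin big_ord_recr/= -[k.+1%:R]natr1 mulrDr mulrDl mul1r.
lra.
Qed.

End real_topology.

Lemma natSinv_small (R : realType) (e : R) : 0 < e ->
  exists n0, forall n, (n0 <= n)%N -> n.+1%:R^-1 < e.
Proof.
move=> e0; have [n0 _ hn0] := near_infty_natSinv_lt (PosNum e0).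
by exists n0 => n n0n; exact: hn0.
Qed.

Lemma expRN_le (R : realType) (z : R) : 0 < z -> expR (- z) <= 4 / z ^+ 2.
Proof.
move=> z0; have -> : - z = - (z / 2) + - (z / 2) by field.
rewrite expRD -expr2 expRN exprVn.
have -> : 4 / z ^+ 2 = ((z / 2) ^+ 2)^-1 by field; rewrite gt_eqF.
rewrite lef_pV2 ?posrE ?exprn_gt0 ?expR_gt0 ?divr_gt0//.
rewrite ler_pXn2r ?nnegrE ?expR_ge0 ?divr_ge0 ?(ltW z0)//.
by have := expR_ge1Dx (z / 2); lra.
Qed.

(** The bound exp(- z) <= 4 / z^2 at z = delta^2 / (4h) makes the tail O(h^2), hence negligible
    against the gain, of order h. *)
Lemma gauss_error_small (R : realType) (C delta kappa : R) : 0 <= C -> 0 < delta -> 0 < kappa ->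
  exists n0, forall n, (n0 <= n)%N -> let h := n.+1%:R^-1 in
    2 * Num.sqrt h <= delta /\
    C * (Num.sqrt 2 * expR (- delta ^+ 2 / (4 * h))) <= kappa * h.
Proof.
move=> C0 d0 k0.
(* 128 = 2 * 4 * 16: sqrt 2 <= 2, the 4 of [expRN_le], and the square of the 4 in z. The added 1
   keeps the denominator positive when C = 0. *)
pose e := Num.min (delta ^+ 2 / 4) (kappa * delta ^+ 4 / (128 * C + 1)).
have C1 : 0 < 128 * C + 1 by lra.
have e0 : 0 < e.
  by rewrite /e lt_min; rewrite !divr_gt0 ?mulr_gt0 ?exprn_gt0.
have [n0 hn0] := natSinv_small e0; exists n0 => n n0n h.
have h0 : 0 < h by rewrite invr_gt0.
have := hn0 n n0n; rewrite -/h /e lt_min => /andP[h1 h2_].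
have h2 : h < kappa * delta ^+ 4 / (128 * C + 1) by [].
clearbody h; have h3 : 2 ^+ 2 * h <= delta ^+ 2 by lra.
split.
  rewrite -[leRHS](gtr0_norm d0) -sqrtr_sqr.
  have -> : 2 = Num.sqrt (2 ^+ 2) :> R by rewrite sqrtr_sqr ger0_norm.
  by rewrite -sqrtrM ?sqr_ge0// ler_sqrt ?sqr_ge0.
have z0 : 0 < delta ^+ 2 / (4 * h) by rewrite divr_gt0 ?mulr_gt0 ?exprn_gt0.
have s2 : Num.sqrt 2 <= 2 :> R.
  by rewrite -[leRHS](@ger0_norm _ 2)// -sqrtr_sqr ler_sqrt ?sqr_ge0//; lra.
apply: (@le_trans _ _ (C * (2 * (4 / (delta ^+ 2 / (4 * h)) ^+ 2)))).
  by rewrite ler_wpM2l// ler_pM ?sqrtr_ge0 ?expR_ge0// mulNr expRN_le.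
have -> : C * (2 * (4 / (delta ^+ 2 / (4 * h)) ^+ 2)) = (128 * C * h / delta ^+ 4) * h.
  by field; rewrite !gt_eqF.
rewrite ler_pM2r// ler_pdivrMr ?exprn_gt0//.
move: h2; rewrite ltr_pdivlMr// => h2.
have : 0 <= h by exact: ltW.
nra.
Qed.

(** * From the sampled walk to the path *)

Section path_estimate.
Variables (R : realType) (eps a a' lam C delta kappa : R) (rho f0 f1 q0 q1 : R -> R).
Hypothesis crho : continuous rho.
Hypothesis rho_ge0 : forall y, 0 <= rho y.
Hypothesis mf0 : measurable_fun setT f0.
Hypothesis mf1 : measurable_fun setT f1.
Hypothesis f0_itv : forall y, 0 <= f0 y <= C.
Hypothesis f1_itv : forall y, 1 <= f1 y <= C.
Hypothesis f1_le_f0 : forall y, a' <= y -> f1 y <= f0 y.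
Hypothesis lam0 : 0 <= lam.
Hypothesis delta0 : 0 < delta.
Hypothesis kappa0 : 0 < kappa.

Definition second_diff_le (f q : R -> R) := forall y u, eps <= y <= a -> `|u| <= delta ->
  f (y + u) + f (y - u) <= 2 * f y - u ^+ 2 * q y.

(** The margin [kappa] is what absorbs the Gaussian tail error of each step. *)
Definition clock_drift (f q : R -> R) := forall y, eps <= y <= a ->
  lam * rho y * f y + kappa <= q y / 2 * gauss_mass R.

Hypothesis hf0 : second_diff_le f0 q0.
Hypothesis hf1 : second_diff_le f1 q1.
Hypothesis hq0 : clock_drift f0 q0.
Hypothesis hq1 : clock_drift f1 q1.

Let step_le (f q : R -> R) h : measurable_fun setT f -> (forall y, 0 <= f y <= C) ->
  second_diff_le f q -> clock_drift f q -> 0 < h ->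
  2 * Num.sqrt h <= delta ->
  C * (Num.sqrt 2 * expR (- delta ^+ 2 / (4 * h))) <= kappa * h ->
  forall y, eps <= y <= a ->
  (\int[gauss h]_u (f (y + u)%R)%:E <= (f y * expR (- (lam * h * rho y)))%:E)%E.
Proof.
move=> mf f_itv hf hq h0 hd hC y ya.
have f0y : 0 <= f y by have /andP[] := f_itv y.
have lr : 0 <= lam * rho y * f y by rewrite !mulr_ge0.
have hqy : lam * rho y * f y + kappa <= q y / 2 * gauss_mass R by exact: hq.
have qg : 0 <= q y * gauss_mass R.
  move: hqy lr kappa0; move: (lam * rho y * f y) (gauss_mass R) (q y) => A G Q.
  by move=> h1 h2 h3; lra.
have q_ge0 : 0 <= q y by rewrite -(pmulr_lge0 _ (gauss_mass_gt0 R)).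
apply: le_trans (gauss_step_le mf f_itv q_ge0 h0 hd (fun u hu => hf y u ya hu)) _.
rewrite lee_fin; apply: (@le_trans _ _ (f y * (1 - lam * h * rho y))); last first.
  by rewrite ler_wpM2l//; have := expR_ge1Dx (- (lam * h * rho y)); lra.
have : h * (lam * rho y * f y + kappa) <= h * (q y / 2 * gauss_mass R).
  by rewrite ler_wpM2l// ltW.
lra.
Qed.

Variables (d : measure_display) (T : measurableType d) (P : probability T R).
Variables (x : R) (B : R -> T -> R).
Hypothesis hB : is_BM_from P x B.

Lemma path_estimate (t : R) :
  outer_le P [set w | exists s, [/\ 0 <= s,
      forall r, 0 <= r <= s -> eps < B r w < a,
      exists2 r, 0 <= r <= s & a' < B r w &
      (t%:E < \int[lebesgue_measure]_(r in `[0%R, s]) (rho (B r w))%:E)%E]]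
    (expR (- (lam * t)) * f0 x)%:E.
Proof.
have C0 : 0 <= C by have /andP[] := f0_itv 0; exact: le_trans.
have f1_itv' y : 0 <= f1 y <= C.
  by have /andP[h ->] := f1_itv y; rewrite (le_trans _ h).
have [n0 hn0] := gauss_error_small C0 delta0 kappa0.
pose h n : R := n.+1%:R^-1.
have h0 n : 0 < h n by rewrite invr_gt0.
(* (n+1)^2 steps of mesh 1/(n+1) reach the horizon n + 1, which eventually exceeds any given s. *)
pose X n := [set w | exists k, [/\ (k <= n.+1 ^ 2)%N,
      forall i, (i < k)%N -> eps <= B (i%:R * h n) w <= a,
      exists2 i, (i <= k)%N & a' <= B (i%:R * h n) w &
      t < \sum_(i < k) h n * rho (B (i%:R * h n) w)]].
apply: (@outer_le_liminf _ _ _ _ _ X); last first.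
  exists n0 => n /hn0[hd hC].
  apply: (@walk_estimate _ eps a a' (h n) lam rho f0 f1) => //.
  - exact: continuous_measurable_fun.
  - by move=> y; have /andP[] := f0_itv y.
  - by move=> y; have /andP[] := f1_itv y.
  - exact: (step_le mf0 f0_itv hf0 hq0 (h0 n) hd hC).
  - exact: (step_le mf1 f1_itv' hf1 hq1 (h0 n) hd hC).
move=> w [s [s0 hs [r0 r0s r0a] ts]].
have cB : {within `[0%R, +oo[, continuous (fun s => B s w)} by case: hB.
pose b := (fun s => B s w) \o clamp 0 s.
have cb : continuous b.
  apply: continuous_clamp_within cB => // r /andP[r1 _].
  by rewrite /= in_itv/= r1.
have bE r : 0 <= r <= s -> b r = B r w by move=> rs; rewrite /b /= clamp_id.
pose g := rho \o b.
have cg : continuous g by move=> r; apply: continuous_comp; [exact: cb|exact: crho].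
have mg : measurable_fun setT g by exact: continuous_measurable_fun.
have EI : (\int[lebesgue_measure]_(r in `[0%R, s]) (rho (B r w))%:E =
    \int[lebesgue_measure]_(r in `[0%R, s]) (g r)%:E)%E.
  by apply: eq_integral => r; rewrite inE/= in_itv/= => rs; rewrite /g /= bE.
rewrite EI in ts.
have [M hM] : exists M, forall r, 0 <= r <= s -> g r <= M.
  have [c _ hc] := @EVT_max R g 0 s s0 (@continuous_subspaceT _ _ _ _ cg).
  by exists (g c) => r rs; apply: hc; rewrite in_itv.
have g_ge0 r : 0 <= g r by exact: rho_ge0.
have Ifin : (\int[lebesgue_measure]_(r in `[0%R, s]) (g r)%:E)%E \is a fin_num.
  rewrite ge0_fin_numE; last by apply: integral_ge0 => r _; rewrite lee_fin.
  apply: (@le_lt_trans _ _ (\int[lebesgue_measure]_(r in `[0%R, s]) M%:E)%E).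
    apply: ge0_le_integral => //; first by move=> r _; rewrite lee_fin.
    by apply/measurable_EFinP; exact: measurable_funTS.
  rewrite integral_cst//= lebesgue_measure_itv/=; case: ifPn => _.
    by rewrite -EFinD -EFinM ltry.
  by rewrite mule0 ltry.
rewrite -(fineK Ifin) in ts *; set I := fine _ in ts; rewrite lte_fin in ts.
(* The Riemann sum errs by at most e times a total length below s + 1, that is by half of the excess
   I - t. *)
pose e := (I - t) / (2 * (s + 1)).
have e0 : 0 < e by rewrite /e divr_gt0//; lra.
have [eta eta0 heta] := unif_continuous_segment 0 (s + 1) cg e0.
have [eta' eta'0 heta'] : exists2 r, 0 < r & forall y, `|r0 - y| < r -> a' < b y.
  have : 0 < b r0 - a' by rewrite bE// subr_gt0.
  move=> /(continuousP_dist (cb r0))[r r_gt0 hr]; exists r => // y /hr.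
  by rewrite ltr_distlC subKr => /andP[].
have m0 : 0 < Num.min (Num.min eta eta') (s + 1)^-1.
  by rewrite !lt_min eta0 eta'0/= invr_gt0; lra.
have [n1 hn1] := natSinv_small m0; exists n1 => n n1n.
have := hn1 n n1n; rewrite -/(h n) !lt_min => /andP[/andP[hn_eta hn_eta'] hn_s].
have hn1' : h n <= 1 by rewrite /h invf_le1// ler1n.
have h_n := h0 n.
have s1 : s + 1 <= n.+1%:R.
  move: hn_s; rewrite /h ltf_pV2 ?posrE//; lra.
pose j := Num.truncn (s / h n).
have j_le : j%:R * h n <= s.
  by rewrite -ler_pdivlMr// ; rewrite Num.Theory.truncn_le divr_ge0// ltW.
have j_gt : s < j.+1%:R * h n by rewrite -ltr_pdivrMr//; exact: truncnS_gt.
have in_s i : (i < j.+1)%N -> 0 <= i%:R * h n <= s.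
  move=> ij; rewrite mulr_ge0 ?(ltW h_n)//= (le_trans _ j_le)//.
  by rewrite ler_pM2r// ler_nat.
(* With j + 1 cells the whole of [0, s] is covered, while the samples that must lie in the interval,
   those of index at most j, are taken at times not after s. *)
exists j.+1; split.
- have : j.+1%:R <= (n.+1 ^ 2)%:R :> R.
    rewrite natrX -natr1; have : j%:R <= s * n.+1%:R.
      by rewrite -[n.+1%:R]invrK ler_pdivlMr// -/(h n).
    move: s1; set N := n.+1%:R; move=> s1 hj.
    have : 1 <= N by rewrite ler1n.
    nra.
  by rewrite ler_nat.
- by move=> i ij; have /andP[/ltW -> /ltW ->] := hs _ (in_s i ij).
- pose i := Num.truncn (r0 / h n).
  have /andP[r00 r01] := r0s.
  have i_le : i%:R * h n <= r0.
    by rewrite -ler_pdivlMr//; rewrite Num.Theory.truncn_le divr_ge0// ltW.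
  have i_gt : r0 < i.+1%:R * h n by rewrite -ltr_pdivrMr//; exact: truncnS_gt.
  have ih0 : 0 <= i%:R * h n by rewrite mulr_ge0 ?(ltW h_n).
  exists i.
    rewrite -(ler_nat R) -(ler_pM2r h_n).
    by rewrite (le_trans i_le)// (le_trans r01)// ltW.
  rewrite -bE ?ih0/= ?(le_trans i_le)//; apply/ltW/heta'.
  rewrite ger0_norm ?subr_ge0// ltrBlDr (lt_trans i_gt)// -natr1 mulrDl mul1r.
  by rewrite addrC ltrD2r.
- have hR : (I%:E <= (\sum_(i < j.+1) h n * g (i%:R * h n) + j.+1%:R * h n * e)%:E)%E.
    apply: (@le_trans _ _ (\int[lebesgue_measure]_(r in `[0%R, (j.+1%:R * h n)%R]) (g r)%:E)%E).
      rewrite /I fineK//; apply: ge0_subset_integral => //.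
      - by apply/measurable_funTS/measurable_EFinP.
      - by move=> r _; rewrite lee_fin.
      - by move=> r /=; rewrite !in_itv/= => /andP[-> rs]; rewrite (le_trans rs)// ltW.
    apply: riemann_le => //; [exact: ltW|exact: ltW|].
    move=> i r ij /andP[r1 r2].
    have /andP[i1 i2] := in_s i ij.
    have : `|g (i%:R * h n) - g r| < e.
      apply: heta; first by rewrite i1/=; lra.
      rewrite distrC ger0_norm ?subr_ge0// (le_lt_trans _ hn_eta)//.
      by move: r2; rewrite -natr1 mulrDl mul1r; lra.
    by move=> /ltr_distlCDr/ltW.
  have -> : \sum_(i < j.+1) h n * rho (B (i%:R * h n) w) = \sum_(i < j.+1) h n * g (i%:R * h n).
    by apply: eq_bigr => i _; rewrite /g/= bE// in_s.
  rewrite lee_fin in hR; apply: (@lt_le_trans _ _ (I - j.+1%:R * h n * e)); last by lra.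
  have : j.+1%:R * h n <= s + 1 by rewrite -natr1 mulrDl mul1r; lra.
  move=> hj; have : j.+1%:R * h n * e <= (s + 1) * e by rewrite ler_wpM2r// ltW.
  have -> : (s + 1) * e = (I - t) / 2 by rewrite /e; field; lra.
  by lra.
Qed.

End path_estimate.

(** * The supersolutions *)

Section derivation_rules.
Variable R : realType.
Implicit Types (f g : R -> R) (x a b k : R).

Lemma derive_eq f x a b : is_derive x 1 f a -> a = b -> is_derive x 1 f b.
Proof. by move=> h <-. Qed.

Lemma deriveD_fun f g x a b : is_derive x 1 f a -> is_derive x 1 g b ->
  is_derive x 1 (fun z => f z + g z) (a + b).
Proof. by move=> hf hg; exact: is_deriveD. Qed.

Lemma deriveB_fun f g x a b : is_derive x 1 f a -> is_derive x 1 g b ->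
  is_derive x 1 (fun z => f z - g z) (a - b).
Proof. by move=> hf hg; exact: is_deriveB. Qed.

Lemma deriveM_fun f g x a b : is_derive x 1 f a -> is_derive x 1 g b ->
  is_derive x 1 (fun z => f z * g z) (a * g x + f x * b).
Proof.
move=> hf hg; apply: (derive_eq (is_deriveM hf hg)).
by rewrite addrC /GRing.scale/= [g x * _]mulrC.
Qed.

Lemma derive_cst_fun k x : is_derive x 1 (fun=> k) 0.
Proof. exact: is_derive_cst. Qed.

Lemma derive_id_fun x : is_derive x 1 (fun z => z) 1.
Proof. exact: is_derive_id. Qed.

Lemma deriveZ_fun k f x a : is_derive x 1 f a -> is_derive x 1 (fun z => k * f z) (k * a).
Proof.
move=> hf; apply: (derive_eq (deriveM_fun (derive_cst_fun k x) hf)).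
by rewrite mul0r add0r.
Qed.

Lemma deriveV_fun f x a : is_derive x 1 f a -> f x != 0 ->
  is_derive x 1 (fun z => (f z)^-1) (- a / f x ^+ 2).
Proof.
move=> hf f0; apply: (derive_eq (is_deriveV f0 hf)).
by rewrite /GRing.scale/= mulNr mulrC mulNr.
Qed.

Lemma derive_comp_fun f g x a b : is_derive (g x) 1 f a -> is_derive x 1 g b ->
  is_derive x 1 (fun z => f (g z)) (a * b).
Proof. by move=> hf hg; exact: is_derive1_comp. Qed.

Lemma derive_sum_fun n (h : 'I_n -> R -> R) (dh : 'I_n -> R) x :
  (forall i, is_derive x 1 (h i) (dh i)) ->
  is_derive x 1 (fun z => \sum_(i < n) h i z) (\sum_(i < n) dh i).
Proof.
move=> hd; have := @is_derive_sum _ _ _ n h x 1 dh hd.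
by rewrite (_ : \sum_(i < n) h i = fun z => \sum_(i < n) h i z)//; apply/funext => z; rewrite fct_sumE.
Qed.

Lemma is_derive_continuous f x a : is_derive x 1 f a -> {for x, continuous f}.
Proof. by move=> [df _]; apply: differentiable_continuous; exact/derivable1_diffP. Qed.

Lemma is_derive_continuous_within f (df : R -> R) (a b : R) :
  (forall x, a <= x <= b -> is_derive x 1 f (df x)) -> {within `[a, b], continuous f}.
Proof.
move=> h; apply: continuous_in_subspaceT => x; rewrite inE/= in_itv/= => xab.
exact: (is_derive_continuous (h x xab)).
Qed.

Lemma is_derive_ge0_le f (df : R -> R) (a b : R) : a <= b ->
  (forall x, a <= x <= b -> is_derive x 1 f (df x)) ->
  (forall x, a <= x <= b -> 0 <= df x) -> f a <= f b.
Proof.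
rewrite le_eqVlt => /predU1P[->//|ab] h h0.
have h' x : x \in `]a, b[ -> is_derive x 1 f (df x).
  by rewrite in_itv/= => /andP[/ltW ax /ltW xb]; apply: h; rewrite ax.
have [c] := MVT ab h' (is_derive_continuous_within h).
rewrite in_itv/= => /andP[ac cb] e.
by rewrite -subr_ge0 e mulr_ge0 ?subr_ge0 ?(ltW ab)// h0// !ltW.
Qed.

(* [z |-> F z + q z ^ 2 / 2] is concave on the interval. *)
Lemma second_diff_derive (F F1 F2 : R -> R) (q y u : R) : 0 <= u ->
  (forall z, y - u <= z <= y + u -> is_derive z 1 F (F1 z)) ->
  (forall z, y - u <= z <= y + u -> is_derive z 1 F1 (F2 z)) ->
  (forall z, y - u <= z <= y + u -> F2 z <= - q) ->
  F (y + u) + F (y - u) <= 2 * F y - u ^+ 2 * q.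
Proof.
rewrite le_eqVlt => /predU1P[<-|u0] hF hF1 hF2.
  by rewrite subr0 addr0 expr0n/= mul0r subr0; lra.
pose H z := F z + q / 2 * (z * z).
pose H1 z := F1 z + q * z.
have dH z : y - u <= z <= y + u -> is_derive z 1 H (H1 z).
  move=> hz; apply: (derive_eq (deriveD_fun (hF z hz) (deriveZ_fun (q / 2)
    (deriveM_fun (derive_id_fun z) (derive_id_fun z))))).
  by rewrite /H1; field.
have dH1 z : y - u <= z <= y + u -> is_derive z 1 H1 (F2 z + q).
  move=> hz; apply: (derive_eq (deriveD_fun (hF1 z hz) (deriveZ_fun q (derive_id_fun z)))).
  by rewrite mulr1.
have yu1 : y - u < y by lra.
have yu2 : y < y + u by lra.
have mvt z1 z2 : y - u <= z1 -> z1 < z2 -> z2 <= y + u ->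
    exists2 c, z1 < c < z2 & H z2 - H z1 = H1 c * (z2 - z1).
  move=> z1y z12 z2y; have h' x : z1 <= x <= z2 -> is_derive x 1 H (H1 x).
    by move=> /andP[x1 x2]; apply: dH; apply/andP; split; lra.
  have h'' x : x \in `]z1, z2[ -> is_derive x 1 H (H1 x).
    by rewrite in_itv/= => /andP[/ltW ax /ltW xb]; apply: h'; rewrite ax.
  by have [c] := MVT z12 h'' (is_derive_continuous_within h'); rewrite in_itv/=; exists c.
have [c1 /andP[c11 c12] e1] : exists2 c, y < c < y + u & H (y + u) - H y = H1 c * (y + u - y).
  by apply: mvt; lra.
have [c2 /andP[c21 c22] e2] : exists2 c, y - u < c < y & H y - H (y - u) = H1 c * (y - (y - u)).
  by apply: mvt; lra.
have : - H1 c2 <= - H1 c1.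
  apply: (@is_derive_ge0_le (fun z => - H1 z) (fun z => - (F2 z + q))); first lra.
    move=> x /andP[x1 x2]; apply: is_deriveN; apply: dH1; apply/andP; split; lra.
  move=> x /andP[x1 x2]; rewrite oppr_ge0 -lerBrDr sub0r; apply: hF2; apply/andP; split; lra.
move=> hh; have : u * H1 c1 <= u * H1 c2 by rewrite ler_wpM2l ?(ltW u0)//; lra.
move: e1 e2; rewrite /H.
have -> : y + u - y = u by ring.
have -> : y - (y - u) = u by ring.
nra.
Qed.

(** Uniform continuity of [Q] replaces its values near y by [Q y] at the loss [kappa]. The radius is
    also small enough for y + u and y - u to stay between [lo] and [hi]. *)
Lemma second_diff_bound (F F1 F2 Q : R -> R) (lo hi eps a kappa : R) :
  lo < eps -> a < hi -> 0 < kappa -> continuous Q ->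
  (forall z, lo <= z <= hi -> is_derive z 1 F (F1 z)) ->
  (forall z, lo <= z <= hi -> is_derive z 1 F1 (F2 z)) ->
  (forall z, lo <= z <= hi -> F2 z <= - Q z) ->
  exists2 delta, 0 < delta & forall y u, eps <= y <= a -> `|u| <= delta ->
    [/\ lo <= y + u <= hi, lo <= y - u <= hi &
     F (y + u) + F (y - u) <= 2 * F y - u ^+ 2 * (Q y - kappa)].
Proof.
move=> loe ahi k0 cQ hF hF1 hF2.
have [eta eta0 heta] := unif_continuous_segment eps a cQ k0.
pose delta := Num.min (eta / 2) (Num.min (eps - lo) (hi - a)).
have d0 : 0 < delta by rewrite /delta !lt_min !subr_gt0 loe ahi divr_gt0.
have [d1 [d2 d3]] : delta <= eta / 2 /\ delta <= eps - lo /\ delta <= hi - a.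
  by rewrite /delta; do 2 (split; [by rewrite !ge_min lexx ?orbT|]); rewrite !ge_min lexx !orbT.
clearbody delta; exists delta => // y u /andP[y1 y2] ud.
have main v : 0 <= v -> v <= delta ->
    [/\ lo <= y + v <= hi, lo <= y - v <= hi &
     F (y + v) + F (y - v) <= 2 * F y - v ^+ 2 * (Q y - kappa)].
  move=> v0 vd.
  have hz z : y - v <= z <= y + v -> lo <= z <= hi.
    by move=> /andP[z1 z2]; apply/andP; split; lra.
  split; [by apply: hz; apply/andP; split; lra|by apply: hz; apply/andP; split; lra|].
  apply: (@second_diff_derive F F1 F2) => // z /[dup] hzz /hz hz'; [exact: hF|exact: hF1|].
  apply: (le_trans (hF2 z hz')); rewrite lerN2 lerBlDr.
  have : `|Q y - Q z| < kappa.
    apply: heta; first by rewrite y1 y2.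
    by move/andP: hzz => [z1 z2]; rewrite ltr_norml; apply/andP; split; lra.
  by move=> /ltr_distlDr/ltW.
have [u0|u0] := leP 0 u; first by apply: main => //; move: ud; rewrite ger0_norm.
have [] := main (- u); [lra|by move: ud; rewrite ltr0_norm|].
by rewrite opprK sqrrN => h1 h2 h3; split => //; rewrite addrC.
Qed.

End derivation_rules.

(** * Exponential supersolutions from profiles at several scales *)

Section profile.
Variable R : realType.
Implicit Types (m x : R).

(** A step in ln x, from 0 to 1 around x = m^-2, with [phi] = x psi' and [phi2] = x phi'. The square
    root is there to make it slow: |phi2| <= phi / 2, so that the term x b' uses up only half of -
    b. *)
Definition psi m x : R := 1 - (1 + m * Num.sqrt x)^-1.
Definition phi m x : R := m * Num.sqrt x / (2 * (1 + m * Num.sqrt x) ^+ 2).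
Definition phi2 m x : R :=
  m * Num.sqrt x * (1 - m * Num.sqrt x) / (4 * (1 + m * Num.sqrt x) ^+ 3).

Lemma derive_psi m x : 0 < m -> 0 < x -> is_derive x 1 (psi m) (phi m x / x).
Proof.
move=> m0 x0; have s0 : 0 < Num.sqrt x by rewrite sqrtr_gt0.
have d0 : 0 < 1 + m * Num.sqrt x by rewrite addr_gt0// mulr_gt0.
have hs := deriveZ_fun m (is_derive1_sqrt x0).
have hd := deriveD_fun (derive_cst_fun 1 x) hs.
apply: (derive_eq (deriveB_fun (derive_cst_fun 1 x) (deriveV_fun hd (lt0r_neq0 d0)))).
have xs : x = Num.sqrt x ^+ 2 by rewrite sqr_sqrtr// ltW.
rewrite /phi; move: s0 d0 xs; move: (Num.sqrt x) => s s0 d0 ->.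
by field; rewrite !gt_eqF.
Qed.

Lemma derive_phi m x : 0 < m -> 0 < x -> is_derive x 1 (phi m) (phi2 m x / x).
Proof.
move=> m0 x0; have s0 : 0 < Num.sqrt x by rewrite sqrtr_gt0.
have d0 : 0 < 1 + m * Num.sqrt x by rewrite addr_gt0// mulr_gt0.
have hs := deriveZ_fun m (is_derive1_sqrt x0).
have hd := deriveD_fun (derive_cst_fun 1 x) hs.
have hq := deriveZ_fun 2 (deriveM_fun hd hd).
have q0 : 2 * ((1 + m * Num.sqrt x) * (1 + m * Num.sqrt x)) != 0 by rewrite gt_eqF// !mulr_gt0.
apply: (derive_eq (deriveM_fun hs (deriveV_fun hq q0))).
have xs : x = Num.sqrt x ^+ 2 by rewrite sqr_sqrtr// ltW.
rewrite /phi2; move: s0 d0 xs; move: (Num.sqrt x) => s s0 d0 ->.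
by field; rewrite !gt_eqF.
Qed.

Lemma phi_ge0 m x : 0 <= m -> 0 <= phi m x.
Proof.
move=> m0; have v0 : 0 <= m * Num.sqrt x by rewrite mulr_ge0// sqrtr_ge0.
by rewrite /phi divr_ge0// mulr_ge0// exprn_ge0// addr_ge0.
Qed.

Lemma psi_itv m x : 0 <= m -> 0 <= psi m x <= 1.
Proof.
move=> m0; have v0 : 0 <= m * Num.sqrt x by rewrite mulr_ge0// sqrtr_ge0.
have d0 : 0 < 1 + m * Num.sqrt x by rewrite ltr_pwDl.
rewrite /psi subr_ge0 invf_le1// lerDl v0/= gerBl invr_ge0; exact: ltW.
Qed.

Lemma phi2_norm m x : 0 <= m -> `|phi2 m x| <= phi m x / 2.
Proof.
move=> m0; have v0 : 0 <= m * Num.sqrt x by rewrite mulr_ge0// sqrtr_ge0.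
rewrite /phi2 /phi; move: (m * Num.sqrt x) v0 => v v0.
have d0 : 0 < 1 + v by rewrite ltr_pwDl.
have -> : v / (2 * (1 + v) ^+ 2) / 2 = v * (1 + v) / (4 * (1 + v) ^+ 3).
  by field; rewrite gt_eqF.
have e0 : 0 < 4 * (1 + v) ^+ 3 by rewrite mulr_gt0// exprn_gt0.
rewrite normf_div (gtr0_norm e0) ler_pM2r ?invr_gt0// normrM (ger0_norm v0).
rewrite ler_wpM2l// ler_norml; apply/andP; split; lra.
Qed.

(** With v = m sqrt x the right side is v / ((1 + v)(1 + 2v)), and 1 + 2v <= 2(1 + v). Over scales
    where m doubles, the bound telescopes. *)
Lemma phi_le_psi m x : 0 <= m -> phi m x <= psi (2 * m) x - psi m x.
Proof.
move=> m0; have v0 : 0 <= m * Num.sqrt x by rewrite mulr_ge0// sqrtr_ge0.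
rewrite /psi /phi -(mulrA 2 m); move: (m * Num.sqrt x) v0 => v v0.
have d0 : 0 < 1 + v by rewrite ltr_pwDl.
have d1 : 0 < 1 + 2 * v by rewrite ltr_pwDl// mulr_ge0.
have -> : 1 - (1 + 2 * v)^-1 - (1 - (1 + v)^-1) = v / ((1 + v) * (1 + 2 * v)).
  by field; rewrite !gt_eqF.
rewrite ler_wpM2l// lef_pV2 ?posrE ?mulr_gt0 ?exprn_gt0//.
nra.
Qed.

Lemma phi_ge m x : 1 / 2 <= m * Num.sqrt x <= 1 -> 1 / 9 <= phi m x.
Proof.
rewrite /phi; move: (m * Num.sqrt x) => v /andP[v1 v2].
rewrite ler_pdivlMr; last by rewrite mulr_gt0// exprn_gt0//; lra.
nra.
Qed.

Variables (n : nat) (c mm : nat -> R).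
Hypothesis c0 : forall i, 0 <= c i.
Hypothesis m0 : forall i, 0 < mm i.

Definition Psi x := \sum_(i < n) c i * psi (mm i) x.
Definition bb x := \sum_(i < n) c i * phi (mm i) x.
Definition bb2 x := \sum_(i < n) c i * phi2 (mm i) x.

Lemma derive_Psi x : 0 < x -> is_derive x 1 Psi (bb x / x).
Proof.
move=> x0; apply: derive_eq.
  by apply: derive_sum_fun => i; exact: (deriveZ_fun (c i) (derive_psi (m0 i) x0)).
by rewrite /bb mulr_suml; apply: eq_bigr => i _; rewrite mulrA.
Qed.

Lemma derive_bb x : 0 < x -> is_derive x 1 bb (bb2 x / x).
Proof.
move=> x0; apply: derive_eq.
  by apply: derive_sum_fun => i; exact: (deriveZ_fun (c i) (derive_phi (m0 i) x0)).
by rewrite /bb2 mulr_suml; apply: eq_bigr => i _; rewrite mulrA.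
Qed.

Lemma bb2_norm x : `|bb2 x| <= bb x / 2.
Proof.
rewrite /bb2 (le_trans (ler_norm_sum _ _ _))// /bb mulr_suml.
apply: ler_sum => i _; rewrite normrM (ger0_norm (c0 i)) -mulrA ler_wpM2l//.
by rewrite phi2_norm// ltW.
Qed.

Lemma Psi_itv x : 0 <= Psi x <= \sum_(i < n) c i.
Proof.
have h i := psi_itv x (ltW (m0 i)).
apply/andP; split.
  by apply: sumr_ge0 => i _; rewrite mulr_ge0//; have /andP[] := h i.
by apply: ler_sum => i _; rewrite ler_piMr//; have /andP[] := h i.
Qed.

Variables (lam lo hi bmin : R) (rho W Q : R -> R).
Hypothesis lo0 : 0 < lo.
Hypothesis lohi : lo <= hi.
Hypothesis hi1 : hi <= 1.
Hypothesis lam0 : 0 <= lam.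
Hypothesis bmin0 : 0 < bmin.
Hypothesis rho_ge0 : forall x, 0 <= rho x.
Hypothesis hW : forall x, lo <= x <= hi -> is_derive x 1 W (x ^+ 2 * rho x).
Hypothesis hQ : forall x, lo <= x <= hi -> is_derive x 1 Q (W x / x ^+ 2).
Hypothesis W_ge0 : forall x, lo <= x <= hi -> 0 <= W x.
Hypothesis W_le : forall x, lo <= x <= hi -> 16 * lam * W x <= x * bb x.
Hypothesis bb_itv : forall x, lo <= x <= hi -> bmin <= bb x <= 1 / 8.

(* Both supersolutions are [exp Phi], where [x Phi' x = beta x - 2 lam W x / x]
   with [beta = b] for the bounded one and [beta = 1 - b] for the one comparable to [x]. *)
Definition Phi1 x := Psi x - 2 * lam * (Q x - Q lo).
Definition Phi0 a' x := ln x - ln a' - Psi x - 2 * lam * (Q x - Q lo) + 3 * \sum_(i < n) c i.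

Definition slope1 x := bb x / x - 2 * lam * (W x / x ^+ 2).
Definition slope0 x := x^-1 - bb x / x - 2 * lam * (W x / x ^+ 2).

Let x_gt0 x : lo <= x <= hi -> 0 < x.
Proof. by move=> /andP[h _]; exact: lt_le_trans h. Qed.

Lemma derive_Phi1 x : lo <= x <= hi -> is_derive x 1 Phi1 (slope1 x).
Proof.
move=> hx; apply: (derive_eq (deriveB_fun (derive_Psi (x_gt0 hx))
  (deriveZ_fun (2 * lam) (deriveB_fun (hQ hx) (derive_cst_fun (Q lo) x))))).
by rewrite subr0.
Qed.

Lemma derive_Phi0 a' x : lo <= x <= hi -> is_derive x 1 (Phi0 a') (slope0 x).
Proof.
move=> hx; have x0 := x_gt0 hx.
apply: (derive_eq (deriveD_fun (deriveB_fun (deriveB_fun (deriveB_fun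
  (is_derive1_ln x0) (derive_cst_fun (ln a') x)) (derive_Psi x0))
  (deriveZ_fun (2 * lam) (deriveB_fun (hQ hx) (derive_cst_fun (Q lo) x))))
  (derive_cst_fun (3 * \sum_(i < n) c i) x))).
by rewrite !subr0 addr0.
Qed.

Definition curv1 x := (bb2 x - bb x + 4 * lam * (W x / x)) / x ^+ 2 - 2 * lam * rho x.
Definition curv0 x := (- 1 - bb2 x + bb x + 4 * lam * (W x / x)) / x ^+ 2 - 2 * lam * rho x.

Let derive_WX x : lo <= x <= hi ->
  is_derive x 1 (fun z => W z / z ^+ 2) (rho x - 2 * (W x / x ^+ 3)).
Proof.
move=> hx; have x0 := x_gt0 hx.
have q0 : x * x != 0 by rewrite gt_eqF// mulr_gt0.
apply: (derive_eq (deriveM_fun (hW hx) (deriveV_fun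
  (deriveM_fun (derive_id_fun x) (derive_id_fun x)) q0))).
by field; rewrite gt_eqF.
Qed.

Lemma derive_slope1 x : lo <= x <= hi -> is_derive x 1 slope1 (curv1 x).
Proof.
move=> hx; have x0 := x_gt0 hx; have xn0 : x != 0 by rewrite gt_eqF.
apply: (derive_eq (deriveB_fun (deriveM_fun (derive_bb x0) (deriveV_fun (derive_id_fun x) xn0))
  (deriveZ_fun (2 * lam) (derive_WX hx)))).
by rewrite /curv1; field.
Qed.

Lemma derive_slope0 x : lo <= x <= hi -> is_derive x 1 slope0 (curv0 x).
Proof.
move=> hx; have x0 := x_gt0 hx; have xn0 : x != 0 by rewrite gt_eqF.
apply: (derive_eq (deriveB_fun (deriveB_fun (deriveV_fun (derive_id_fun x) xn0)
   (deriveM_fun (derive_bb x0) (deriveV_fun (derive_id_fun x) xn0)))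
  (deriveZ_fun (2 * lam) (derive_WX hx)))).
by rewrite /curv0; field.
Qed.

Let bounds x : lo <= x <= hi -> let g := 2 * lam * (W x / x) in
  [/\ 0 < x, x <= 1, 0 <= g, 8 * g <= bb x & bmin <= bb x <= 1 / 8 /\ `|bb2 x| <= bb x / 2].
Proof.
move=> hx g; have x0 := x_gt0 hx.
split => //.
- by have /andP[_ /le_trans] := hx; apply.
- by rewrite /g !mulr_ge0// ?invr_ge0 ?W_ge0// ltW.
- rewrite /g -(ler_pM2l x0); have := W_le hx.
  have -> : x * (8 * (2 * lam * (W x / x))) = 16 * lam * W x by field; rewrite gt_eqF.
  by [].
- by split; [exact: bb_itv|exact: bb2_norm].
Qed.

Lemma slope_ge0 x : lo <= x <= hi -> 0 <= slope1 x /\ 0 <= slope0 x.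
Proof.
move=> hx; have [x0 x1 g0 gb [/andP[b1 b2] _]] := bounds hx.
have -> : slope1 x = (bb x - 2 * lam * (W x / x)) / x.
  by rewrite /slope1; field; rewrite gt_eqF.
have -> : slope0 x = (1 - bb x - 2 * lam * (W x / x)) / x.
  by rewrite /slope0; field; rewrite gt_eqF.
by split; rewrite divr_ge0 ?(ltW x0)//; lra.
Qed.

Let inv_sq_ge1 x : 0 < x -> x <= 1 -> 1 <= x ^- 2.
Proof. by move=> x0 x1; rewrite invf_ge1 ?exprn_gt0// exprn_ile1// ltW. Qed.

(** With g = 2 lam W / x, the numerator over x^2 is b2 - b + 2g + (b - g)^2. By |b2| <= b/2, 8g <= b
    and b <= 1/8 it is at most b/2 - b + b/4 + b/8 = - b/8. Since x <= 1, dividing by x^2 only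
    helps. *)
Lemma curv1_le x : lo <= x <= hi ->
  curv1 x + slope1 x ^+ 2 <= - (2 * lam * rho x + bmin / 8).
Proof.
move=> hx; have [x0 x1 g0 gb [/andP[b1 b2] hb2]] := bounds hx.
have -> : curv1 x + slope1 x ^+ 2 = (bb2 x - bb x + 2 * (2 * lam * (W x / x)) +
    (bb x - 2 * lam * (W x / x)) ^+ 2) / x ^+ 2 - 2 * lam * rho x.
  by rewrite /curv1 /slope1; field; rewrite gt_eqF.
move: hb2; rewrite ler_norml => /andP[h1 h2].
move: (2 * lam * (W x / x)) g0 gb => g g0 gb.
suff : (bb2 x - bb x + 2 * g + (bb x - g) ^+ 2) / x ^+ 2 <= - (bmin / 8) by lra.
apply: (@le_trans _ _ (- (bmin / 8) / x ^+ 2)).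
  rewrite ler_pM2r ?invr_gt0 ?exprn_gt0//.
  have : (bb x - g) ^+ 2 <= bb x / 8.
    have : (bb x - g) ^+ 2 <= bb x ^+ 2 by rewrite ler_pXn2r ?nnegrE//; lra.
    have : bb x ^+ 2 <= bb x * (1 / 8) by rewrite expr2 ler_wpM2l//; lra.
    lra.
  lra.
by rewrite mulNr lerN2 ler_peMr ?inv_sq_ge1// divr_ge0// ltW.
Qed.

(** Here x times the slope is 1 - b - g, and the terms linear in g cancel: what remains is - b2 - b
    + (b + g)^2, with (b + g)^2 <= (9b/8)^2 <= b/4. *)
Lemma curv0_le x : lo <= x <= hi ->
  curv0 x + slope0 x ^+ 2 <= - (2 * lam * rho x + bmin / 8).
Proof.
move=> hx; have [x0 x1 g0 gb [/andP[b1 b2] hb2]] := bounds hx.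
have -> : curv0 x + slope0 x ^+ 2 = (- bb2 x - bb x + (bb x + 2 * lam * (W x / x)) ^+ 2)
    / x ^+ 2 - 2 * lam * rho x.
  by rewrite /curv0 /slope0; field; rewrite gt_eqF.
move: hb2; rewrite ler_norml => /andP[h1 h2].
move: (2 * lam * (W x / x)) g0 gb => g g0 gb.
suff : (- bb2 x - bb x + (bb x + g) ^+ 2) / x ^+ 2 <= - (bmin / 8) by lra.
apply: (@le_trans _ _ (- (bmin / 8) / x ^+ 2)).
  rewrite ler_pM2r ?invr_gt0 ?exprn_gt0//.
  have : (bb x + g) ^+ 2 <= bb x / 4.
    have : (bb x + g) ^+ 2 <= (9 / 8 * bb x) ^+ 2 by rewrite ler_pXn2r ?nnegrE//; lra.
    have : bb x ^+ 2 <= bb x * (1 / 8) by rewrite expr2 ler_wpM2l//; lra.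
    rewrite exprMn; lra.
  lra.
by rewrite mulNr lerN2 ler_peMr ?inv_sq_ge1// divr_ge0// ltW.
Qed.

Lemma Phi_nondecreasing a' x y : lo <= x -> x <= y -> y <= hi ->
  Phi1 x <= Phi1 y /\ Phi0 a' x <= Phi0 a' y.
Proof.
move=> lx xy yh; have h z : x <= z <= y -> lo <= z <= hi.
  by move=> /andP[z1 z2]; rewrite (le_trans lx)// (le_trans z2).
split.
  by apply: (@is_derive_ge0_le _ _ slope1) => // z /h hz;
    [exact: derive_Phi1|have [] := slope_ge0 hz].
by apply: (@is_derive_ge0_le _ _ slope0) => // z /h hz;
  [exact: derive_Phi0|have [] := slope_ge0 hz].
Qed.

Lemma Q_ge x : lo <= x <= hi -> Q lo <= Q x.
Proof.
move=> /andP[lx xh]; apply: (@is_derive_ge0_le _ _ (fun z => W z / z ^+ 2)) => // z /andP[z1 z2].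
  by apply: hQ; rewrite z1 (le_trans z2).
have hz : lo <= z <= hi by rewrite z1 (le_trans z2).
by rewrite divr_ge0 ?W_ge0// sqr_ge0.
Qed.

(** By monotonicity [Phi1] stays above its value [Psi lo] at [lo], which is nonnegative.
    Nonnegativity also says that the potential term is at most [Psi x], so the sum of the weights
    bounds it too. *)
Lemma Phi1_itv x : lo <= x <= hi -> 0 <= Phi1 x <= \sum_(i < n) c i.
Proof.
move=> hx; have /andP[lx xh] := hx; have /andP[h1 h2] := Psi_itv x.
have /andP[h3 h4] := Psi_itv lo.
have [h5 _] := Phi_nondecreasing 1 (lexx lo) lx xh.
have h6 : 0 <= 2 * lam * (Q x - Q lo) by rewrite !mulr_ge0// subr_ge0 Q_ge.
apply/andP; split; last by rewrite (le_trans _ h2)// /Phi1 gerBl.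
by rewrite (le_trans _ h5)// /Phi1 subrr mulr0 subr0.
Qed.

(** This fixes the constant 3. Let S be the sum of the weights. At [a'] the logarithms cancel, [Psi]
    and the potential term are each at most S, so [Phi0] is at least 3S - 2S = S, an upper bound of
    [Phi1]; beyond [a'] it increases. *)
Lemma Phi1_le_Phi0 a' x : lo <= a' -> a' <= x -> x <= hi -> Phi1 x <= Phi0 a' x.
Proof.
move=> la ax xh; have ha : lo <= a' <= hi by rewrite la (le_trans ax).
have hx : lo <= x <= hi by rewrite xh (le_trans la).
have [_ h1] := Phi_nondecreasing a' la ax xh.
have /andP[h2 h3] := Phi1_itv ha; have /andP[h4 h5] := Phi1_itv hx.
have /andP[h6 h7] := Psi_itv a'.
apply: le_trans h1; apply: (le_trans h5).
move: h2 h7; rewrite /Phi0 /Phi1 subrr.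
move: (\sum_(i < n) c i) (Psi a') (2 * lam * (Q a' - Q lo)) => S p q.
lra.
Qed.

Lemma Phi0_le a' x : lo <= x <= hi -> Phi0 a' x <= ln x - ln a' + 3 * \sum_(i < n) c i.
Proof.
move=> hx; have /andP[h1 h2] := Psi_itv x.
have h6 : 0 <= 2 * lam * (Q x - Q lo) by rewrite !mulr_ge0// subr_ge0 Q_ge.
move: h1 h6; rewrite /Phi0.
move: (\sum_(i < n) c i) (Psi x) (2 * lam * (Q x - Q lo)) (ln x) (ln a') => S p q u v.
lra.
Qed.

Hypothesis crho : continuous rho.
Variables (eps a a' : R).
Hypothesis eps_lo : lo < eps.
Hypothesis a_hi : a < hi.
Hypothesis a'_itv : lo <= a' <= hi.

(** Clamping makes the exponential bounded and continuous on the line. The minimum of f is m =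
    exp(Phi lo). Of the surplus bmin/8, the amount bmin m / 16 pays for uniform continuity, and the
    rest provides [kappa]. The Gaussian step yields only the fraction [gauss_mass] of the drift,
    hence the rate. *)
Let supersolution (Phi slope curv : R -> R) :
  (forall x, lo <= x <= hi -> is_derive x 1 Phi (slope x)) ->
  (forall x, lo <= x <= hi -> is_derive x 1 slope (curv x)) ->
  (forall x, lo <= x <= hi -> curv x + slope x ^+ 2 <= - (2 * lam * rho x + bmin / 8)) ->
  (forall x, lo <= x <= hi -> Phi lo <= Phi x) ->
  let f := fun y => expR (Phi (clamp lo hi y)) in
  continuous f /\
  exists q, [/\ exists2 delta, 0 < delta & second_diff_le eps a delta f q &
    exists2 kappa, 0 < kappa & clock_drift eps a (lam * gauss_mass R) kappa rho f q].
Proof.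
move=> dPhi dslope hcurv Phi_lo f.
have cf : continuous f.
  have cP := is_derive_continuous_within dPhi.
  move=> y; apply: continuous_comp; last exact: continuous_expR.
  by apply: (continuous_clamp_within lohi _ cP) => z; rewrite /= in_itv.
split => //.
pose F y := expR (Phi y).
have fE y : lo <= y <= hi -> f y = F y by move=> hy; rewrite /f clamp_id.
have dF z : lo <= z <= hi -> is_derive z 1 F (F z * slope z).
  by move=> hz; exact: (derive_comp_fun (is_derive_expR _) (dPhi z hz)).
have dF1 z : lo <= z <= hi ->
    is_derive z 1 (fun z => F z * slope z) (F z * slope z * slope z + F z * curv z).
  by move=> hz; exact: (deriveM_fun (dF z hz) (dslope z hz)).
pose q0 y := (2 * lam * rho y + bmin / 8) * f y.
have cq0 : continuous q0.
  move=> y; apply: cvgM; last exact: cf.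
  by apply: cvgD; [apply: cvgM; [exact: cvg_cst|exact: crho]|exact: cvg_cst].
pose m := expR (Phi lo); have m_gt0 : 0 < m by exact: expR_gt0.
have b0 := bmin0; have g0 := gauss_mass_gt0 R.
have k0 : 0 < bmin / 16 * m by rewrite mulr_gt0// divr_gt0.
have [|delta delta0 hdelta] :=
    @second_diff_bound _ F (fun z => F z * slope z) _ q0 lo hi eps a _ eps_lo a_hi k0 cq0 dF dF1.
  move=> z hz; rewrite /q0 fE//.
  have -> : F z * slope z * slope z + F z * curv z = (curv z + slope z ^+ 2) * F z by ring.
  by rewrite -mulNr ler_wpM2r ?hcurv// expR_ge0.
have hy y : eps <= y <= a -> lo <= y <= hi.
  by move=> /andP[y1 y2]; rewrite (le_trans (ltW eps_lo))// (le_trans y2)// ltW.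
exists (fun y => q0 y - bmin / 16 * m); split.
  exists delta => // y u ya ud; have [h1 h2 h3] := hdelta y u ya ud.
  by rewrite !fE// hy.
exists (bmin / 32 * m * gauss_mass R); first by apply: mulr_gt0 => //; apply: mulr_gt0 => //; exact: divr_gt0.
move=> y ya; have hm : m <= f y by rewrite fE ?hy// ler_expR Phi_lo// hy.
have h1 : bmin * m <= bmin * f y by rewrite ler_wpM2l// ltW.
have h2 : bmin * m * gauss_mass R <= bmin * f y * gauss_mass R by rewrite ler_wpM2r// ltW.
rewrite /q0.
have -> : ((2 * lam * rho y + bmin / 8) * f y - bmin / 16 * m) / 2 * gauss_mass R =
  lam * gauss_mass R * rho y * f y + (bmin * f y * gauss_mass R / 16 - bmin * m * gauss_mass R / 32).
  by field.
rewrite lerD2l.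
have -> : bmin / 32 * m * gauss_mass R = bmin * m * gauss_mass R / 32 by field.
by move: h2; move: (bmin * m * gauss_mass R) (bmin * f y * gauss_mass R) => u v; lra.
Qed.

Variables (d : measure_display) (T : measurableType d) (P : probability T R).
Variables (x : R) (B : R -> T -> R).
Hypothesis hB : is_BM_from P x B.

Lemma profile_estimate (t : R) : 0 <= x ->
  outer_le P [set w | exists s, [/\ 0 <= s,
      forall r, 0 <= r <= s -> eps < B r w < a,
      exists2 r, 0 <= r <= s & a' < B r w &
      (t%:E < \int[lebesgue_measure]_(r in `[0%R, s]) (rho (B r w))%:E)%E]]
    (x / a' * expR (3 * \sum_(i < n) c i - lam * gauss_mass R * t))%:E.
Proof.
move=> x0; have /andP[lo_a' a'_hi] := a'_itv.
have a'0 : 0 < a' by exact: lt_le_trans lo_a'.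
have [xa|xa] := boolP (eps < x < a); last first.
  exists set0; split => //.
    move=> w [s' [s'0 hs _ _]]; have := hs 0; rewrite lexx s'0 => /(_ isT).
    by have -> : B 0 w = x by [case: hB]; rewrite (negbTE xa).
  by rewrite measure0 lee_fin mulr_ge0 ?expR_ge0// divr_ge0// ltW.
have hx : lo <= x <= hi.
  by move/andP: xa => [/ltW x1 /ltW x2]; rewrite (le_trans (ltW eps_lo))// (le_trans x2)// ltW.
have xgt0 : 0 < x by case/andP: hx => /(lt_le_trans lo0).
have lohi' := lohi.
have h_lo : lo <= lo <= hi by rewrite lexx.
have mono z1 z2 := @Phi_nondecreasing a' z1 z2.
have [cf1 [q1 [[d1 d1_gt0 hd1] [k1 k1_gt0 hk1]]]] :=
  @supersolution Phi1 slope1 curv1 derive_Phi1 derive_slope1 curv1_le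
    (fun z hz => (mono lo z (lexx lo) (andP hz).1 (andP hz).2).1).
have [cf0 [q0 [[d0 d0_gt0 hd0] [k0 k0_gt0 hk0]]]] :=
  @supersolution (Phi0 a') slope0 curv0 (@derive_Phi0 a') derive_slope0 curv0_le
    (fun z hz => (mono lo z (lexx lo) (andP hz).1 (andP hz).2).2).
set f1 := (fun y => expR (Phi1 (clamp lo hi y))) in cf1 hd1 hk1.
set f0 := (fun y => expR (Phi0 a' (clamp lo hi y))) in cf0 hd0 hk0.
pose C := expR (Phi1 hi) + expR (Phi0 a' hi).
have f1_itv y : 1 <= f1 y <= C.
  have hy := clamp_itv y lohi; have /andP[h1 _] := Phi1_itv hy.
  have /andP[y1 y2] := hy; have [h2 _] := mono _ _ y1 y2 (lexx hi).
  rewrite /f1 -[X in X <= _ <= _](@expR0 R) ler_expR h1/= /C.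
  by rewrite (@le_trans _ _ (expR (Phi1 hi))) ?ler_expR// lerDl expR_ge0.
have f0_itv y : 0 <= f0 y <= C.
  have /andP[y1 y2] := clamp_itv y lohi; have [_ h2] := mono _ _ y1 y2 (lexx hi).
  rewrite /f0 expR_ge0/= /C.
  by rewrite (@le_trans _ _ (expR (Phi0 a' hi))) ?ler_expR// lerDr expR_ge0.
have f10 y : a' <= y -> f1 y <= f0 y.
  move=> ay; rewrite /f1 /f0 ler_expR; have /andP[y1 y2] := clamp_itv y lohi.
  by apply: Phi1_le_Phi0 => //; rewrite /clamp le_max le_min a'_hi ay orbT.
pose delta := Num.min d0 d1; pose kappa := Num.min k0 k1.
have delta_gt0 : 0 < delta by rewrite lt_min d0_gt0.
have kappa_gt0 : 0 < kappa by rewrite lt_min k0_gt0.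
have hd0' : second_diff_le eps a delta f0 q0.
  by move=> y u ya; rewrite le_min => /andP[u0 _]; exact: hd0.
have hd1' : second_diff_le eps a delta f1 q1.
  by move=> y u ya; rewrite le_min => /andP[_ u0]; exact: hd1.
have hk0' : clock_drift eps a (lam * gauss_mass R) kappa rho f0 q0.
  by move=> y ya; apply: le_trans (hk0 y ya); rewrite lerD2l ge_min lexx.
have hk1' : clock_drift eps a (lam * gauss_mass R) kappa rho f1 q1.
  by move=> y ya; apply: le_trans (hk1 y ya); rewrite lerD2l ge_min lexx orbT.
have lg : 0 <= lam * gauss_mass R by rewrite mulr_ge0// ltW// gauss_mass_gt0.
have := @path_estimate R eps a a' (lam * gauss_mass R) C delta kappa rho f0 f1 q0 q1 crho rho_ge0
  (continuous_measurable_fun cf0) (continuous_measurable_fun cf1) f0_itv f1_itv f10 lg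
  delta_gt0 kappa_gt0 hd0' hd1' hk0' hk1' d T P x B hB t.
apply: outer_le_sub => //; rewrite lee_fin /f0 clamp_id// -expRD.
have -> : x / a' = expR (ln x - ln a') by rewrite expRB !lnK ?posrE.
rewrite -expRD ler_expR; have := Phi0_le a' hx.
move: (Phi0 a' x) (ln x - ln a') (3 * \sum_(i < n) c i) (lam * gauss_mass R * t) => p u v z.
by lra.
Qed.

End profile.

Lemma derive_Rintegral (R : realType) (f : R -> R) (a u x : R) : a < x -> x < u ->
  {within `[a, u], continuous f} ->
  is_derive x 1 (fun y => \int[lebesgue_measure]_(z in `[a, y]) f z) (f x).
Proof.
move=> ax xu cf.
have fi : lebesgue_measure.-integrable `[a, u] (EFin \o f).
  by apply: continuous_compact_integrable cf; exact: segment_compact.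
have cfx : {for x, continuous f}.
  apply: (within_continuous_continuous (lt_trans ax xu) cf).
  by rewrite in_itv/= ax xu.
have [df dE] := continuous_FTC1_closed xu fi ax cfx.
by apply: DeriveDef; [exact: df|rewrite -derive1E; exact: dE].
Qed.

(** * Choice of the weights from the scales of the measure *)

Section ladder.
Variable R : realType.
Implicit Types (x : R).

Lemma sum_phi_le k n x :
  \sum_(i < n) phi (2 ^+ (k + i)) x <= psi (2 ^+ (k + n)) x - psi (2 ^+ k) x.
Proof.
elim: n => [|n IH]; first by rewrite big_ord0 addn0 subrr.
have := phi_le_psi x (exprn_ge0 (k + n) (ler0n R 2)).
rewrite big_ord_recr/= addnS exprS; lra.
Qed.

Lemma quaternary_level k n x : (4^-1) ^+ (k + n.+1) <= x <= (4^-1) ^+ k ->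
  exists2 i, (i < n.+1)%N & (4^-1) ^+ (k + i).+1 <= x <= (4^-1) ^+ (k + i).
Proof.
elim: n => [|n IH] /andP[x1 x2].
  by exists 0%N => //; rewrite addn0; rewrite addn1 in x1; rewrite x1.
have [h|h] := leP ((4^-1) ^+ (k + n.+1)) x.
  by have [|i ni hi] := IH; [rewrite h|exists i => //; exact: (ltn_trans ni)].
by exists n.+1 => //; rewrite -addnS x1/= ltW.
Qed.

Lemma sqrt_quaternary i x : (4^-1) ^+ i.+1 <= x <= (4^-1) ^+ i ->
  1 / 2 <= 2 ^+ i * Num.sqrt x <= 1.
Proof.
move=> /andP[x1 x2].
have s4 j : Num.sqrt ((4^-1) ^+ j) = (2^-1) ^+ j :> R.
  rewrite (_ : 4^-1 = (2^-1) ^+ 2 :> R); last by field.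
  by rewrite exprAC sqrtr_sqr ger0_norm// exprn_ge0.
have p2 : 0 < 2 ^+ i :> R by rewrite exprn_gt0.
have h1 : (2^-1) ^+ i.+1 <= Num.sqrt x by rewrite -s4 ler_wsqrtr.
have h2 : Num.sqrt x <= (2^-1) ^+ i by rewrite -s4 ler_wsqrtr.
have e1 : 2 ^+ i * (2^-1) ^+ i = 1 :> R by rewrite -exprMn divff ?expr1n// pnatr_eq0.
apply/andP; split.
  apply: (@le_trans _ _ (2 ^+ i * (2^-1) ^+ i.+1)); last by rewrite ler_pM2l.
  by rewrite exprS mulrCA e1 mulr1 div1r.
by rewrite -[leRHS]e1 ler_pM2l.
Qed.

Variables (k n : nat) (s : nat -> R) (rho : R -> R) (eps a a' : R).
Hypothesis s_gt0 : forall i, 0 < s i.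
Hypothesis s_noninc : forall i j, (i <= j)%N -> s j <= s i.
Hypothesis crho : continuous rho.
Hypothesis rho_ge0 : forall y, 0 <= rho y.

Let lo : R := (4^-1) ^+ (k + n.+1).
Let hi : R := (4^-1) ^+ k.

Hypothesis eps_lo : lo < eps.
Hypothesis a_hi : a < hi.
Hypothesis a'_itv : lo <= a' <= hi.
Hypothesis hrho : forall i, (i < n.+1)%N ->
  (\int[lebesgue_measure]_(z in `[0%R, ((4^-1) ^+ (k + i))%R]) (z ^+ 2 * rho z)%:E
    <= (s (k + i) * (4^-1) ^+ (k + i))%:E)%E.

(* Chosen so that the coefficient [c 0], the largest one, is 1/8. *)
Definition ladder_rate : R := (8 * (24 * 24) * s k)^-1.
Let lam := ladder_rate.
(** 24 * 24 = 9 * 64. For x between 4^-(k+i+1) and 4^-(k+i), the i-th profile alone gives a sum of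
    at least c i / 9, while W x <= 4 s (k + i) x. So 16 lam W <= x bb asks for c i to be 9 * 64 lam
    s (k + i). *)
Let c i : R := 24 * 24 * lam * s (k + i).
Let mm i : R := 2 ^+ (k + i).

Let W x := \int[lebesgue_measure]_(z in `[0, x]) (z ^+ 2 * rho z).
(** Starting at lo / 2 makes [Q] differentiable at [lo] itself, still away from the singularity at
    0. Only differences of [Q] matter. *)
Let Q x := \int[lebesgue_measure]_(z in `[lo / 2, x]) (W z / z ^+ 2).

Let lo_gt0 : 0 < lo. Proof. by rewrite exprn_gt0// invr_gt0. Qed.
Let hi_le1 : hi <= 1. Proof. by rewrite exprn_ile1// invf_le1// ler1n. Qed.
Let lo_hi : lo <= hi. Proof. by case/andP: a'_itv; exact: le_trans. Qed.
Let lam_gt0 : 0 < lam. Proof. by rewrite invr_gt0 mulr_gt0. Qed.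
Let c_gt0 i : 0 < c i. Proof. by rewrite !mulr_gt0. Qed.
Let mm_gt0 i : 0 < mm i. Proof. by rewrite exprn_gt0. Qed.

Let cdens : continuous (fun z : R => z ^+ 2 * rho z).
Proof. by move=> z; apply: cvgM; [exact: exprn_continuous|exact: crho]. Qed.

Let dW x : 0 < x -> is_derive x 1 W (x ^+ 2 * rho x).
Proof.
move=> x0; apply: (@derive_Rintegral _ (fun z => z ^+ 2 * rho z) 0 (x + 1)) => //.
  by rewrite ltrDl.
exact: continuous_subspaceT.
Qed.

Let dQ x : lo <= x -> is_derive x 1 Q (W x / x ^+ 2).
Proof.
move=> lx; have l0 := lo_gt0.
apply: (@derive_Rintegral _ (fun z => W z / z ^+ 2) (lo / 2) (x + 1)); [lra|lra|].
have d z : lo / 2 <= z <= x + 1 -> is_derive z 1 (fun z => W z / z ^+ 2)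
    (z ^+ 2 * rho z * (z * z)^-1 + W z * (- (1 * z + z * 1) / (z * z) ^+ 2)).
  move=> /andP[z1 z2]; have z0 : 0 < z by lra.
  exact: (deriveM_fun (dW z0) (deriveV_fun (deriveM_fun (derive_id_fun z) (derive_id_fun z))
    (lt0r_neq0 (mulr_gt0 z0 z0)))).
exact: (is_derive_continuous_within d).
Qed.

Let W_ge0 x : 0 <= W x.
Proof. by apply: Rintegral_ge0 => z _; rewrite mulr_ge0// sqr_ge0. Qed.

Let W_level i : (i < n.+1)%N -> W ((4^-1) ^+ (k + i)) <= s (k + i) * (4^-1) ^+ (k + i).
Proof.
move=> ni; rewrite /W /Rintegral -lee_fin fineK; first exact: hrho.
apply: integrable_fin_num => //=.
apply: continuous_compact_integrable; first exact: segment_compact.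
exact: continuous_subspaceT.
Qed.

Let level x : lo <= x <= hi -> exists i, [/\ (i < n.+1)%N, 1 / 9 <= phi (mm i) x &
  W x <= 4 * s (k + i) * x].
Proof.
move=> hx; have x0 : 0 < x by case/andP: hx => /(lt_le_trans lo_gt0).
have [i ni /[dup]hi' /andP[h1 h2]] := quaternary_level hx; exists i; split => //.
  by apply: phi_ge; exact: sqrt_quaternary.
apply: (@le_trans _ _ (W ((4^-1) ^+ (k + i)))).
  apply: (@is_derive_ge0_le _ _ (fun x => x ^+ 2 * rho x)) => // z /andP[z1 z2].
    by apply: dW; exact: lt_le_trans z1.
  by rewrite mulr_ge0// sqr_ge0.
apply: (le_trans (W_level ni)); rewrite mulrAC [leRHS]mulrC ler_wpM2l ?(ltW (s_gt0 _))//.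
by move: h1; rewrite exprS; lra.
Qed.

Let bb_ge x i : (i < n.+1)%N -> c i * phi (mm i) x <= bb n.+1 c mm x.
Proof.
move=> ni; rewrite /bb (bigD1 (Ordinal ni))//= lerDl; apply: sumr_ge0 => j _.
by rewrite mulr_ge0 ?(ltW (c_gt0 _))// phi_ge0// ltW.
Qed.

Let bmin : R := c n / 9.

Let bmin_gt0 : 0 < bmin. Proof. by rewrite divr_gt0. Qed.

(** From below, the profile of the scale of x contributes at least 1/9, with a weight no smaller
    than the last one. From above, all weights are at most c 0 = 1/8 and the profiles telescope to
    at most 1. *)
Let bb_itv x : lo <= x <= hi -> bmin <= bb n.+1 c mm x <= 1 / 8.
Proof.
move=> hx; apply/andP; split.
  have [i [ni h1 _]] := level hx; apply: le_trans (bb_ge x ni).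
  have h2 : c n <= c i.
    by rewrite /c ler_wpM2l ?mulr_ge0 ?(ltW lam_gt0)// s_noninc// leq_add2l -ltnS.
  apply: (@le_trans _ _ (c i * (1 / 9))).
    by rewrite /bmin div1r ler_wpM2r.
  by apply: ler_wpM2l => //; exact: ltW.
apply: (@le_trans _ _ (\sum_(i < n.+1) c 0%N * phi (mm i) x)).
  apply: ler_sum => i _; rewrite ler_wpM2r ?phi_ge0 ?(ltW (mm_gt0 _))//.
  by rewrite /c ler_wpM2l ?mulr_ge0 ?(ltW lam_gt0)// s_noninc// addn0 leq_addr.
rewrite -mulr_sumr.
have -> : 1 / 8 = c 0%N * 1.
  by rewrite /c addn0 /lam /ladder_rate; field; rewrite gt_eqF.
rewrite ler_wpM2l ?(ltW (c_gt0 _))//; apply: (le_trans (sum_phi_le k n.+1 x)).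
have /andP[_ h1] := psi_itv x (exprn_ge0 (k + n.+1) (ler0n R 2)).
have /andP[h2 _] := psi_itv x (exprn_ge0 k (ler0n R 2)).
lra.
Qed.

Let W_le x : lo <= x <= hi -> 16 * lam * W x <= x * bb n.+1 c mm x.
Proof.
move=> hx; have x0 : 0 < x by case/andP: hx => /(lt_le_trans lo_gt0).
have [i [ni h1 h2]] := level hx.
apply: (@le_trans _ _ (x * (c i * (1 / 9)))); last first.
  rewrite ler_wpM2l ?(ltW x0)//; apply: le_trans (bb_ge x ni).
  by rewrite ler_wpM2l ?(ltW (c_gt0 _)).
apply: (@le_trans _ _ (16 * lam * (4 * s (k + i) * x))).
  by rewrite ler_wpM2l// mulr_ge0// ltW.
by rewrite /c; have -> : 16 * lam * (4 * s (k + i) * x) = x * (24 * 24 * lam * s (k + i) * (1 / 9)) by field.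
Qed.

Let dWh x : lo <= x <= hi -> is_derive x 1 W (x ^+ 2 * rho x).
Proof. by move=> /andP[lx _]; apply: dW; exact: lt_le_trans lx. Qed.
Let dQh x : lo <= x <= hi -> is_derive x 1 Q (W x / x ^+ 2).
Proof. by move=> /andP[lx _]; exact: dQ. Qed.

Variables (d : measure_display) (T : measurableType d) (P : probability T R).
Variables (x : R) (B : R -> T -> R).
Hypothesis hB : is_BM_from P x B.

Lemma ladder_estimate (t : R) : 0 <= x ->
  outer_le P [set w | exists s, [/\ 0 <= s,
      forall r, 0 <= r <= s -> eps < B r w < a,
      exists2 r, 0 <= r <= s & a' < B r w &
      (t%:E < \int[lebesgue_measure]_(r in `[0%R, s]) (rho (B r w))%:E)%E]]
    (x / a' * expR (3 * (24 * 24 * ladder_rate * \sum_(i < n.+1) s (k + i))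
       - ladder_rate * gauss_mass R * t))%:E.
Proof.
move=> x0.
have c_ge0 i : 0 <= c i := ltW (c_gt0 i).
have W_ge0' z : lo <= z <= hi -> 0 <= W z := fun=> W_ge0 z.
have -> : 24 * 24 * ladder_rate * \sum_(i < n.+1) s (k + i) = \sum_(i < n.+1) c i.
  by rewrite mulr_sumr.
exact: (@profile_estimate R n.+1 c mm c_ge0 mm_gt0 lam lo hi bmin rho W Q lo_gt0 lo_hi hi_le1
  (ltW lam_gt0) bmin_gt0 rho_ge0 dWh dQh W_ge0' W_le bb_itv crho eps a a' eps_lo a_hi a'_itv
  d T P x B hB t x0).
Qed.

End ladder.

(** * Smoothing the speed measure *)

Section smoothing.
Variable R : realType.
Local Notation leb := (@lebesgue_measure R).

Definition tent (v : R) : R := Num.max 0 (1 - `|v|).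

Lemma tent_itv v : 0 <= tent v <= 1.
Proof. by rewrite /tent le_max lexx/= ge_max ler01 gerBl normr_ge0. Qed.

Lemma tent_out v : 1 <= `|v| -> tent v = 0.
Proof. by move=> v1; rewrite /tent; apply/max_idPl; rewrite subr_le0. Qed.

Lemma tent_in v : `|v| <= 1 / 2 -> 1 / 2 <= tent v.
Proof. by move=> v1; rewrite /tent le_max; apply/orP; right; lra. Qed.

Lemma continuous_tent : continuous tent.
Proof.
move=> v; apply: (@continuous_max R R (fun=> 0) (fun v => 1 - `|v|)); first exact: cvg_cst.
by apply: cvgB; [exact: cvg_cst|exact: norm_continuous].
Qed.

Lemma continuous_kernel (N : R) (f : R -> R) :
  continuous f -> continuous (fun z => N * tent (N * f z)).
Proof.
move=> cf z; apply: cvgM; first exact: cvg_cst.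
have cNf : {for z, continuous (fun z => N * f z)} by apply: cvgM; [exact: cvg_cst|exact: cf].
exact: (continuous_comp cNf (@continuous_tent _)).
Qed.

Variable mu : {finite_measure set R -> \bar R}.
Variable N : R.
Hypothesis N_gt0 : 0 < N.

Definition smooth (y : R) : R := \int[mu]_z (N * tent (N * (y - z))).

Let kerf (y z : R) : R := N * tent (N * (y - z)).

Let kerf_itv y z : 0 <= kerf y z <= N.
Proof.
have /andP[h1 h2] := tent_itv (N * (y - z)).
by rewrite /kerf mulr_ge0 ?(ltW N_gt0)//= ler_piMr// ltW.
Qed.

Let mkerf y : measurable_fun setT (kerf y).
Proof.
apply: continuous_measurable_fun; apply: continuous_kernel => z.
by apply: cvgB; [exact: cvg_cst|exact: cvg_id].
Qed.

Let ikerf y : mu.-integrable setT (EFin \o kerf y).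
Proof.
apply: (@le_integrable _ _ _ mu setT measurableT _ (fun=> N%:E)) => //.
- exact/measurable_EFinP.
- move=> z _ /=; have /andP[h1 h2] := kerf_itv y z.
  by rewrite lee_fin !ger0_norm// ltW.
- exact: finite_measure_integrable_cst.
Qed.

Lemma smoothE y : (\int[mu]_z (N * tent (N * (y - z)))%:E)%E = (smooth y)%:E.
Proof. by rewrite /smooth /Rintegral fineK//; apply: integrable_fin_num => //; exact: ikerf. Qed.

Lemma smooth_ge0 y : 0 <= smooth y.
Proof. by apply: Rintegral_ge0 => z _; have /andP[] := kerf_itv y z. Qed.

Lemma continuous_smooth : continuous smooth.
Proof.
move=> y.
apply: (@continuity_under_integral R _ _ mu kerf setT measurableT (y - 1) (y + 1) _ _ (fun=> N)).
- by move=> x _; exact: ikerf.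
- apply: aeW => z _ x _; apply: (@continuous_kernel N (fun x => x - z)) => x'.
  by apply: cvgB; [exact: cvg_id|exact: cvg_cst].
- exact: finite_measure_integrable_cst.
- move=> x _; apply: aeW => z _; have /andP[h1 h2] := kerf_itv x z.
  by rewrite ger0_norm.
- by rewrite inE/= in_itv/=; apply/andP; split; lra.
Qed.

Variables w b : R -> R.
Hypothesis mw : measurable_fun setT w.
Hypothesis w0 : forall y, 0 <= w y.
Hypothesis cb : continuous b.

Let h (p : R * measurableTypeR R) : \bar R := (w p.2 * (N * tent (N * (b p.2 - p.1))))%:E.

Let mh : measurable_fun setT h.
Proof.
apply/measurable_EFinP.
have m1 : measurable_fun setT (fun p : R * measurableTypeR R => p.1) by exact: measurable_fst.
have m2 : measurable_fun setT (fun p : R * measurableTypeR R => (p.2 : R)) by exact: measurable_snd.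
have m3 := measurableT_comp (continuous_measurable_fun cb) m2.
have m4 := measurable_funM (measurable_cst N) (measurable_funB m3 m1).
have m5 := measurableT_comp (continuous_measurable_fun continuous_tent) m4.
exact: (measurable_funM (measurableT_comp mw m2) (measurable_funM (measurable_cst N) m5)).
Qed.

Let h0 p : (0 <= h p)%E.
Proof. by rewrite lee_fin mulr_ge0//; have /andP[] := kerf_itv (b p.2) p.1. Qed.

Definition kernel_mass (z : R) : \bar R :=
  (\int[leb]_y (w y * (N * tent (N * (b y - z))))%:E)%E.

Lemma kernel_mass_ge0 z : (0 <= kernel_mass z)%E.
Proof. by apply: integral_ge0 => y _; exact: (h0 (z, y)). Qed.

Lemma measurable_kernel_mass : measurable_fun setT kernel_mass.
Proof. exact: (@measurable_fun_fubini_tonelli_F _ _ R (measurableTypeR R) R leb h mh h0). Qed.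

(** Used twice: with [b] the identity and [w] equal to y^2 on [0, x], for the moments; with [b] the
    path and [w] the indicator of [0, s], for the clock. *)
Lemma smooth_tonelli :
  (\int[leb]_y (w y * smooth (b y))%:E = \int[mu]_z kernel_mass z)%E.
Proof.
have e1 := @fubini_tonelli1 _ _ R (measurableTypeR R) R mu leb h mh h0.
have e2 := @fubini_tonelli2 _ _ R (measurableTypeR R) R mu leb h mh h0.
rewrite e1 /fubini_F /fubini_G /h/= in e2.
transitivity (\int[leb]_y \int[mu]_z (w y * (N * tent (N * (b y - z))))%:E)%E; last exact/esym.
apply: eq_integral => y _; rewrite EFinM -smoothE -ge0_integralZl//.
- by apply/measurable_EFinP; exact: (mkerf (b y)).
- by move=> z _; rewrite lee_fin; have /andP[] := kerf_itv (b y) z.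
- by rewrite lee_fin.
Qed.

End smoothing.

Section restricted_speed.
Variable R : realType.
Local Notation leb := (@lebesgue_measure R).
Variable m : {measure set R -> \bar R}.
Variables kap M : R.
Let K : set R := `[kap, M]%classic.
Hypothesis mKoo : (m K < +oo)%E.
Let mK : measurable K. Proof. exact: measurable_itv. Qed.

Definition restricted_speed : {finite_measure set R -> \bar R} := mfrestr mK mKoo.

Lemma integral_restricted_speed (f : R -> \bar R) : measurable_fun setT f ->
  (forall x, (0 <= f x)%E) ->
  (\int[restricted_speed]_x f x = \int[m]_(x in `[kap, M]) f x)%E.
Proof.
move=> mf f0; rewrite (@ge0_negligible_integral _ _ _ _ _ (~` K))//.
- rewrite setDE setCK setTI; apply: eq_measure_integral => A mA AK.
  by rewrite /restricted_speed/= /mfrestr /mrestr setIidl.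
- exact: measurableC.
- by rewrite /restricted_speed/= /mfrestr /mrestr setICl measure0.
Qed.

Hypothesis kap_gt0 : 0 < kap.

(** The kernel at z >= kap has radius 1/N <= z/2, so y^2 <= 4 z^2 on it, and bounding it by N over a
    length 2/N gives 4 * 2 = 8. A point z >= 2x contributes nothing, since z - y >= x >= 1/N. *)
Lemma smooth_moment (N x : R) : 2 / kap <= N -> kap <= x ->
  (\int[leb]_(y in `[0%R, x]) (y ^+ 2 * smooth restricted_speed N y)%:E <=
   8%:E * \int[m]_(z in `]0%R, (2 * x)%R[) (z ^+ 2)%:E)%E.
Proof.
move=> kN kx; have N0 : 0 < N by apply: lt_le_trans kN; rewrite divr_gt0.
have Ninv : N^-1 <= kap / 2.
  by rewrite -[kap / 2]invrK lef_pV2 ?posrE ?invr_gt0 ?divr_gt0// invf_div.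
have Ni0 : 0 < N^-1 by rewrite invr_gt0.
pose w y : R := \1_(`[0, x]%classic : set R) y * y ^+ 2.
have mw : measurable_fun setT w.
  by apply: measurable_funM; [exact: measurable_indic|exact: exprn_measurable].
have w0 y : 0 <= w y by rewrite mulr_ge0// sqr_ge0.
have cid : continuous (fun y : R => y) by move=> y; exact: cvg_id.
rewrite integral_mkcond.
rewrite (_ : \int[leb]_y _ = \int[leb]_y (w y * smooth restricted_speed N y)%:E)%E; last first.
  apply: eq_integral => y _; rewrite patchE /w indicE.
  by case: ifPn => _; rewrite ?mul1r// !mul0r.
rewrite (smooth_tonelli restricted_speed N0 mw w0 cid).
have mx2 : measurable_fun setT (fun z : R => (z ^+ 2)%:E).
  by apply/measurable_EFinP; exact: exprn_measurable.
pose D : set R := `]0%R, (2 * x)%R[%classic.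
have mD : measurable D by exact: measurable_itv.
have mr : measurable_fun setT ((fun z : R => (z ^+ 2)%:E) \_ D).
  by apply/(measurable_restrictT _ mD); exact: measurable_funTS.
rewrite [X in (_ <= _ * X)%E]integral_mkcond -ge0_integralZl//; first last.
- by move=> z _; rewrite patchE; case: ifP => // _; rewrite lee_fin sqr_ge0.
pose g z : \bar R := (8%:E * (((fun z : R => (z ^+ 2)%:E) \_ D) z))%E.
have mg : measurable_fun setT g.
  exact: measurable_funeM.
have g0 z : (0 <= g z)%E.
  by rewrite /g mule_ge0// patchE; case: ifP => // _; rewrite lee_fin sqr_ge0.
apply: (@le_trans _ _ (\int[restricted_speed]_z g z)%E); last first.
  rewrite integral_restricted_speed//; exact: ge0_subset_integral.
have mF := @measurable_kernel_mass R N N0 w (fun y => y) mw w0 cid.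
have F0 := @kernel_mass_ge0 R N N0 w (fun y => y) w0.
rewrite (integral_restricted_speed mF F0) (integral_restricted_speed mg g0).
apply: ge0_le_integral => //; [exact: measurable_funTS|exact: measurable_funTS|].
move=> z; rewrite /= in_itv/= => /andP[kz zM].
have z0 : 0 < z by exact: lt_le_trans kz.
rewrite /kernel_mass /g patchE; case: ifPn => zD; last first.
  rewrite mule0 integral0_eq// => y _; rewrite /w indicE.
  have [yx|yx] := boolP (y \in _); last by rewrite !mul0r.
  move: yx; rewrite inE/= in_itv/= => /andP[y0 yx].
  rewrite tent_out ?mulr0// normrM (gtr0_norm N0) -ler_pdivrMl// mulr1.
  move: zD; rewrite notin_setE /D/= in_itv/= z0/= => /negP; rewrite -leNgt => zx.
  rewrite distrC ger0_norm; lra.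
pose I : set R := `[z - N^-1, z + N^-1]%classic.
have mI : measurable I by exact: measurable_itv.
apply: (@le_trans _ _ (\int[leb]_y ((4 * z ^+ 2 * N) * \1_I y)%:E)%E).
  apply: ge0_le_integral => //.
  - move=> y _; rewrite lee_fin; apply: mulr_ge0 => //; apply: mulr_ge0; first exact: ltW.
    by have /andP[] := tent_itv (N * (y - z)).
  - apply/measurable_EFinP; apply: measurable_funM => //.
    apply: continuous_measurable_fun; apply: (@continuous_kernel _ N (fun y => y - z)) => y.
    by apply: cvgB; [exact: cvg_id|exact: cvg_cst].
  - by apply/measurable_EFinP; apply: measurable_funM => //; exact: measurable_indic.
  - move=> y _; rewrite lee_fin.
    have [yI|yI] := pselect (I y); last first.
      have h : 1 <= `|N * (y - z)|.
        rewrite normrM (gtr0_norm N0) -ler_pdivrMl// mulr1 leNgt; apply/negP => h; apply: yI.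
        by rewrite /I/= in_itv/=; move: h; rewrite ltr_norml => /andP[h1 h2]; apply/andP; split; lra.
      rewrite (tent_out h) !mulr0 mulr_ge0//.
      by apply: mulr_ge0; [rewrite mulr_ge0// sqr_ge0|exact: ltW].
    rewrite [X in _ <= _ * X]indicE (mem_set yI) mulr1.
    have /andP[t0 t1] := tent_itv (N * (y - z)).
    have hw : w y <= 4 * z ^+ 2.
      rewrite /w indicE; have [yx|yx] := boolP (y \in _); last by rewrite mul0r mulr_ge0// sqr_ge0.
      rewrite mul1r; move: yx; rewrite inE/= in_itv/= => /andP[y0 yx].
      move: yI; rewrite /I/= in_itv/= => /andP[_ yz].
      have : y ^+ 2 <= (2 * z) ^+ 2 by rewrite ler_pXn2r ?nnegrE//; lra.
      by rewrite exprMn; lra.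
    apply: ler_pM => //; first by rewrite mulr_ge0// ltW.
    by rewrite ler_piMr// ltW.
under eq_integral do rewrite EFinM.
rewrite ge0_integralZl//; last 2 first.
- by apply/measurable_EFinP; exact: measurable_indic.
- by rewrite lee_fin; apply: mulr_ge0; [rewrite mulr_ge0// sqr_ge0|exact: ltW].
have lI : leb I = (2 / N)%:E.
  rewrite /I lebesgue_measure_itv/= lte_fin ifT; last lra.
  by rewrite -EFinD; congr EFin; field; rewrite gt_eqF.
rewrite integral_indic// setIT [X in (_ * X)%E]lI -!EFinM lee_fin.
by rewrite le_eqVlt; apply/orP; left; apply/eqP; field; rewrite gt_eqF.
Qed.

End restricted_speed.

(** * Comparison of the smoothed clock with the local time clock *)

Section smoothed_clock.
Variable R : realType.
Local Notation leb := (@lebesgue_measure R).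
Variable m : {measure set R -> \bar R}.
Variables kap M : R.
Let K : set R := `[kap, M]%classic.
Hypothesis mKoo : (m K < +oo)%E.
Variables (b Lt : R -> R) (s : R).
Hypothesis cb : continuous b.
Hypothesis cL : continuous Lt.
Hypothesis L0 : forall y, 0 <= Lt y.
Hypothesis occ : forall A, measurable A ->
  leb (`[0%R, s]%classic `&` (b @^-1` A)) = (\int[leb]_(y in A) (Lt y)%:E)%E.

Let mK : measurable K. Proof. exact: measurable_itv. Qed.

(** The factor 1/2 is the value of the tent at half its radius. Hence the kernel mass at z is at
    least N/2 times the time spent within 1/(2N) of z, that is N/2 times the integral of [Lt] over a
    length 1/N. Uniform continuity of [Lt] and finiteness of [m K] make the error uniform. *)
Lemma smooth_clock (e : R) : 0 < e -> exists N0 : R, forall N : R, 0 < N -> N0 <= N ->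
  ((1 / 2)%:E * \int[m]_(y in K) (Lt y)%:E <=
    \int[leb]_(r in `[0%R, s]) (smooth (restricted_speed mKoo) N (b r))%:E + e%:E)%E.
Proof.
move=> e0; set mu := restricted_speed mKoo.
have fmK : m K \is a fin_num by rewrite ge0_fin_numE.
have mK0 : 0 <= fine (m K) by rewrite fine_ge0.
pose e' := e / (fine (m K) + 1).
have e'0 : 0 < e' by rewrite divr_gt0// ltr_wpDl.
have [r r0 hr] := unif_continuous_segment kap M cL e'0.
exists r^-1 => N N0 rN.
have Nr : N^-1 <= r by rewrite -[r]invrK lef_pV2 ?posrE ?invr_gt0.
have Ni0 : 0 < N^-1 by rewrite invr_gt0.
pose J : set R := `[0%R, s]%classic.
have mJ : measurable J by exact: measurable_itv.
pose w r : R := \1_J r.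
have mw : measurable_fun setT w by exact: measurable_indic.
have w0 y : 0 <= w y by [].
have mL : measurable_fun setT (fun y => (Lt y)%:E).
  by apply/measurable_EFinP; exact: continuous_measurable_fun.
have eI : (\int[leb]_(r in J) (smooth mu N (b r))%:E =
    \int[mu]_z kernel_mass N w b z)%E.
  rewrite -(smooth_tonelli mu N0 mw w0 cb) integral_mkcond.
  apply: eq_integral => y _; rewrite patchE /w indicE.
  by case: ifPn => _; rewrite ?mul1r// mul0r.
rewrite eI (integral_restricted_speed mKoo (measurable_kernel_mass N0 mw w0 cb) (@kernel_mass_ge0 R N N0 w b w0)).
have inner z : K z -> ((1 / 2)%:E * (Lt z)%:E <= kernel_mass N w b z + (e' / 2)%:E)%E.
  rewrite /K/= in_itv/= => Kz.
  pose I : set R := `[z - N^-1 / 2, z + N^-1 / 2]%classic.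
  have mI : measurable I by exact: measurable_itv.
  have lI : leb I = (N^-1)%:E.
    rewrite /I lebesgue_measure_itv/= lte_fin ifT; last lra.
    by rewrite -EFinD; congr EFin; field; rewrite gt_eqF.
  have mA0 : measurable (J `&` b @^-1` I).
    apply: measurableI => //; rewrite -[X in measurable X]setTI.
    exact: (continuous_measurable_fun cb).
  pose A : set R := J `&` b @^-1` I.
  have mA : measurable A by exact: mA0.
  pose c : R := N / 2.
  pose g1 (y : R) : R := c * \1_A y.
  have h1 : (c%:E * leb A <= kernel_mass N w b z)%E.
    apply: (@le_trans _ _ (\int[leb]_y (g1 y)%:E)%E).
      rewrite /g1; under eq_integral do rewrite EFinM.
      rewrite ge0_integralZl//; last 2 first.
      - by apply/measurable_EFinP; exact: measurable_indic.
      - by rewrite lee_fin divr_ge0// ltW.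
      by rewrite integral_indic// setIT.
    apply: ge0_le_integral => //.
    - by move=> y _; rewrite lee_fin mulr_ge0// divr_ge0// ltW.
    - by apply/measurable_EFinP; apply: measurable_funM => //; exact: measurable_indic.
    - apply/measurable_EFinP; apply: measurable_funM => //.
      apply: continuous_measurable_fun; apply: (@continuous_kernel _ N (fun y => b y - z)) => y.
      by apply: cvgB; [exact: cb|exact: cvg_cst].
    - move=> y _; rewrite lee_fin /g1 /c.
      have /andP[t0 t1] := tent_itv (N * (b y - z)).
      have [[yJ yI]|yI] := pselect (A y); last first.
        by rewrite indicE (memNset yI) mulr0 mulr_ge0// mulr_ge0// ltW.
      rewrite /w !indicE (mem_set (conj yJ yI : A y)) (mem_set yJ) mulr1 mul1r.
      rewrite ler_wpM2l ?(ltW N0)// -[2^-1]mul1r; apply: tent_in.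
      move: yI; rewrite /I/= in_itv/= => /andP[i1 i2].
      rewrite normrM (gtr0_norm N0) -ler_pdivlMl// mulrC.
      by rewrite ler_norml; apply/andP; split; lra.
  have h2 : ((N^-1 * (Lt z - e'))%:E <= leb A)%E.
    have [le|el] := leP (Lt z) e'.
      apply: (@le_trans _ _ 0%E); last exact: measure_ge0.
      by rewrite lee_fin mulr_ge0_le0 ?subr_le0// ltW.
    rewrite /A occ//.
    have -> : (N^-1 * (Lt z - e'))%:E = (\int[leb]_(y in I) (Lt z - e')%:E)%E.
      by rewrite integral_cst// [X in (_ * X)%E]lI -EFinM mulrC.
    apply: ge0_le_integral => //.
    - by move=> y _; rewrite lee_fin subr_ge0 ltW.
    - exact: measurable_funTS.
    - move=> y; rewrite /I/= in_itv/= => /andP[y1 y2]; rewrite lee_fin.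
      have : `|Lt z - Lt y| < e'.
        by apply: hr => //; rewrite ltr_norml; apply/andP; split; lra.
      by move=> /ltr_distlDr; lra.
  have h3 := le_trans (lee_wpmul2l (_ : 0 <= c%:E)%E h2) h1.
  rewrite -EFinM in h3; rewrite -EFinM.
  apply: (@le_trans _ _ ((N / 2 * (N^-1 * (Lt z - e')))%:E + (e' / 2)%:E)%E).
    rewrite -EFinD lee_fin le_eqVlt; apply/orP; left; apply/eqP; field.
    by rewrite gt_eqF.
  by rewrite leeD2r// h3// lee_fin divr_ge0// ltW.
have mk := measurable_funTS (measurable_kernel_mass N0 mw w0 cb) (D := K).
rewrite -ge0_integralZl//; last 2 first.
- exact: measurable_funTS.
- by move=> z _; rewrite lee_fin.
apply: (@le_trans _ _ (\int[m]_(z in K) (kernel_mass N w b z + (e' / 2)%:E))%E).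
  apply: ge0_le_integral => //.
  - by move=> z _; rewrite mule_ge0// lee_fin.
  - by apply: measurable_funeM; exact: measurable_funTS.
  - by apply: emeasurable_funD.
rewrite ge0_integralD//; last 2 first.
- by move=> z _; exact: kernel_mass_ge0.
- by rewrite lee_fin divr_ge0// ltW.
rewrite leeD2l// integral_cst// -(fineK fmK) -EFinM lee_fin.
have : e' * fine (m K) <= e.
  rewrite /e' mulrAC ler_pdivrMr ?ltr_wpDl// ler_wpM2l ?(ltW e0)//; lra.
have : 0 <= e' * fine (m K) by rewrite mulr_ge0// ltW.
lra.
Qed.

End smoothed_clock.

(** * Local time and absorption along a path *)

Section occupation.
Variable R : realType.
Local Notation leb := (@lebesgue_measure R).

Lemma continuous_max0_within (b : R -> R) : {within `[0%R, +oo[, continuous b} ->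
  continuous (fun r : R => b (Num.max 0 r)).
Proof.
move=> /subspace_continuousP cb x.
have A0 y : (`[0%R, +oo[%classic : set R) (Num.max 0 y) by rewrite /= in_itv/= andbT le_max lexx.
apply: (@cvg_comp _ _ _ (fun r => Num.max 0 r) b _ (within `[0%R, +oo[%classic (nbhs (Num.max 0 x)))); last exact: cb.
move=> V /= hV.
have cm : continuous (fun r : R => Num.max 0 r).
  move=> r; apply: (@continuous_max R R (fun=> 0) (fun r => r)); [exact: cvg_cst|exact: cvg_id].
have H : nbhs x [set y | (`[0%R, +oo[%classic : set R) (Num.max 0 y) -> V (Num.max 0 y)] := cm x _ hV.
rewrite /= nbhs_simpl /=.
by apply: (filterS _ H) => y /= hy; exact: (hy (A0 y)).
Qed.

(** The occupation formula speaks of local times for almost every level only. Continuity upgrades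
    such comparisons to every level, as is necessary since [m] may charge Lebesgue-null sets. *)
Lemma integral_small_itv_le (f g : R -> R) (c r0 : R) : continuous f -> continuous g ->
  (forall y, 0 <= f y) -> (forall y, 0 <= g y) -> 0 < r0 ->
  (forall r : R, 0 < r -> r < r0 ->
    (\int[leb]_(y in `[(c - r)%R, (c + r)%R]) (f y)%:E <=
     \int[leb]_(y in `[(c - r)%R, (c + r)%R]) (g y)%:E)%E) ->
  f c <= g c.
Proof.
move=> cf cg f0 g0 r00 hfg; rewrite leNgt; apply/negP => gf.
pose e : R := (f c - g c) / 3.
have e0 : 0 < e by rewrite divr_gt0// subr_gt0.
have [r1 r10 h1] := continuousP_dist (cf c) e0.
have [r2 r20 h2] := continuousP_dist (cg c) e0.
pose r : R := Num.min r0 (Num.min r1 r2) / 2.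
have rm : 0 < Num.min r0 (Num.min r1 r2) by rewrite !lt_min r00 r10.
have r_gt0 : 0 < r by rewrite divr_gt0.
have [rr0 [rr1 rr2]] : r < r0 /\ r < r1 /\ r < r2.
  have h : r < Num.min r0 (Num.min r1 r2) by rewrite /r; lra.
  by move: h; rewrite !lt_min => /andP[-> /andP[-> ->]].
have := hfg r r_gt0 rr0.
pose I : set R := `[(c - r)%R, (c + r)%R]%classic.
have mI : measurable I by exact: measurable_itv.
have lI : leb I = (2 * r)%:E.
  rewrite /I lebesgue_measure_itv/= lte_fin ifT; last lra.
  by rewrite -EFinD; congr EFin; ring.
have mf : measurable_fun I (fun y => (f y)%:E).
  by apply/measurable_funTS/measurable_EFinP; exact: continuous_measurable_fun.
have mg : measurable_fun I (fun y => (g y)%:E).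
  by apply/measurable_funTS/measurable_EFinP; exact: continuous_measurable_fun.
have Iy y : I y -> `|c - y| <= r.
  by rewrite /I/= in_itv/= => /andP[y1 y2]; rewrite ler_norml; apply/andP; split; lra.
have hf : (((f c - e) * (2 * r))%:E <= \int[leb]_(y in I) (f y)%:E)%E.
  apply: (@le_trans _ _ (\int[leb]_(y in I) (f c - e)%:E)%E).
    by rewrite integral_cst// [X in (_ * X)%E]lI -EFinM.
  apply: ge0_le_integral => //.
  - by move=> y _; rewrite lee_fin; have := g0 c; rewrite /e; lra.
  - move=> y /Iy hy; rewrite lee_fin.
    have : `|f c - f y| < e by apply: h1; exact: le_lt_trans hy rr1.
    by rewrite ltr_norml => /andP[_ ?]; lra.
have hg : (\int[leb]_(y in I) (g y)%:E <= ((g c + e) * (2 * r))%:E)%E.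
  apply: (@le_trans _ _ (\int[leb]_(y in I) (g c + e)%:E)%E); last first.
    by rewrite integral_cst// [X in (_ * X)%E]lI -EFinM.
  apply: ge0_le_integral => //.
  - by move=> y _; rewrite lee_fin.
  - move=> y /Iy hy; rewrite lee_fin.
    have : `|g c - g y| < e by apply: h2; exact: le_lt_trans hy rr2.
    by rewrite ltr_norml => /andP[? _]; lra.
move=> h; have := le_trans hf (le_trans h hg); rewrite lee_fin ler_pM2r ?mulr_gt0//.
by rewrite /e; lra.
Qed.

Variable m : {measure set R -> \bar R}.
Variables (b : R -> R) (L : R -> R -> R).
Hypothesis cb : continuous b.
Hypothesis L0 : forall y s, 0 <= L y s.
Hypothesis cL : forall p : R * R, {for p, continuous (fun q : R * R => L q.1 q.2)}.
Hypothesis occ : forall (s : R) A, 0 <= s -> measurable A ->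
  leb (`[0%R, s]%classic `&` (b @^-1` A)) = (\int[leb]_(y in A) (L y s)%:E)%E.

Definition clock s : \bar R := (\int[m]_y (L y s)%:E)%E.

Lemma continuous_level s : continuous (fun y => L y s).
Proof.
move=> y; apply: (@continuous2_cvg R R R R (nbhs y) _ id (fun=> s) L y s);
  [exact: (@cL (y, s))|exact: cvg_id|exact: cvg_cst].
Qed.

Lemma continuous_time y : continuous (fun s => L y s).
Proof.
move=> s; apply: (@continuous2_cvg R R R R (nbhs s) _ (fun=> y) id L y s);
  [exact: (@cL (y, s))|exact: cvg_cst|exact: cvg_id].
Qed.

Lemma measurable_level s : measurable_fun setT (fun y => (L y s)%:E).
Proof. by apply/measurable_EFinP; apply: continuous_measurable_fun; exact: continuous_level. Qed.

Let mpre A : measurable A -> measurable (b @^-1` A).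
Proof. by move=> mA; rewrite -[X in measurable X]setTI; exact: (continuous_measurable_fun cb). Qed.

Lemma level_le (s s' y r0 : R) : 0 <= s -> 0 <= s' -> 0 < r0 ->
  (forall r : R, 0 < r -> r < r0 ->
    `[0%R, s]%classic `&` (b @^-1` `[y - r, y + r]%classic) `<=`
    `[0%R, s']%classic `&` (b @^-1` `[y - r, y + r]%classic)) ->
  L y s <= L y s'.
Proof.
move=> s0 s'0 r00 h.
apply: (@integral_small_itv_le (fun y => L y s) (fun y => L y s') y r0) => //;
  [exact: continuous_level|exact: continuous_level|].
move=> r r_gt0 rr0; rewrite -!occ// le_measure ?inE//; last exact: h.
- by apply: measurableI => //; exact: mpre.
- by apply: measurableI => //; exact: mpre.
Qed.

Lemma level_nondecreasing (s s' y : R) : 0 <= s -> s <= s' -> L y s <= L y s'.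
Proof.
move=> s0 ss'; apply: (@level_le s s' y 1) => //; first exact: le_trans ss'.
move=> r _ _ u [/= us ub]; split => //=.
by move: us; rewrite !in_itv/= => /andP[-> us]; exact: le_trans ss'.
Qed.

Lemma level_eq0 (s y r0 : R) : 0 <= s -> 0 < r0 ->
  (forall r, 0 <= r <= s -> r0 <= `|y - b r|) -> L y s = 0.
Proof.
move=> s0 r00 h; apply/eqP; rewrite eq_le L0 andbT.
apply: (@integral_small_itv_le (fun y => L y s) (fun=> 0) y r0) => //.
- exact: continuous_level.
- by move=> z; exact: cvg_cst.
move=> r r_gt0 rr0; rewrite -occ// integral0.
rewrite (_ : _ `&` _ = set0) ?measure0//.
apply/seteqP; split => // u [/=]; rewrite !in_itv/= => us /andP[u1 u2].
have := h u us; rewrite leNgt => /negP; apply.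
by rewrite ltr_norml; apply/andP; split; lra.
Qed.

Lemma clock_nondecreasing (s s' : R) : 0 <= s -> s <= s' -> (clock s <= clock s')%E.
Proof.
move=> s0 ss'; apply: ge0_le_integral => //.
- by move=> y _; rewrite lee_fin.
- exact: measurable_level.
- exact: measurable_level.
- by move=> y _; rewrite lee_fin level_nondecreasing.
Qed.

Hypothesis m_neg : m `]-oo, 0%R]%classic = 0%E.
Hypothesis m_pos : forall c d : R, 0 <= c -> c < d -> (0 < m `]c, d[%classic)%E.

(** Only levels y > 0 count, and a window of radius below y around such a level is not visited while
    the path is nonpositive. The endpoint s' is a null set of times. *)
Lemma clock_flat (s s' : R) : 0 <= s -> s <= s' -> (forall r, s < r < s' -> b r <= 0) ->
  (clock s' <= clock s)%E.
Proof.
move=> s0 ss' hb; rewrite /clock.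
have restr u : (\int[m]_y (L y u)%:E = \int[m]_(y in setT `\` `]-oo, 0%R]) (L y u)%:E)%E.
  apply: ge0_negligible_integral => //; first exact: measurable_level.
  by move=> y _; rewrite lee_fin.
rewrite !restr; apply: ge0_le_integral => //.
- exact: measurableD.
- by move=> y _; rewrite lee_fin.
- exact: measurable_funTS (measurable_level s').
- exact: measurable_funTS (measurable_level s).
move=> y [_ /=]; rewrite in_itv/= => /negP; rewrite -ltNge => y0; rewrite lee_fin.
have s'0 : 0 <= s' by exact: le_trans ss'.
have mI r : measurable (`[(y - r)%R, (y + r)%R]%classic : set R) by exact: measurable_itv.
apply: (@integral_small_itv_le (fun y => L y s') (fun y => L y s) y y) => //;
  [exact: continuous_level|exact: continuous_level|].
move=> r r_gt0 ry; rewrite -!occ//.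
apply: (@le_trans _ _ (leb ((`[0%R, s]%classic `&` b @^-1` `[y - r, y + r]%classic) `|` [set s']))).
  apply: le_measure; rewrite ?inE; last first.
  - move=> u [/=]; rewrite !in_itv/= => /andP[u0 us'] /andP[u1 u2].
    have [us|su] := leP u s; first by left; split => /=; rewrite ?in_itv/= ?u0 ?us ?u1.
    right; apply/eqP; rewrite eq_le us'/= leNgt; apply/negP => us'2.
    by have := hb u; rewrite su us'2 => /(_ isT); lra.
  - by apply: measurableU => //; apply: measurableI => //; exact: mpre.
  - by apply: measurableI => //; exact: mpre.
apply: (le_trans (measureU2 _ _ _)) => //.
- by apply: measurableI => //; exact: mpre.
- by rewrite [X in (_ + X)%E](lebesgue_measure_set1 s') adde0.
Qed.

(** The time spent near [b r] grows, so some level near it gains local time. By continuity an open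
    interval of positive levels gains at least e, and [m] charges it. Finiteness of the clock at s
    makes the gain strict. *)
Lemma clock_strict (s s' r : R) : 0 <= s -> s < r < s' -> 0 < b r -> (clock s < +oo)%E ->
  (clock s < clock s')%E.
Proof.
move=> s0 /andP[sr rs'] br clock_fin.
have ss' : s < s' by exact: lt_trans rs'.
have s'0 : 0 <= s' by rewrite (le_trans s0)// ltW.
have [r1 r10 hr1] := continuousP_dist (@cb r) (divr_gt0 br (ltr0n R 2)).
pose r2 : R := Num.min r1 (Num.min (r - s) (s' - r)) / 2.
have rm : 0 < Num.min r1 (Num.min (r - s) (s' - r)) by rewrite !lt_min r10 !subr_gt0 sr.
have r20 : 0 < r2 by rewrite divr_gt0.
have [rr1 [rr2 rr3]] : r2 < r1 /\ r2 < r - s /\ r2 < s' - r.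
  have h : r2 < Num.min r1 (Num.min (r - s) (s' - r)) by rewrite /r2; lra.
  by move: h; rewrite !lt_min => /andP[-> /andP[-> ->]].
pose U : set R := `[(b r / 2)%R, (2 * b r)%R]%classic.
have mU : measurable U by exact: measurable_itv.
pose J : set R := `[(r - r2)%R, (r + r2)%R]%classic.
have mJ : measurable J by exact: measurable_itv.
have lJ : leb J = (2 * r2)%:E.
  rewrite /J lebesgue_measure_itv/= lte_fin ifT; last lra.
  by rewrite -EFinD; congr EFin; ring.
have [y [Uy Ly]] : exists y, U y /\ L y s < L y s'.
  apply: contrapT => /forallNP hno.
  have hle : (\int[leb]_(y in U) (L y s')%:E <= \int[leb]_(y in U) (L y s)%:E)%E.
    apply: ge0_le_integral => //.
    - by move=> z _; rewrite lee_fin.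
    - exact: measurable_funTS (measurable_level s').
    - exact: measurable_funTS (measurable_level s).
    - by move=> z Uz; rewrite lee_fin leNgt; apply/negP => h; apply: (hno z).
  move: hle; rewrite -!occ//.
  have mA u : measurable (`[0%R, u]%classic `&` b @^-1` U).
    by apply: measurableI => //; exact: mpre.
  have hfin : (leb (`[0%R, s]%classic `&` b @^-1` U) < +oo)%E.
    apply: (@le_lt_trans _ _ (leb `[0%R, s]%classic)).
      by apply: le_measure; rewrite ?inE; [exact: mA|exact: measurable_itv|exact: subIsetl].
    by rewrite lebesgue_measure_itv/=; case: ifP => _; rewrite ?ltry// -EFinD ltry.
  have : (leb (`[0%R, s]%classic `&` b @^-1` U) + leb J <= leb (`[0%R, s']%classic `&` b @^-1` U))%E.
    rewrite -measureU//; last first.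
      have rr2' : s < r - r2 by lra.
      apply/seteqP; split => // u [[/=]]; rewrite !in_itv/= => /andP[_ us] _ /andP[+ _].
      rewrite bnd_simp => u1.
      by move: (lt_le_trans rr2' (le_trans u1 us)); rewrite ltxx.
      exact: mA.
    apply: le_measure; rewrite ?inE; [by apply: measurableU; [exact: mA|]|exact: mA|].
    move=> u [[/= + ub]|]; rewrite ?/J/= !in_itv/=.
      by move=> /andP[u0 us]; split => //=; rewrite ?in_itv/= u0/= (le_trans us)// ltW.
    move=> /andP[u1 u2]; have : `|b r - b u| < b r / 2.
      by apply: hr1; rewrite ltr_norml; apply/andP; split; lra.
    rewrite ltr_norml => /andP[h1 h2]; split; rewrite /U/= ?in_itv/=; apply/andP; split; lra.
  move=> h1 h2; have := le_trans h1 h2.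
  have hfn : leb (`[0%R, s]%classic `&` b @^-1` U) \is a fin_num by rewrite ge0_fin_numE.
  by rewrite lJ -(fineK hfn) -EFinD lee_fin; lra.
have y0 : 0 < y by move: Uy; rewrite /U/= in_itv/= => /andP[h _]; lra.
pose e : R := (L y s' - L y s) / 3.
have e0 : 0 < e by rewrite divr_gt0// subr_gt0.
have [q1 q10 h1] := continuousP_dist (@continuous_level s y) e0.
have [q2 q20 h2] := continuousP_dist (@continuous_level s' y) e0.
pose q : R := Num.min y (Num.min q1 q2).
have q0 : 0 < q by rewrite !lt_min y0 q10.
have [qy [qq1 qq2]] : q <= y /\ q <= q1 /\ q <= q2.
  by rewrite /q; split; [rewrite ge_min lexx|split; rewrite !ge_min lexx ?orbT].
pose V : set R := `](y - q)%R, (y + q)%R[%classic.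
have mV : measurable V by exact: measurable_itv.
have mVpos : (0 < m V)%E by apply: m_pos; lra.
apply: (@lt_le_trans _ _ (clock s + e%:E * m V)%E).
  by rewrite lteDl ?ge0_fin_numE ?mule_gt0 ?lte_fin// /clock integral_ge0// => z _; rewrite lee_fin.
pose g (z : R) : R := e * \1_V z.
have mg : measurable_fun setT (fun z => (g z)%:E).
  by apply/measurable_EFinP; apply: measurable_funM => //; exact: measurable_indic.
have -> : (e%:E * m V = \int[m]_z (g z)%:E)%E.
  rewrite /g; under eq_integral do rewrite EFinM.
  rewrite ge0_integralZl ?integral_indic ?setIT//.
    by apply/measurable_EFinP; exact: measurable_indic.
  by rewrite lee_fin ltW.
rewrite /clock -ge0_integralD//; last 2 first.
- exact: measurable_level.
- by move=> z _; rewrite lee_fin mulr_ge0// ltW.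
apply: ge0_le_integral => //.
- by move=> z _; rewrite adde_ge0// lee_fin// mulr_ge0// ltW.
- by apply: emeasurable_funD => //; exact: measurable_level.
- exact: measurable_level.
- move=> z _; rewrite -EFinD lee_fin /g indicE.
  have [zV|zV] := pselect (V z); last first.
    by rewrite (memNset zV) mulr0 addr0 level_nondecreasing// ltW.
  rewrite (mem_set zV) mulr1.
  have hz : `|y - z| < q.
    by move: zV; rewrite /V/= in_itv/= => /andP[z1 z2]; rewrite ltr_norml; apply/andP; split; lra.
  have := h1 z (lt_le_trans hz qq1); have := h2 z (lt_le_trans hz qq2).
  by rewrite !ltr_norml => /andP[a1 a2] /andP[a3 a4]; move: a1 a2 a3 a4; rewrite /e; lra.
- by move=> z _; rewrite lee_fin.
Qed.

End occupation.

(** * Absorption of the time-changed path *)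

Section absorption.
Variables (R : realType) (m : {measure set R -> \bar R}) (T : Type).
Local Notation leb := (@lebesgue_measure R).
Variables (B : R -> T -> R) (L : R -> R -> T -> R) (w : T).
Hypothesis hm : speed_measure m.
Hypothesis cB : {within `[0%R, +oo[, continuous (fun s => B s w)}.

Definition local_time_at := [/\ (forall y s, 0 <= L y s w),
  (forall p : R * R, {for p, continuous (fun q : R * R => L q.1 q.2 w)}) &
  (forall s A, 0 <= s -> measurable A ->
    (leb (`[0%R, s]%classic `&` ((fun r => B r w) @^-1` A))
        = \int[leb]_(y in A) (L y s w)%:E)%E)].

Hypothesis hL : local_time_at.

(** Continuity of [B] is given for nonnegative times; freezing it at time 0 yields a path continuous
    on the whole line. *)
Definition path (r : R) : R := B (Num.max 0 r) w.

Lemma pathE r : 0 <= r -> path r = B r w.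
Proof. by move=> r0; rewrite /path (max_idPr r0). Qed.

Lemma continuous_path_R : continuous path.
Proof. exact: (continuous_max0_within cB). Qed.

Lemma path_occ (s : R) A : 0 <= s -> measurable A ->
  leb (`[0%R, s]%classic `&` (path @^-1` A)) = (\int[leb]_(y in A) (L y s w)%:E)%E.
Proof.
move=> s0 mA; case: hL => _ _ occ; rewrite -occ//; congr (leb _).
apply/seteqP; split => r [/= + hr]; rewrite in_itv/= => /andP[r0 rs]; split;
  rewrite /= ?in_itv/= ?r0//; move: hr; by rewrite /path (max_idPr r0).
Qed.

Let Lw y s := L y s w.
Let L0 y s : 0 <= Lw y s. Proof. by case: hL => h _ _; exact: h. Qed.
Let cL : forall p : R * R, {for p, continuous (fun q : R * R => Lw q.1 q.2)}.
Proof. by case: hL => _ h _; exact: h. Qed.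
Let m_neg : m `]-oo, 0%R]%classic = 0%E. Proof. by case: hm. Qed.
Let m_pos (c d : R) : 0 <= c -> c < d -> (0 < m `]c, d[%classic)%E.
Proof. by case: hm => _ _ h; exact: h. Qed.
Let A s := additive_functional m L s w.

Let A_le (s s' : R) : 0 <= s -> s <= s' -> (A s <= A s')%E.
Proof. exact: (clock_nondecreasing m continuous_path_R L0 cL path_occ). Qed.

Let A_flat (s s' : R) : 0 <= s -> s <= s' -> (forall r, s < r < s' -> path r <= 0) -> (A s' <= A s)%E.
Proof. exact: (clock_flat continuous_path_R L0 cL path_occ m_neg). Qed.

Let A_strict (s s' r : R) : 0 <= s -> s < r < s' -> 0 < path r -> (A s < +oo)%E -> (A s < A s')%E.
Proof. exact: (clock_strict continuous_path_R L0 cL path_occ m_pos). Qed.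

Variables (t T0 s1 : R).
Hypothesis T0_gt0 : 0 < T0.
Hypothesis B_T0 : B T0 w = 0.
Hypothesis A_before : forall s, 0 <= s < T0 -> (additive_functional m L s w <= t%:E)%E.
Hypothesis T0_s1 : T0 < s1.
Hypothesis B_s1 : 0 < B s1 w.

(** Left continuity of the clock, by monotone convergence along times increasing to [T0]. *)
Let A_T0 : (A T0 <= t%:E)%E.
Proof.
pose u n : R := T0 * (1 - n.+1%:R^-1).
have un n : 0 <= u n < T0.
  have n1 : n.+1%:R^-1 <= 1 :> R by rewrite invf_le1// ler1n.
  have n0 : 0 < n.+1%:R^-1 :> R by rewrite invr_gt0.
  rewrite /u mulr_ge0 ?(ltW T0_gt0) ?subr_ge0//= gtr_pMr//; lra.
have u_nd : {homo u : n k / (n <= k)%N >-> n <= k}.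
  move=> n k nk; rewrite /u ler_pM2l// lerD2l lerN2 lef_pV2 ?posrE// ler_nat ltnS.
  exact: nk.
have cu : u n @[n --> \oo] --> T0.
  rewrite -[X in _ --> X]mulr1 -[X in _ --> T0 * X]subr0.
  apply: cvgM; first exact: cvg_cst.
  apply: cvgB; first exact: cvg_cst.
  exact: cvg_harmonic.
pose g n y := (Lw y (u n))%:E.
have mg n : measurable_fun setT (g n) by exact: (measurable_level cL).
have g0 n y : [set: R] y -> (0 <= g n y)%E by rewrite lee_fin L0.
have g_nd y : [set: R] y -> nondecreasing_seq (g^~ y).
  move=> _ n k nk; rewrite lee_fin.
  have /andP[h1 _] := un n.
  exact: (level_nondecreasing continuous_path_R L0 cL path_occ y h1 (u_nd _ _ nk)).
have cg y : (g n y) @[n --> \oo] --> (Lw y T0)%:E.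
  have h : Lw y (u n) @[n --> \oo] --> Lw y T0.
    by apply: (@continuous_cvg _ _ _ _ _ u (Lw y) T0) => //; exact: (continuous_time cL).
  by apply/fine_cvgP; split; [exact: nearW|exact: h].
have cvgA : (\int[m]_y g n y)%E @[n --> \oo] --> A T0.
  have -> : A T0 = (\int[m]_y limn (g^~ y))%E.
    by apply: eq_integral => y _; apply/esym/cvg_lim => //; exact: cg.
  exact: (cvg_monotone_convergence measurableT mg g0 g_nd).
rewrite -(cvg_lim _ cvgA)//; apply: lime_le; first by apply/cvg_ex; eexists; exact: cvgA.
by apply: nearW => n; apply: A_before.
Qed.

(** The witness is u0 = A T0. Its time change s0, the infimum of the times with clock above u0, may
    lie beyond [T0], if the path stays nonpositive for a while. The path is nonpositive between [T0]
    and s0, where the clock has not grown, and it cannot be negative at s0, or the clock would stay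
    flat beyond s0; so it vanishes there. The positive value at [s1] makes s0 finite. *)
Lemma absorption_le : (absorption_time m B L w <= t%:E)%E.
Proof.
have T00 : 0 <= T0 by exact: ltW.
have A_ge0 s : (0 <= A s)%E by apply: integral_ge0 => y _; rewrite lee_fin; exact: L0.
have fA : A T0 \is a fin_num.
  by rewrite ge0_fin_numE// (le_lt_trans A_T0)// ltry.
pose u0 : R := fine (A T0).
have u0E : A T0 = u0%:E by rewrite fineK.
have u0_ge0 : 0 <= u0 by exact: fine_ge0.
have u0t : u0 <= t by rewrite -lee_fin -u0E.
pose S : set R := [set s | 0 <= s /\ (u0%:E < A s)%E].
have s1_ge0 : 0 <= s1 by rewrite (le_trans T00)// ltW.
have S_ne : S !=set0.
  exists (s1 + 1); split; first by rewrite addr_ge0.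
  rewrite -u0E; apply: (@A_strict T0 (s1 + 1) s1) => //.
  - by rewrite T0_s1/=; lra.
  - by rewrite pathE.
  - by rewrite u0E ltry.
have S_lb : lbound S T0.
  move=> s [s0 us]; rewrite leNgt; apply/negP => sT.
  by move: us; rewrite -u0E ltNge A_le// ltW.
have S_inf : has_inf S by split => //; exists T0.
pose s0 : R := inf S.
have T0s0 : T0 <= s0 by apply: lb_le_inf.
have s0_ge0 : 0 <= s0 by exact: le_trans T0s0.
have s0E : time_change m L u0 w = s0%:E.
  rewrite /time_change -ereal_inf_EFin//; by exists T0.
have below r : T0 < r -> r < s0 -> path r <= 0.
  move=> Tr rs; rewrite leNgt; apply/negP => br.
  have : S ((r + s0) / 2).
    split; first by rewrite divr_ge0// addr_ge0// (le_trans T00)// ltW.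
    rewrite -u0E; apply: (@A_strict T0 _ r) => //; last by rewrite u0E ltry.
    by rewrite Tr/=; lra.
  by move=> /(ge_inf S_inf.2); rewrite -/s0; lra.
have bs0_le : path s0 <= 0.
  have [->|neq] := eqVneq s0 T0; first by rewrite pathE// B_T0.
  have lt : T0 < s0 by rewrite lt_neqAle eq_sym neq.
  rewrite leNgt; apply/negP => b0.
  have [r r0 hr] := continuousP_dist (continuous_path_R (x := s0)) b0.
  pose z : R := Num.max ((T0 + s0) / 2) (s0 - r / 2).
  have z1 : T0 < z by rewrite /z lt_max; apply/orP; left; lra.
  have z2 : z < s0 by rewrite /z gt_max; apply/andP; split; lra.
  have z3 : s0 - r / 2 <= z by rewrite /z le_max lexx orbT.
  have := below z z1 z2; have : `|path s0 - path z| < path s0.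
    by apply: hr; rewrite ger0_norm; lra.
  by rewrite ltr_norml => /andP[_ h1]; lra.
have bs0_ge : 0 <= path s0.
  rewrite leNgt; apply/negP => b0.
  have b0' : 0 < - path s0 by rewrite oppr_gt0.
  have [r r0 hr] := continuousP_dist (continuous_path_R (x := s0)) b0'.
  have flat : (A (s0 + r / 2) <= A T0)%E.
    apply: A_flat => //; first lra.
    move=> z /andP[z1 z2]; have [zs|sz] := ltP z s0; first exact: below.
    have : `|path s0 - path z| < - path s0.
      by apply: hr; rewrite distrC ger0_norm; lra.
    by rewrite ltr_norml => /andP[h1 h2]; lra.
  have [s Ss sr] := inf_adherent (divr_gt0 r0 (ltr0n R 2)) S_inf.
  case: Ss => s_ge0; rewrite -u0E ltNge => /negP; apply.
  by apply: le_trans flat; apply: A_le => //; exact: ltW.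
apply: (@le_trans _ _ u0%:E); last by rewrite lee_fin.
apply: ereal_inf_lbound; exists u0 => //; split => //; exists s0; split => //.
by rewrite -pathE//; apply/eqP; rewrite eq_le bs0_le.
Qed.

End absorption.

(** * The scales of the speed measure *)

Section summable_sequence.
Variables (R : realType) (s : nat -> R) (C : R).
Hypothesis s_ge0 : forall i, 0 <= s i.
Hypothesis s_noninc : forall i j, (i <= j)%N -> s j <= s i.
Hypothesis s_sum : forall n, \sum_(i < n) s i <= C.

Let u n := \sum_(i < n) s i.

Let u_nd : nondecreasing_seq u.
Proof. by apply/nondecreasing_seqP => n; rewrite /u big_ord_recr/= lerDl. Qed.

Let u_split k n : u (k + n) = u k + \sum_(i < n) s (k + i).
Proof. by rewrite /u big_split_ord. Qed.

Lemma tail_sum_small (e : R) : 0 < e ->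
  exists k0, forall k n, (k0 <= k)%N -> \sum_(i < n) s (k + i) <= e.
Proof.
move=> e0; pose A : set R := range u.
have A_sup : has_sup A.
  by split; [exists (u 0%N), 0%N|exists C => _ [n _ <-]; exact: s_sum].
have [_ [k0 _ <-] hk0] := sup_adherent e0 A_sup.
exists k0 => k n k0k.
have h1 : u (k + n) <= sup A by apply: ub_le_sup; [case: A_sup|exists (k + n)%N].
have h2 : u k0 <= u k by exact: u_nd.
by move: h1; rewrite u_split; lra.
Qed.

(** The block from k/2 to k has at least k/2 terms, each at least s k, and its sum is a piece of a
    small tail. *)
Lemma weighted_tail_small (e : R) : 0 < e ->
  exists k0, forall k, (k0 <= k)%N -> k%:R * s k <= e.
Proof.
move=> e0; have e20 : 0 < e / 2 by rewrite divr_gt0.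
have [k1 hk1] := tail_sum_small e20; exists (k1.*2)%N => k kk.
have k1k : (k1 <= k./2)%N by lia.
have := hk1 k./2 (k - k./2)%N k1k.
have : \sum_(i < k - k./2) s k <= \sum_(i < k - k./2) s (k./2 + i)%N.
  by apply: ler_sum => i _; apply: s_noninc; have := ltn_ord i; lia.
rewrite sumr_const card_ord -mulr_natl.
have : k%:R / 2 <= (k - k./2)%:R :> R.
  by rewrite ler_pdivrMr// -natrM ler_nat; lia.
have := s_ge0 k; nra.
Qed.

End summable_sequence.

Section speed_scale.
Variables (R : realType) (m : {measure set R -> \bar R}).
Local Notation leb := (@lebesgue_measure R).
Local Open Scope ereal_scope.

Lemma Gm_ge0 (y : R) : (0 < y)%R -> 0 <= Gm m y.
Proof.
move=> y0; rewrite /Gm mule_ge0 ?lee_fin ?invr_ge0 ?(ltW y0)//.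
by apply: integral_ge0 => z _; rewrite lee_fin sqr_ge0.
Qed.

Lemma Sm_nondecreasing (x y : R) : (x <= y)%R -> Sm m x <= Sm m y.
Proof.
move=> xy; apply: le_ereal_sup => _ [z /= + <-]; rewrite in_itv/= => /andP[z0 zx].
by exists z => //=; rewrite in_itv/= z0 (le_trans zx).
Qed.

Lemma Gm_le_Sm (x : R) : (0 < x)%R -> Gm m x <= Sm m x.
Proof. by move=> x0; apply: ereal_sup_ubound; exists x => //=; rewrite in_itv/= x0 lexx. Qed.

Lemma Sm_ge0 (x : R) : (0 < x)%R -> 0 <= Sm m x.
Proof. by move=> x0; apply: le_trans (Gm_le_Sm x0); exact: Gm_ge0. Qed.

Lemma measurable_Sm : measurable_fun setT (Sm m).
Proof.
apply: (measurability _ (ErealGenOInfty.measurableE R)) => _ [_ [x ->] <-].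
rewrite setTI; apply: is_interval_measurable => a b /= + _ c /andP[ac _].
rewrite !in_itv/= !andbT => h; apply: lt_le_trans h _; exact: Sm_nondecreasing.
Qed.

Let f (x : R) := (x^-1)%:E * Sm m x.

Let mf : measurable_fun (`]0%R, 1%R[%classic : set R) f.
Proof.
apply: emeasurable_funM; last exact: measurable_funTS measurable_Sm.
apply/measurable_EFinP; apply: subspace_continuous_measurable_fun => //.
apply: continuous_in_subspaceT => x; rewrite inE/= in_itv/= => /andP[x0 _].
by apply: inv_continuous; rewrite gt_eqF.
Qed.

Let f_ge0 (x : R) : (0 < x)%R -> 0 <= f x.
Proof. by move=> x0; rewrite /f mule_ge0 ?Sm_ge0// lee_fin invr_ge0 ltW. Qed.

Hypothesis hint : integral_condition m.

Let block (a b : R) : (0 < a)%R -> (a < b)%R -> (b <= 1)%R ->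
  (b^-1 * (b - a))%:E * Sm m a <= \int[leb]_(x in `[a, b[) f x.
Proof.
move=> a0 ab b1; have b0 : (0 < b)%R by exact: lt_trans ab.
have mI : measurable (`[a, b[%classic : set R) by exact: measurable_itv.
apply: (@le_trans _ _ (\int[leb]_(x in `[a, b[) ((b^-1)%:E * Sm m a))).
  rewrite integral_cst//= lebesgue_measure_itv/= lte_fin ab -EFinD.
  by rewrite muleAC -EFinM.
apply: ge0_le_integral => //.
- by move=> x _; rewrite mule_ge0 ?Sm_ge0// lee_fin invr_ge0 ltW.
- apply: measurable_funS mf => // x /=; rewrite !in_itv/= => /andP[ax xb].
  by rewrite (lt_le_trans a0)//= (lt_le_trans xb).
- move=> x /=; rewrite in_itv/= => /andP[ax xb].
  have x0 : (0 < x)%R by exact: lt_le_trans ax.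
  apply: lee_pmul; rewrite ?lee_fin ?invr_ge0 ?(ltW b0) ?Sm_ge0//.
    by rewrite lef_pV2 ?posrE// ltW.
  exact: Sm_nondecreasing.
Qed.

(** On [1/2, 1) the integrand of the condition is at least Sm(1/2), which therefore cannot be
    infinite. *)
Lemma Sm_fin (x : R) : (0 < x)%R -> (x <= 2^-1)%R -> Sm m x \is a fin_num.
Proof.
move=> x0 x1; rewrite ge0_fin_numE ?Sm_ge0//; apply: (le_lt_trans (Sm_nondecreasing x1)).
have h20 : (0 < 2^-1 :> R)%R by [].
have := block h20 (_ : 2^-1 < 1)%R (lexx 1%R).
rewrite invf_lt1 ?ltr1n// => /(_ isT) h.
have : (1^-1 * (1 - 2^-1))%:E * Sm m 2^-1 < +oo.
  apply: (le_lt_trans h); apply: le_lt_trans hint.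
  apply: ge0_subset_integral => //.
  - by move=> z /=; rewrite in_itv/= => /andP[z0 _]; exact: f_ge0.
  - move=> z /=; rewrite !in_itv/= => /andP[z0 ->]; rewrite andbT; exact: lt_le_trans z0.
have := Sm_ge0 h20; case: (Sm m 2^-1) => // [r _ _|_]; first by rewrite ltry.
by rewrite gt0_muley// lte_fin invr1 mul1r subr_gt0 invf_lt1// ltr1n.
Qed.

Let a_ j : R := (2 * 4^-1 ^+ j)%R.

Let a_gt0 j : (0 < a_ j)%R. Proof. by rewrite mulr_gt0// exprn_gt0. Qed.

Let a_S j : a_ j = (4 * a_ j.+1)%R. Proof. by rewrite /a_ exprS; field. Qed.

Let a_half j : (a_ j.+1 <= 2^-1)%R.
Proof.
rewrite /a_ exprS; have : (4^-1 ^+ j <= 1 :> R)%R by rewrite exprn_ile1// ?invf_le1// ler1n.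
lra.
Qed.

(** Comparison of series and integral on the cells between consecutive scales, starting from a_1 =
    1/2. A cell whose endpoints have ratio 4 has length 3/4 of its right endpoint. *)
Let sum_Sm n : \sum_(i < n) (3 / 4)%:E * Sm m (a_ i.+2) <= \int[leb]_(x in `[a_ n.+1, 2^-1%R[) f x.
Proof.
have sub01 (c : R) : (0 < c)%R -> `[c, 2^-1%R[%classic `<=` (`]0%R, 1%R[%classic : set R).
  move=> c0 x /=; rewrite !in_itv/= => /andP[cx xh]; apply/andP; split; lra.
elim: n => [|n IH].
  by rewrite big_ord0; apply: integral_ge0 => x; rewrite /= in_itv/= => /andP[/(lt_le_trans (a_gt0 _))] /f_ge0.
rewrite big_ord_recr/=.
have ab : (a_ n.+2 < a_ n.+1)%R by rewrite (a_S n.+1); have := a_gt0 n.+2; lra.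
have b1 : (a_ n.+1 <= 1)%R by have := a_half n; lra.
have h := block (a_gt0 n.+2) ab b1.
have e34 : ((a_ n.+1)^-1 * (a_ n.+1 - a_ n.+2) = 3 / 4)%R.
  by rewrite (a_S n.+1); have := a_gt0 n.+2; move: (a_ n.+2) => c c0; field; rewrite gt_eqF.
rewrite e34 in h.
have U : `[a_ n.+2, 2^-1%R[%classic = `[a_ n.+2, a_ n.+1[%classic `|` `[a_ n.+1, 2^-1%R[%classic :> set R.
  rewrite -itv_bndbnd_setU// bnd_simp; [exact: ltW|exact: a_half].
rewrite [X in (_ <= \int[_]_(x in X) _)]U ge0_integral_setU//=.
- by rewrite addeC; exact: leeD.
- by rewrite -U; apply: measurable_funS mf => //; exact: sub01.
- move=> x [|] /=; rewrite in_itv/= => /andP[cx _]; apply: f_ge0; apply: lt_le_trans cx; exact: a_gt0.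
- rewrite disj_set2E; apply/eqP/seteqP; split => // x [/=]; rewrite !in_itv/= => /andP[_ h1] /andP[h2 _].
  by move: (lt_le_trans h1 h2); rewrite ltxx.
Qed.

(* The cutoff at 1/2 keeps [Sm] finite, and the geometric term keeps the value positive. *)
Definition level_const j : R :=
  (16 * fine (Sm m (Num.min 2^-1 (2 * 4^-1 ^+ j))) + 2^-1 ^+ j)%R.

Let mn j : (0 < Num.min 2^-1 (2 * 4^-1 ^+ j) :> R)%R && (Num.min 2^-1 (2 * 4^-1 ^+ j) <= 2^-1 :> R)%R.
Proof. by rewrite lt_min a_gt0 ge_min lexx invr_gt0 ltr0n. Qed.

Let fine_ge0 j : (0 <= fine (Sm m (Num.min 2^-1 (2 * 4^-1 ^+ j))))%R.
Proof. by have /andP[h _] := mn j; rewrite fine_ge0// Sm_ge0. Qed.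

Lemma level_const_gt0 j : (0 < level_const j)%R.
Proof. by rewrite ltr_wpDl ?exprn_gt0// mulr_ge0. Qed.

Lemma level_const_noninc i j : (i <= j)%N -> (level_const j <= level_const i)%R.
Proof.
move=> ij; have h4 : (4^-1 ^+ j <= 4^-1 ^+ i :> R)%R by rewrite ler_wiXn2l// invf_le1// ler1n.
apply: lerD; last by rewrite ler_wiXn2l// invf_le1// ler1n.
rewrite ler_wpM2l// fine_le//.
- by have /andP[? ?] := mn j; exact: Sm_fin.
- by have /andP[? ?] := mn i; exact: Sm_fin.
- apply: Sm_nondecreasing; rewrite le_min !ge_min lexx/=; apply/orP; right; lra.
Qed.

Lemma Sm_le_level_const j : (1 <= j)%N -> 16%:E * Sm m (2 * 4^-1 ^+ j)%R <= (level_const j)%:E.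
Proof.
case: j => // j _; have mE : (Num.min 2^-1 (2 * 4^-1 ^+ j.+1) = a_ j.+1)%R by apply/min_idPr; exact: a_half.
rewrite /level_const mE [leRHS]EFinD [X in _ <= X + _]EFinM fineK; last exact: Sm_fin.
by rewrite leeDl// lee_fin exprn_ge0.
Qed.

Lemma level_const_sum : exists C : R, forall n, (\sum_(i < n) level_const i <= C)%R.
Proof.
pose J := fine (\int[leb]_(x in `]0%R, 1%R[) f x).
have If : \int[leb]_(x in `]0%R, 1%R[) f x \is a fin_num.
  rewrite ge0_fin_numE//; apply: integral_ge0 => x; rewrite /= in_itv/= => /andP[/f_ge0 //].
have mE j : (Num.min 2^-1 (2 * 4^-1 ^+ j.+1) = a_ j.+1)%R by apply/min_idPr; exact: a_half.
have SJ n : (\sum_(i < n) 3 / 4 * fine (Sm m (a_ i.+2)) <= J)%R.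
  rewrite -lee_fin fineK// -sumEFin; apply: (@le_trans _ _ (\sum_(i < n) (3 / 4)%:E * Sm m (a_ i.+2))).
    apply: lee_sum => i _; rewrite EFinM fineK//; apply: Sm_fin; [exact: a_gt0|exact: a_half].
  apply: (le_trans (sum_Sm n)); apply: ge0_subset_integral => //.
  - by move=> x /=; rewrite in_itv/= => /andP[x0 _]; exact: f_ge0.
  - by move=> x /=; rewrite !in_itv/= => /andP[cx xh]; have := a_gt0 n.+1; lra.
have G n : (\sum_(i < n) 2^-1 ^+ i <= 2 - 2^-1 ^+ n *+ 2 :> R)%R.
  elim: n => [|n IH]; first by rewrite big_ord0 expr0; lra.
  by rewrite big_ord_recr/= exprS; move: IH; move: (2^-1 ^+ n)%R => c; lra.
(* Levels 0 and 1 are set apart, because the cells below 1/2 control [Sm] only from a_2 on. The last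
   2 bounds the geometric series. *)
exists (level_const 0 + level_const 1 + 16 * (4 / 3 * J) + 2)%R => n.
have L2 : (\sum_(i < n) level_const i.+2 <= 16 * (4 / 3 * J) + 2)%R.
  apply: (@le_trans _ _ (\sum_(i < n) (16 * (4 / 3 * (3 / 4 * fine (Sm m (a_ i.+2)))) + 2^-1 ^+ i)))%R.
    apply: ler_sum => i _; rewrite /level_const mE; apply: lerD.
      rewrite ler_wpM2l//; lra.
    by rewrite ler_wiXn2l ?invf_le1 ?ler1n//; lia.
  rewrite big_split/= -!mulr_sumr; apply: lerD.
    by rewrite !ler_wpM2l// mulr_sumr; exact: SJ.
  by apply: (le_trans (G n)); have : (0 <= 2^-1 ^+ n :> R)%R by []; lra.
have mono : (\sum_(i < n) level_const i <= \sum_(i < n.+2) level_const i)%R.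
  by rewrite 2!big_ord_recr/= -addrA lerDl addr_ge0// ltW// level_const_gt0.
apply: (le_trans mono); rewrite 2!big_ord_recl/=.
apply: (@le_trans _ _ (level_const 0 + level_const 1 + \sum_(i < n) level_const i.+2)%R).
  by rewrite addrA.
by rewrite -[leRHS]addrA lerD2l.
Qed.

End speed_scale.

(** * The clock estimate at one level *)

Section clock_estimate.
Variables (R : realType) (m : {measure set R -> \bar R}).
Local Notation leb := (@lebesgue_measure R).
Hypothesis hm : speed_measure m.
Hypothesis hint : integral_condition m.
Variables (d : measure_display) (T : measurableType d) (P : probability T R).
Variables (x : R) (B : R -> T -> R) (L : R -> R -> T -> R).
Hypothesis x_ge0 : 0 <= x.
Hypothesis hB : is_BM_from P x B.

Let cB w : {within `[0%R, +oo[, continuous (fun s => B s w)}.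
Proof. by case: hB => _ _ h _; exact: h. Qed.

(** The 16 of [level_const] is the 8 lost in smoothing times the 2 in the normalisation 2y of
    [Gm m (2 * y)]. *)
Lemma moment_le_level_const (j : nat) : (1 <= j)%N ->
  (8%:E * \int[m]_(z in `]0%R, (2 * 4^-1 ^+ j)%R[) (z ^+ 2)%:E <=
   (level_const m j * 4^-1 ^+ j)%:E)%E.
Proof.
move=> j1; set y := 4^-1 ^+ j; have y0 : 0 < y :> R by rewrite exprn_gt0.
have -> : (8%:E * \int[m]_(z in `]0%R, (2 * y)%R[) (z ^+ 2)%:E =
   (16 * y)%:E * Gm m (2 * y))%E.
  rewrite /Gm muleA -EFinM; congr (_%:E * _)%E; field; lra.
apply: (@le_trans _ _ ((16 * y)%:E * Sm m (2 * y))%E).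
  by rewrite lee_wpmul2l ?Gm_le_Sm ?mulr_gt0// lee_fin mulr_ge0// ltW.
have -> : (16 * y)%:E = (y%:E * 16%:E)%E :> \bar R by rewrite -EFinM mulrC.
rewrite -muleA [leRHS]EFinM [leRHS]muleC.
rewrite lee_wpmul2l ?lee_fin ?(ltW y0)//; exact: Sm_le_level_const.
Qed.

(** The maximum lies in the band from k4/16 to k4/2. With k4 divided by 4 from one level to the
    next, the bands overlap, so every small positive maximum is strictly inside one of them. *)
Definition clock_event (eps k4 t : R) : set T := [set w | local_time_at B L w /\
  exists s : R, [/\ 0 <= s,
    forall r : R, 0 <= r <= s -> eps < B r w < k4 / 2,
    exists2 r : R, 0 <= r <= s & k4 / 16 < B r w &
    (t%:E < additive_functional m L s w)%E]].

(** The time is t / 2 because the smoothed clock is only known to reach half of the true one. *)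
Definition clock_bound (k : nat) (D t : R) : R := x / (4^-1 ^+ k / 16) *
  expR (3 * (24 * 24 * ladder_rate k (level_const m) * D) -
        ladder_rate k (level_const m) * gauss_mass R * (t / 2)).

(** A path confined between 2 kap and M/2 has no local time outside [kap, M], so its clock sees only
    the restriction of [m] to that compact interval, a finite measure that can be smoothed. *)
Lemma clock_estimate_cutoff (k n : nat) (t : R) : (1 <= k)%N -> (1 < n)%N ->
  outer_le P (clock_event (2 * 4^-1 ^+ (k + n.+1)) (4^-1 ^+ k) t)
    (clock_bound k (\sum_(i < n.+1) level_const m (k + i)) t)%:E.
Proof.
move=> k1 n1; set kap := 4^-1 ^+ (k + n.+1); set M := 4^-1 ^+ k.
have M0 : 0 < M :> R by rewrite exprn_gt0.
have kap0 : 0 < kap :> R by rewrite exprn_gt0.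
have kapM : 16 * kap <= M.
  rewrite /kap exprD -/M mulrCA ger_pMr//.
  have -> : 4^-1 ^+ n.+1 = 4^-1 ^+ 2 * 4^-1 ^+ n.-1 :> R by rewrite -exprD; congr (_ ^+ _); lia.
  have : 4^-1 ^+ n.-1 <= 1 :> R by rewrite exprn_ile1// invf_le1// ler1n.
  by rewrite expr2; lra.
have mK : (m `[kap, M]%classic < +oo)%E by case: hm => _ h _; apply: h => //; lra.
pose mu := restricted_speed mK.
have N_gt0 (j : nat) : 0 < j.+1%:R :> R by [].
pose Xn (j : nat) : set T := [set w | exists s0 : R, [/\ 0 <= s0,
  forall r : R, 0 <= r <= s0 -> 2 * kap < B r w < M / 2,
  exists2 r : R, 0 <= r <= s0 & M / 16 < B r w &
  ((t / 2)%:E < \int[leb]_(r in `[0%R, s0]) (smooth mu j.+1%:R (B r w))%:E)%E]].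
apply: (@outer_le_liminf _ _ _ _ _ Xn).
- move=> w [hL [s [s0 hs hr ht]]]; have [L0 cL _] := hL.
  have AK : additive_functional m L s w = (\int[m]_(y in `[kap, M]) (L y s w)%:E)%E.
    rewrite [RHS]integral_mkcond; apply: eq_integral => y _; rewrite patchE.
    case: ifPn => // yK; congr EFin.
    have r00 : 0 < Num.min kap (M / 2) by rewrite lt_min kap0/=; lra.
    apply: (@level_eq0 R (path B w) (fun y s => L y s w) L0 cL (path_occ hL) _ _ _ s0 r00).
    move=> r rs; have /andP[r0 _] := rs; rewrite pathE//; have /andP[b1 b2] := hs r rs.
    move: yK; rewrite notin_setE/= in_itv/= => /negP; rewrite negb_and -!ltNge => /orP[yk|My].
      rewrite ge_min; apply/orP; left; rewrite ler0_norm; lra.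
    rewrite ge_min; apply/orP; right; rewrite ger0_norm; lra.
  have [e e0 he] : exists2 e : R, 0 < e & ((t / 2 + e)%:E < (1 / 2)%:E * additive_functional m L s w)%E.
    move: ht; case: (additive_functional m L s w) => [a|_|]; last by rewrite ltNge leNye.
    - rewrite lte_fin => ta; exists ((a - t) / 4); first by rewrite divr_gt0// subr_gt0.
      by rewrite -EFinM lte_fin; lra.
    - by exists 1 => //; rewrite gt0_muley ?ltry// lte_fin.
  have [N0 hN0] := @smooth_clock R m kap M mK (path B w) (fun y => L y s w) s
    (@continuous_path_R _ _ _ w (@cB w)) (@continuous_level _ (fun y s => L y s w) cL s) (fun y => L0 y s)
    (fun A mA => path_occ hL s0 mA) e e0.
  exists (Num.bound `|N0|) => j hj; exists s; split => //.
  have Nj : N0 <= j.+1%:R.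
    apply: (le_trans (ler_norm N0)); apply: ltW; apply: (lt_le_trans (archi_boundP (normr_ge0 N0))).
    by rewrite ler_nat; apply: leq_trans hj _.
  have := hN0 _ (N_gt0 j) Nj; rewrite -AK => /(lt_le_trans he).
  rewrite (_ : \int[leb]_(r in `[0%R, s]) (smooth mu j.+1%:R (B r w))%:E =
     \int[leb]_(r in `[0%R, s]) (smooth mu j.+1%:R (path B w r))%:E)%E; last first.
    by apply: eq_integral => r; rewrite inE/= in_itv/= => /andP[r0 _]; rewrite pathE.
  rewrite EFinD; rewrite lteD2rE//.
- exists (Num.bound (2 / kap)) => j hj; rewrite /clock_bound.
  have Nj : 2 / kap <= j.+1%:R.
    apply: ltW; apply: (lt_le_trans (archi_boundP (_ : 0 <= 2 / kap))); first by rewrite divr_ge0// ltW.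
    by rewrite ler_nat; apply: leq_trans hj _.
  apply: (@ladder_estimate R k n (level_const m) (smooth mu j.+1%:R) (2 * kap) (M / 2) (M / 16)) => //.
  + exact: level_const_gt0.
  + exact: level_const_noninc.
  + exact: continuous_smooth.
  + exact: smooth_ge0.
  + rewrite -/kap; lra.
  + rewrite -/M; lra.
  + rewrite -/M -/kap; apply/andP; split; lra.
  + move=> i ni; apply: le_trans (moment_le_level_const _); last by rewrite (leq_trans k1)// leq_addr.
    apply: smooth_moment => //.
    by rewrite /kap ler_wiXn2l ?invf_le1 ?ler1n// leq_add2l ltnW.
Qed.

(** On [0, s] the positive path has a positive minimum, so it meets the cutoff condition for all
    large n, and [D] makes the bounds uniform in n. *)
Lemma clock_estimate (k : nat) (D t : R) : (1 <= k)%N ->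
  (forall n, \sum_(i < n) level_const m (k + i) <= D) ->
  outer_le P (clock_event 0 (4^-1 ^+ k) t) (clock_bound k D t)%:E.
Proof.
move=> k1 hD.
apply: (@outer_le_liminf _ _ _ _ _ (fun n => clock_event (2 * 4^-1 ^+ (k + n.+1)) (4^-1 ^+ k) t)).
- move=> w [hL [s [s0 hs hr ht]]].
  have cb : {within `[0, s], continuous (path B w)}.
    by apply: continuous_subspaceT; exact: @continuous_path_R _ _ _ w (@cB w).
  have [c] := EVT_min s0 cb; rewrite in_itv/= => /andP[c0 cs] hc.
  have bc : 0 < path B w c by rewrite pathE//; have /andP[] := hs c (introT andP (conj c0 cs)).
  exists (Num.bound (path B w c)^-1) => n hn; split => //; exists s; split => // r /andP[r0 rs].
  have rs' : 0 <= r <= s by rewrite r0.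
  have /andP[_ ->] := hs r rs'; rewrite andbT.
  have := hc r; rewrite in_itv/= r0 rs => /(_ isT); rewrite (pathE B w r0); apply: lt_le_trans.
  apply: (@le_lt_trans _ _ (n.+1%:R^-1)).
    rewrite exprD exprS -[leRHS]mul1r mulrA mulrA; apply: ler_pM => //.
    + have : 4^-1 ^+ k <= 1 :> R by rewrite exprn_ile1// invf_le1// ler1n.
      lra.
    + rewrite exprVn lef_pV2 ?posrE ?exprn_gt0// -natrX ler_nat.
      exact: ltn_expl.
  rewrite -[ltRHS]invrK ltf_pV2 ?posrE ?invr_gt0//.
  apply: (lt_le_trans (archi_boundP (_ : 0 <= (path B w c)^-1))); first by rewrite invr_ge0 ltW.
  by rewrite ler_nat; apply: leq_trans hn _.
- exists 2%N => n n2; apply: outer_le_sub (clock_estimate_cutoff t k1 n2) => //.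
  rewrite lee_fin ler_wpM2l//.
    by rewrite divr_ge0// divr_ge0// exprn_ge0.
  rewrite ler_expR lerD2r ler_wpM2l// ler_wpM2l// mulr_ge0//.
  by rewrite invr_ge0 !mulr_ge0// ltW// level_const_gt0.
Qed.

End clock_estimate.

(** * Null events *)

Section null_events.
Variables (R : realType) (d : measure_display) (T : measurableType d) (P : probability T R).

Lemma outer_le_approx (X : set T) : (forall e : R, 0 < e -> outer_le P X e%:E) -> outer_le P X 0.
Proof.
move=> h; have /choice[E hE] : forall n : nat, exists E, [/\ measurable E, X `<=` E & (P E <= (n.+1%:R^-1)%:E)%E].
  by move=> n; apply: h.
have mE n : measurable (E n) by have [] := hE n.
exists (\bigcap_n E n); split; first exact: bigcap_measurable.
  by move=> w Xw n _; have [_ + _] := hE n; apply.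
apply/lee_addgt0Pr => e e0; rewrite add0e.
have [n hn] := natSinv_small e0.
apply: (@le_trans _ _ (P (E n))).
  by apply: le_measure; rewrite ?inE//; [exact: bigcap_measurable|move=> w /(_ n); apply].
by have [_ _ /le_trans] := hE n; apply; rewrite lee_fin ltW// hn.
Qed.

Lemma outer_le_exists (X : nat -> set T) (c : R) (n : nat) :
  (forall i, (i < n)%N -> outer_le P (X i) c%:E) ->
  outer_le P [set w | exists2 i, (i < n)%N & X i w] (n%:R * c)%:E.
Proof.
elim: n => [_|n IH h].
  by exists set0; split => //; [move=> w [] | rewrite measure0 mul0r].
have h1 : forall i, (i < n)%N -> outer_le P (X i) c%:E by move=> i /ltnW; exact: h.
apply: outer_le_sub (outer_leU (IH h1) (h n (ltnSn n))).
- move=> w [i]; rewrite ltnS leq_eqVlt => /orP[/eqP ->|ni Xi]; first by right.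
  by left; exists i.
- by rewrite -EFinD -[n.+1]addn1 natrD mulrDl mul1r.
Qed.

Variables (x : R) (B : R -> T -> R).
Hypothesis hB : is_BM_from P x B.

Let mB s : measurable_fun setT (B s). Proof. by case: hB. Qed.

Let mincr (s s' : R) (A : set R) : measurable A -> measurable [set w | A (B s' w - B s w)].
Proof.
move=> mA; rewrite -[X in measurable X]setTI.
by apply: (measurable_funB (mB s') (mB s)).
Qed.

Lemma BM_tail (t delta : R) : 0 < t -> 0 <= delta ->
  outer_le P [set w | delta < `|B t w - x| ] (Num.sqrt 2 * expR (- (delta ^+ 2) / (4 * t)))%:E.
Proof.
move=> t0 d0; pose A : set R := [set u | delta < `|u|].
have mA : measurable A.
  rewrite (_ : A = (fun u : R => `|u|) @^-1` `]delta, +oo[%classic); last first.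
    by apply/seteqP; split => u; rewrite /A/= in_itv/= andbT.
  rewrite -[X in measurable X]setTI; apply: (@normr_measurable R setT) => //; exact: measurable_itv.
exists [set w | A (B t w - B 0 w)]; split; first exact: mincr.
  by have [_ B0 _ _] := hB; move=> w /=; rewrite /A/= B0.
have := BM_increments hB t0 1 (fun=> mA); rewrite big_ord1 => h.
rewrite (_ : [set w | _] = \bigcap_(i < 1) [set w | A (B (i.+1%:R * t) w - B (i%:R * t) w)]).
  by apply: le_trans (gauss_tail t0 d0); rewrite -h.
apply/seteqP; split => w /=.
  by move=> Aw [|//] _ /=; rewrite mul1r mul0r.
by move=> /(_ 0%N isT) /=; rewrite mul1r mul0r.
Qed.

Lemma gauss_mass_le1 : gauss_mass R <= 1.
Proof.
rewrite -lee_fin; apply: (le_trans (gauss_bulk (ltr01 : 0 < 1 :> R))).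
apply: probability_le1; exact: measurable_itv.
Qed.

Lemma BM_no_big_increment (n : nat) (t : nat -> R) : 0 <= t 0%N -> (forall i, t i < t i.+1) ->
  outer_le P [set w | forall i, (i < n)%N -> B (t i.+1) w - B (t i) w < Num.sqrt (t i.+1 - t i)]
    ((1 - gauss_mass R) ^+ n)%:E.
Proof.
move=> t0 tS; pose A i : set R := `]-oo, Num.sqrt (t i.+1 - t i)[%classic.
have mA i : measurable (A i) by exact: measurable_itv.
exists (\bigcap_(i in [set i | (i < n)%N]) [set w | A i (B (t i.+1) w - B (t i) w)]); split.
- by apply: bigcap_measurableType => i _; exact: mincr.
- by move=> w h i /= ni; rewrite /A/= in_itv/=; exact: h.
have [_ _ _ /(_ n t A t0 (fun i _ => tS i) mA) E] := hB; rewrite [leLHS]E {E}.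
have v0 i : 0 < t i.+1 - t i by rewrite subr_gt0.
under eq_bigr do rewrite -gaussE//.
have gA i : (0 <= gauss (t i.+1 - t i) (A i) <= (1 - gauss_mass R)%:E)%E.
  rewrite measure_ge0/=.
  have mI : measurable (`[Num.sqrt (t i.+1 - t i), (2 * Num.sqrt (t i.+1 - t i))%R]%classic : set R).
    exact: measurable_itv.
  apply: (@le_trans _ _ (gauss (t i.+1 - t i) (~` `[Num.sqrt (t i.+1 - t i), (2 * Num.sqrt (t i.+1 - t i))%R]%classic))).
    apply: le_measure; rewrite ?inE; [exact: mA|exact: measurableC|].
    move=> u; rewrite /A/= !in_itv/= => us; rewrite leNgt us//.
  rewrite probability_setC// EFinB leeB// gauss_bulk//.
elim: n => [|n IH]; first by rewrite big_ord0 expr0.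
rewrite big_ord_recr/= exprSr EFinM; apply: lee_pmul => //.
- by apply: prode_ge0 => i _; have /andP[] := gA i.
- by have /andP[] := gA n.
Qed.

Lemma power_small (e : R) : 0 < e -> exists n, (1 - gauss_mass R) ^+ n < e.
Proof.
move=> e0; have g1 := gauss_mass_le1; have g0 := gauss_mass_gt0 R.
have z1 : `|1 - gauss_mass R| < 1 by rewrite ger0_norm; lra.
have := @cvg_expr R _ z1; move/cvgrPdist_lt => /(_ _ e0)[n _ /(_ n (leqnn n))] /=.
by rewrite sub0r normrN => h; exists n; apply: le_lt_trans h; exact: ler_norm.
Qed.

(** Confinement forbids an increment of size a over a time a^2, that is, of one standard deviation,
    and such an increment has probability at least [gauss_mass] on each of n independent
    intervals. *)
Lemma BM_exits (a : R) : 0 < a -> outer_le P [set w | forall s : R, 0 <= s -> 0 < B s w < a] 0.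
Proof.
move=> a0; apply: outer_le_approx => e e0.
have [n hn] := power_small e0.
pose t (i : nat) : R := i%:R * a ^+ 2.
have a20 : 0 < a ^+ 2 by rewrite exprn_gt0.
apply: outer_le_sub (@BM_no_big_increment n t _ _).
- move=> w h i _; rewrite /t -mulrBl -natrB// subSnn mul1r sqrtr_sqr gtr0_norm//.
  have /andP[_ h1] : 0 < B (i.+1%:R * a ^+ 2) w < a by apply: h; rewrite mulr_ge0// ltW.
  have /andP[h2 _] : 0 < B (i%:R * a ^+ 2) w < a by apply: h; rewrite mulr_ge0// ltW.
  lra.
- by rewrite lee_fin ltW.
- by rewrite /t mul0r.
- by move=> i; rewrite /t ltr_pM2r// ltr_nat.
Qed.

Hypothesis x_gt0 : 0 < x.

(** Along fast geometric times, one standard deviation of the next increment exceeds the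
    displacement accumulated so far, up to a small probability. A single upward increment of that
    size then brings the path back to x or above. *)
Lemma BM_returns_positive (N : R) : outer_le P [set w | forall s : R, N <= s -> B s w <= 0] 0.
Proof.
apply: outer_le_approx => e e0; have e20 : 0 < e / 2 by rewrite divr_gt0.
have [n hn] := power_small e20.
(* Each of the n exceptional events has probability at most 8 / z^2; this z brings their total below
   e / 2. *)
pose z : R := 16 * n%:R / e + 1.
have z1 : 1 <= z by rewrite lerDr divr_ge0 ?mulr_ge0// ltW.
have z0 : 0 < z by lra.
pose N1 : R := Num.max 1 N.
have N10 : 0 < N1 by rewrite lt_max ltr01.
pose K : R := 4 * z + 1.
have K1 : 1 < K by rewrite /K; lra.
pose t (i : nat) : R := N1 * K ^+ i.
have K0 : 0 < K by lra.
have t_gt0 i : 0 < t i by rewrite mulr_gt0// exprn_gt0.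
have tSE i : t i.+1 - t i = 4 * z * t i by rewrite /t /K exprS; ring.
have tS i : t i < t i.+1 by rewrite -subr_gt0 tSE; apply: mulr_gt0 => //; apply: mulr_gt0.
have t_ge i : N <= t i.
  apply: (@le_trans _ _ N1); first by rewrite le_max lexx orbT.
  by rewrite /t ler_peMr ?exprn_ege1// ltW.
pose Xi i : set T := [set w | Num.sqrt (t i.+1 - t i) < `|B (t i) w - x| ].
have hX i : (i < n)%N -> outer_le P (Xi i) (8 / z ^+ 2)%:E.
  move=> _; apply: outer_le_sub (BM_tail (t_gt0 i) (sqrtr_ge0 (t i.+1 - t i))) => //.
  have -> : - Num.sqrt (t i.+1 - t i) ^+ 2 / (4 * t i) = - z.
    by rewrite sqr_sqrtr ?subr_ge0 ?(ltW (tS i))// tSE; field; rewrite gt_eqF.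
  rewrite lee_fin; apply: (@le_trans _ _ (2 * (4 / z ^+ 2))); last first.
    by rewrite le_eqVlt; apply/orP; left; apply/eqP; field; rewrite gt_eqF.
  apply: ler_pM; rewrite ?sqrtr_ge0 ?expR_ge0 ?expRN_le//.
  by rewrite -[leRHS](ger0_norm (ler0n _ 2)) -sqrtr_sqr ler_wsqrtr// expr2; lra.
apply: outer_le_sub (outer_leU (outer_le_exists hX) (@BM_no_big_increment n t (ltW (t_gt0 0%N)) tS)).
- move=> w h; have [[i ni Xw]|nX] := pselect (exists2 i, (i < n)%N & Xi i w).
    by left; exists i.
  right=> i ni; rewrite ltNge; apply/negP => big.
  have : ~ Xi i w by move=> Xw; apply: nX; exists i.
  rewrite /Xi/= => /negP; rewrite -leNgt ler_norml => /andP[h1 h2].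
  have h3 : B (t i.+1) w <= 0 by apply: h.
  move: h1 big h3 x_gt0; move: (Num.sqrt _) (B (t i.+1) w) (B (t i) w) => a b c; lra.
- rewrite -EFinD lee_fin.
  have : n%:R * (8 / z ^+ 2) <= e / 2.
    have -> : n%:R * (8 / z ^+ 2) = (16 * n%:R) / z ^+ 2 / 2 by field; rewrite gt_eqF.
    rewrite ler_pM2r// ler_pdivrMr ?exprn_gt0//.
    have -> : 16 * n%:R = e * (z - 1) by rewrite /z; field; rewrite gt_eqF.
    by rewrite ler_pM2l// expr2; nra.
  lra.
Qed.

End null_events.

(** * Assembly *)

Lemma first_exit (R : realType) (p : R -> R) (a : R) : continuous p -> 0 < p 0 < a ->
  (exists2 s : R, 0 <= s & ~ (0 < p s < a)) ->
  exists s : R, [/\ 0 < s, (forall r : R, 0 <= r -> r < s -> 0 < p r < a) & p s = 0 \/ p s = a].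
Proof.
move=> cp p0 [s0 s00 hs0].
pose S : set R := [set s | 0 <= s /\ ~ (0 < p s < a)].
have S_inf : has_inf S by split; [exists s0|exists 0 => s []].
pose s1 : R := inf S.
have s1_ge0 : 0 <= s1 by apply: lb_le_inf; [exists s0|move=> s []].
have before (r : R) : 0 <= r -> r < s1 -> 0 < p r < a.
  move=> r0 rs; apply: contrapT => hr.
  have : s1 <= r by apply: ge_inf; [exact: S_inf.2|split].
  by rewrite leNgt rs.
have at_s1 : ~ (0 < p s1 < a).
  move=> /andP[h1 h2].
  have e0 : 0 < Num.min (p s1) (a - p s1) by rewrite lt_min h1 subr_gt0.
  have [r r0 hr] := continuousP_dist (cp s1) e0.
  have [s Ss ss] := inf_adherent r0 S_inf; have [s_ge0 hs] := Ss; apply: hs.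
  have s1s : s1 <= s by apply: ge_inf => //; exact: S_inf.2.
  have : `|p s1 - p s| < Num.min (p s1) (a - p s1).
    by apply: hr; rewrite ler0_norm; move: ss; rewrite -/s1; lra.
  by rewrite lt_min !ltr_norml => /andP[/andP[g1 g2] /andP[g3 g4]]; apply/andP; split; lra.
have s1_gt0 : 0 < s1.
  by rewrite lt_neqAle s1_ge0 andbT eq_sym; apply/eqP => s10; apply: at_s1; rewrite s10.
have left_approx (e : R) : 0 < e -> exists2 s, 0 <= s < s1 & `|p s1 - p s| < e.
  move=> e0; have [r r0 hr] := continuousP_dist (cp s1) e0.
  exists (Num.max 0 (s1 - r / 2)).
    by rewrite le_max lexx gt_max s1_gt0/=; lra.
  apply: hr; rewrite ger0_norm; last by rewrite subr_ge0 ge_max s1_ge0/=; lra.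
  have : s1 - r / 2 <= Num.max 0 (s1 - r / 2) by rewrite le_max lexx orbT.
  lra.
exists s1; split => //.
have [p1|p1] := ltP (p s1) 0.
  have [s /andP[h1 h2]] := left_approx (- p s1) (ltac:(rewrite oppr_gt0 //)).
  have /andP[h3 _] := before s h1 h2.
  by rewrite ltr_norml => /andP[g1 g2]; lra.
have [p2|p2] := ltP a (p s1).
  have [s /andP[h1 h2]] := left_approx (p s1 - a) (ltac:(rewrite subr_gt0 //)).
  have /andP[_ h3] := before s h1 h2.
  by rewrite ltr_norml => /andP[g1 g2]; lra.
have [->|n0] := eqVneq (p s1) 0; first by left.
right; apply: contrapT => /eqP na; apply: at_s1.
by rewrite !lt_neqAle p1 p2 eq_sym n0 na.
Qed.

Section constants.
Variables (R : realType) (m : {measure set R -> \bar R}).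
Hypothesis hint : integral_condition m.

Lemma clock_bound_linear (x : R) (k : nat) (D t : R) :
  clock_bound m x k D t = x * clock_bound m 1 k D t.
Proof. by rewrite /clock_bound [RHS]mulrA; congr (_ * _); rewrite div1r. Qed.

Lemma expRN4_le (k : nat) : expR (- (4 * k%:R)) <= 16^-1 ^+ k :> R.
Proof.
rewrite mulrC -mulrN expRM_natl; apply: lerXn2r; rewrite ?nnegrE ?expR_ge0 ?invr_ge0//.
have h1 : 2 <= expR 1 :> R by have := expR_ge1Dx (1 : R); lra.
have h4 : expR 4 = expR 1 ^+ 4 :> R by rewrite -expRM_natl mulr1.
rewrite expRN lef_pV2 ?posrE ?expR_gt0// h4.
have -> : 16 = 2 ^+ 4 :> R by ring.
by rewrite lerXn2r ?nnegrE ?expR_ge0.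
Qed.

Lemma clock_bound_small (t : R) : 0 < t -> exists k0 D, (1 <= k0)%N /\
  forall k, (k0 <= k)%N -> (forall n, \sum_(i < n) level_const m (k + i) <= D) /\
    clock_bound m 1 k D t <= 16 * 4^-1 ^+ k.
Proof.
move=> t0; have [C hC] := level_const_sum hint; have g0 := gauss_mass_gt0 R.
pose s := level_const m.
have s_gt0 i : 0 < s i by exact: level_const_gt0.
have s_ge0 i : 0 <= s i by exact: ltW.
have s_ni := level_const_noninc hint.
(* The prefactor then uses up half of the decay, leaving lam g t / 4 out of lam g t / 2, where g is
   [gauss_mass R]. *)
pose D : R := gauss_mass R * t / (4 * (3 * (24 * 24))).
(* With lam = 1 / (8 * 24 * 24 * s k), the bound k s k <= e says that lam g t / 4 >= 4k. Then exp(-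
   4k) <= 16^-k turns the factor 16 * 4^k into 16 * 4^-k. *)
pose e : R := gauss_mass R * t / (16 * (8 * (24 * 24))).
have gt : 0 < gauss_mass R * t by exact: mulr_gt0.
have D0 : 0 < D by apply: divr_gt0.
have e0 : 0 < e by apply: divr_gt0.
have [k1 h1] := @tail_sum_small R s C s_ge0 hC D D0.
have [k2 h2] := @weighted_tail_small R s C s_ge0 s_ni hC e e0.
exists (maxn 1 (maxn k1 k2)), D; split; first exact: leq_maxl.
move=> k; rewrite !geq_max => /andP[k_ge1 /andP[kk1 kk2]].
split; first by move=> n; exact: h1.
pose lam := ladder_rate k s.
have lam0 : 0 < lam by rewrite invr_gt0 !mulr_gt0.
have lamE : lam * (8 * (24 * 24) * s k) = 1 by rewrite /lam /ladder_rate mulVf// gt_eqF// !mulr_gt0.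
have hk := h2 k kk2.
rewrite /clock_bound -/s -/lam.
have ex : 3 * (24 * 24 * lam * D) - lam * gauss_mass R * (t / 2) <= - (4 * k%:R).
  have -> : 3 * (24 * 24 * lam * D) - lam * gauss_mass R * (t / 2) = - (lam * (gauss_mass R * t / 4)).
    by rewrite /D; field.
  rewrite lerN2.
  have -> : 4 * k%:R = lam * (4 * (8 * (24 * 24)) * (k%:R * s k)).
    have -> : lam * (4 * (8 * (24 * 24)) * (k%:R * s k)) = lam * (8 * (24 * 24) * s k) * (4 * k%:R) by ring.
    by rewrite lamE mul1r.
  rewrite ler_pM2l//.
  have -> : gauss_mass R * t / 4 = 4 * (8 * (24 * 24)) * e by rewrite /e; field.
  by rewrite ler_wpM2l.
apply: (@le_trans _ _ (1 / (4^-1 ^+ k / 16) * 16^-1 ^+ k)).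
  rewrite ler_wpM2l ?divr_ge0 ?exprn_ge0//.
  by apply: le_trans (expRN4_le k); rewrite ler_expR.
have -> : 16^-1 = 4^-1 * 4^-1 :> R by field.
rewrite exprMn; have : 0 < 4^-1 ^+ k :> R by rewrite exprn_gt0.
move: (4^-1 ^+ k) => c c0; rewrite le_eqVlt; apply/orP; left; apply/eqP; field.
by rewrite gt_eqF.
Qed.

End constants.

(** * Slow absorption forces one of the bad events *)

Section cover.
Variables (R : realType) (m : {measure set R -> \bar R}).
Variables (d : measure_display) (T : measurableType d).
Variables (B : R -> T -> R) (L : R -> R -> T -> R) (w : T) (k0 : nat) (t : R).
Hypothesis hm : speed_measure m.
Hypothesis cB : {within `[0%R, +oo[, continuous (fun s => B s w)}.
Hypothesis hL : local_time_at B L w.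
Hypothesis B0 : 0 < B 0 w < 4^-1 ^+ k0 / 8.
Hypothesis exits : ~ (forall s : R, 0 <= s -> 0 < B s w < 4^-1 ^+ k0 / 8).
Hypothesis no_reach : ~ clock_event m B L 0 (4^-1 ^+ k0) (-1) w.
Hypothesis fast : forall i, ~ clock_event m B L 0 (4^-1 ^+ (k0 + i)) t w.
Hypothesis returns : forall n : nat, ~ (forall s : R, n%:R <= s -> B s w <= 0).

Lemma absorbed_before : (absorption_time m B L w <= t%:E)%E.
Proof.
pose p := path B w; have pE r : 0 <= r -> p r = B r w by exact: pathE.
have cp : continuous p by exact: continuous_path_R.
pose a : R := 4^-1 ^+ k0 / 8.
have hk0 : 0 < 4^-1 ^+ k0 :> R by rewrite exprn_gt0.
have a0 : 0 < a by rewrite divr_gt0.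
have A_ge0 s : (0 <= additive_functional m L s w)%E.
  by apply: integral_ge0 => y _; rewrite lee_fin; case: hL => h _ _.
have exits' : exists2 s, 0 <= s & ~ (0 < p s < a).
  apply: contrapT => h; apply: exits => s s0; apply: contrapT => hs.
  by apply: h; exists s => //; rewrite pE.
have p0 : 0 < p 0 < a by rewrite pE.
have [s1 [s10 before at_s1]] := first_exit cp p0 exits'.
case: at_s1 => ps1.
  have [n hn] : exists n : nat, s1 < n%:R.
    by exists (Num.bound s1); apply: archi_boundP; exact: ltW.
  have [s2 ns2 Bs2] : exists2 s, n%:R <= s & 0 < B s w.
    apply: contrapT => h; apply: (@returns n) => s ns; rewrite leNgt; apply/negP => Bs.
    by apply: h; exists s.
  apply: (@absorption_le R m T B L w hm cB hL t s1 s2) => //.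
  - by rewrite -pE// ltW.
  - move=> s /andP[s0 ss1].
    have cps : {within `[0, s], continuous p} by exact: continuous_subspaceT.
    have [c] := EVT_max s0 cps; rewrite in_itv/= => /andP[c0 cs] hc.
    have /andP[pc0 pca] := before c c0 (le_lt_trans cs ss1).
    have [n' hn'] := natSinv_small (divr_gt0 (mulr_gt0 (ltr0n _ 3) pc0) hk0).
    (* The factor 3 puts the maximum between 1/12 and 1/3 of 4^-(k0+i), strictly inside the band
       from 1/16 to 1/2. *)
    have /quaternary_level[i _ /andP[i1 i2]] : 4^-1 ^+ (k0 + n'.+1) <= 3 * p c <= 4^-1 ^+ k0.
      apply/andP; split; last by move: pca; rewrite /a; lra.
      have := hn' n' (leqnn _); rewrite ltr_pdivlMr// => h; apply: le_trans (ltW h).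
      rewrite exprD mulrC ler_pM2r//.
      by rewrite exprVn lef_pV2 ?posrE ?exprn_gt0// -natrX ler_nat ltnW// ltn_expl.
    rewrite leNgt; apply/negP => ht; apply: (@fast i); split => //; exists s; split => //.
    + move=> r /andP[r0 rs]; have /andP[h1 _] := before r r0 (le_lt_trans rs ss1).
      have := hc r; rewrite in_itv/= r0 rs => /(_ isT) h2.
      by rewrite -pE// h1/=; lra.
    + exists c; first by rewrite c0.
      by rewrite -pE//; move: i1; rewrite exprS; lra.
  - exact: lt_le_trans ns2.
(* The threshold -1 makes the clock condition automatic, so this event only records reaching the
   level. Just before s1 the path lies between a/2 and a, that is between 1/16 and 1/8 of 4^-k0. *)
exfalso; apply: no_reach; split => //.
have [r r0 hr] := continuousP_dist (cp s1) (divr_gt0 a0 (ltr0n R 2)).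
pose s : R := Num.max 0 (s1 - r / 2).
have s_ge0 : 0 <= s by rewrite le_max lexx.
have ss1 : s < s1 by rewrite gt_max s10/=; lra.
have hs : `|p s1 - p s| < a / 2.
  apply: hr; rewrite ger0_norm ?subr_ge0 ?ltW//.
  have : s1 - r / 2 <= s by rewrite le_max lexx orbT.
  lra.
exists s; split => //.
- move=> u /andP[u0 us]; rewrite -pE//.
  have /andP[-> h] := before u u0 (le_lt_trans us ss1).
  by rewrite /=; apply: (lt_le_trans h); rewrite /a; lra.
- exists s; first by rewrite s_ge0/=.
  by move: hs; rewrite ps1 -pE// ltr_norml /a => /andP[h1 h2]; lra.
- by apply: lt_le_trans (A_ge0 s); rewrite lte_fin; lra.
Qed.

End cover.

Section assembly.
Variables (R : realType) (m : {measure set R -> \bar R}).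
Hypothesis hm : speed_measure m.
Hypothesis hint : integral_condition m.

Lemma geometric_sum_le (x : R) (k n : nat) : 0 <= x ->
  \sum_(i < n) x * (16 * 4^-1 ^+ (k + i)) <= x * 32.
Proof.
move=> x0; rewrite -mulr_sumr ler_wpM2l//.
have h : \sum_(i < n) 4^-1 ^+ i <= 4 / 3 * (1 - 4^-1 ^+ n) :> R.
  elim: n => [|n IH]; first by rewrite big_ord0 expr0; lra.
  have h0 : 0 <= 4^-1 ^+ n :> R by rewrite exprn_ge0.
  by rewrite big_ord_recr/= exprS; move: IH h0; move: (\sum_(i < n) _) (4^-1 ^+ n) => a b; lra.
have -> : 32 = 16 * 2 :> R by ring.
rewrite -mulr_sumr ler_wpM2l//; apply: le_trans (_ : \sum_(i < n) 4^-1 ^+ i <= _).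
  by apply: ler_sum => i _; rewrite ler_wiXn2l ?invf_le1 ?ler1n// leq_addl.
have h0 : 0 <= 4^-1 ^+ n :> R by rewrite exprn_ge0.
lra.
Qed.

Lemma absorption_tail (t : R) : 0 < t -> exists At : R, forall x : R, 0 < x ->
  forall (d : measure_display) (T : measurableType d) (P : probability T R)
         (B : R -> T -> R) (L : R -> R -> T -> R),
  is_BM_from P x B -> is_local_time P B L ->
  outer_le P [set w | (t%:E < absorption_time m B L w)%E] (At * x)%:E.
Proof.
move=> t0; have [k0 [D [k0_ge1 hk]]] := clock_bound_small hint t0.
pose a : R := 4^-1 ^+ k0 / 8.
have a0 : 0 < a by rewrite divr_gt0// exprn_gt0.
pose C : R := clock_bound m 1 k0 D (-1).
have C0 : 0 <= C by rewrite mulr_ge0 ?expR_ge0// divr_ge0// divr_ge0// exprn_ge0.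
(* [C] pays for reaching the level a, 32 for the sum over the scales below it, and [a^-1] makes the
   bound at least 1 when x >= a. *)
exists (C + 32 + a^-1) => x x0 d T P B L hB hL.
have x_ge0 : 0 <= x by exact: ltW.
have [ax|xa] := leP a x.
  exists setT; split => //; apply: (le_trans (probability_le1 P measurableT)); rewrite lee_fin.
  apply: (@le_trans _ _ (a^-1 * x)).
    by rewrite mulrC ler_pdivlMr// mul1r.
  by rewrite ler_wpM2r// lerDr addr_ge0.
have [_ B0 cB _] := hB.
pose N : set T := ~` [set w | local_time_at B L w].
have hN : outer_le P N 0.
  case: hL => A [mA PA0 hA]; exists A; split => //; last by move: PA0 => /eqP; rewrite eq_le => /andP[].
  move=> w hw; apply: hA => /= h; apply: hw; case: h => L0 [cL occ]; by split.
pose Z (t' : R) (k : nat) : set T := clock_event m B L 0 (4^-1 ^+ k) t'.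
have hZ (t' : R) (k : nat) : (k0 <= k)%N -> outer_le P (Z t' k) (clock_bound m x k D t')%:E.
  move=> kk; apply: (clock_estimate hm hint L x_ge0 hB t' (leq_trans k0_ge1 kk)).
  by case: (hk k kk).
have hZt i : outer_le P (Z t (k0 + i)) (x * (16 * 4^-1 ^+ (k0 + i)))%:E.
  apply: outer_le_sub (hZ t (k0 + i)%N (leq_addr _ _)) => //.
  rewrite clock_bound_linear lee_fin ler_wpM2l//.
  by have [_] := hk (k0 + i)%N (leq_addr _ _).
pose U1 : set T := [set w | forall s : R, 0 <= s -> 0 < B s w < a].
pose U4 (n : nat) : set T := [set w | forall s : R, n%:R <= s -> B s w <= 0].
have := outer_leU (outer_leU (outer_leU (outer_leU hN (BM_exits hB a0))
  (outer_le_bigcup (fun n : nat => BM_returns_positive hB x0 n%:R)))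
  (hZ (-1) k0 (leqnn _))) (outer_le_bigcup hZt).
apply: outer_le_sub.
- move=> w /= tw; apply: contrapT => hw.
  have [hw1 [hw2 [hw3 [hw4 hw5]]]] : ~ N w /\ ~ U1 w /\ (forall n, ~ U4 n w) /\
      ~ Z (-1) k0 w /\ (forall i, ~ Z t (k0 + i)%N w).
    split=> [h|]; first by apply: hw; do 4 left.
    split=> [h|]; first by apply: hw; do 3 left; right.
    split=> [n h|]; first by apply: hw; do 2 left; right; exists n.
    split=> [h|i h]; first by apply: hw; left; right.
    by apply: hw; right; exists i.
  have /(le_lt_trans (absorbed_before hm (cB w) (contrapT hw1) _ hw2 hw4 hw5 hw3)) := tw.
  rewrite B0 x0 xa => /(_ isT).
  by rewrite ltxx.
- rewrite eseries0 // !add0e clock_bound_linear -/C.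
  have -> : (C + 32 + a^-1) * x = x * C + (x * 32 + a^-1 * x) by ring.
  rewrite EFinD leeD2l//.
  apply: (@le_trans _ _ (x * 32)%:E); last by rewrite lee_fin lerDl mulr_ge0// invr_ge0 ltW.
  apply: lime_le.
    by apply: is_cvg_nneseries => i _ _; rewrite lee_fin !mulr_ge0// exprn_ge0.
  by apply: nearW => n; rewrite sumEFin lee_fin big_mkord geometric_sum_le.
Qed.

End assembly.

Theorem mainTheorem10 (R : realType) (m : {measure set R -> \bar R})
  (hm : speed_measure m) (hcd : comes_down_from_infinity m)
  (hint : integral_condition m) :
  forall t : R, 0 < t -> exists At : R, forall x : R, 0 < x ->
  forall (d : measure_display) (T : measurableType d) (P : probability T R)
         (B : R -> T -> R) (L : R -> R -> T -> R),
  is_BM_from P x B -> is_local_time P B L ->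
  exists E : set T, [/\ measurable E,
    [set w | (t%:E < absorption_time m B L w)%E] `<=` E &
    (P E <= (At * x)%:E)%E].
Proof. exact: absorption_tail hm hint. Qed.
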